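(* Let $H$ be a connected, simply connected Lie group, $\Gamma\subset H$ a discrete, cocompact subgroup, $G$ an abelian group, and $(H/\Gamma,G)$ a flow on $H/\Gamma$ such that every $G$-invariant function $f\in C(H/\Gamma)$ is constant. Then every equicontinuous factor of $(H/\Gamma,G)$ is isomorphic to a minimal action of $G$ on some torus $\mathbb{T}^m$, $0\le m\le\operatorname{rank}(\Gamma/[\Gamma,\Gamma])$, via rotations.
   Context: A flow $(K,G)$ is a continuous action $G\times K\to K$ of a topological group $G$ on a compact Hausdorff space $K$. $C(K)$ is the space of continuous complex-valued functions on $K$; $f\in C(K)$ is $G$-invariant if $f(gx)=f(x)$ for all $g\in G$, $x\in K$. A factor of $(K,G)$ is a flow $(L,G)$ for which there is a continuous, surjective, $G$-equivariant map $K\to L$. A flow $(L,G)$ is equicontinuous if the family of maps $\{x\mapsto gx\mid g\in G\}\subset C(L,L)$ is (uniformly) equicontinuous, and minimal if every orbit is dense. Two flows of $G$ are isomorphic if there is a $G$-equivariant homeomorphism between them. An action of $G$ on $\mathbb{T}^m$ is via rotations if each $g\in G$ acts as $x\mapsto a_g+x$ for some $a_g\in\mathbb{T}^m$. For an abelian group $A$, $\operatorname{rank}(A)$ is its torsion-free rank $\dim_{\mathbb{Q}}(\mathbb{Q}\otimes A)$. *)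

(* Defs.v *)
From HB Require Import structures.
From mathcomp Require Import all_boot all_order all_algebra generic_quotient ring_quotient.
From mathcomp Require Import complex.
From mathcomp Require Import all_classical all_reals.
From mathcomp Require Import ereal topology normedtype derive.

Set Implicit Arguments.
Unset Strict Implicit.
Unset Printing Implicit Defensive.

Import Order.TTheory GRing.Theory Num.Theory.
Import numFieldNormedType.Exports.

Local Open Scope classical_set_scope.
Local Open Scope ring_scope.
Local Open Scope quotient_scope.

HB.mixin Record isTopGroup G of Topological G & Group G := {
  mulg_continuous : continuous (fun p : G * G => (p.1 * p.2)%g);
  invg_continuous : continuous (fun x : G => (x^-1)%g)
}.

#[short(type="topGroupType")]
HB.structure Definition TopGroup :=
  {G of Topological G & Group G & isTopGroup G}.

Section Cosets.
Context (gT : groupType) (S : groupClosed gT).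

Definition coset_rel (x y : gT) : bool := (x^-1 * y)%g \in S.

Lemma coset_rel_refl : reflexive coset_rel.
Proof. by move=> x; rewrite /coset_rel mulVg gpred1. Qed.

Lemma coset_rel_sym : symmetric coset_rel.
Proof. by move=> x y; rewrite /coset_rel -gpredV invgM invgK. Qed.

Lemma coset_rel_trans : transitive coset_rel.
Proof.
move=> y x z Sxy Syz; rewrite /coset_rel.
have -> : (x^-1 * z = x^-1 * y * (y^-1 * z))%g by rewrite !mulgA mulgK.
exact: gpredM.
Qed.

Canonical coset_equiv :=
  EquivRel coset_rel coset_rel_refl coset_rel_sym coset_rel_trans.

(* gT / S: the class of x is x S. *)
Definition cosets : Type := {eq_quot coset_equiv}.
HB.instance Definition _ := Choice.on cosets.
HB.instance Definition _ := EqQuotient.on cosets.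

End Cosets.

Definition coset_space (H : topGroupType) (S : groupClosed H) : Type :=
  quotient_topology (cosets S).
HB.instance Definition _ (H : topGroupType) (S : groupClosed H) :=
  Topological.on (coset_space S).

Section Subgroup.
Context (gT : groupType) (S : groupClosed gT).

Record subgroup : Type := Subgroup { subgroup_val : gT; _ : subgroup_val \in S }.

HB.instance Definition _ := [isSub for subgroup_val].
HB.instance Definition _ := [Choice of subgroup by <:].

Lemma subgroup_closed : group_closed S.
Proof. by split; [exact: gpred1 | exact: gpredF]. Qed.
HB.instance Definition _ :=
  SubChoice_isSubGroup.Build _ _ subgroup subgroup_closed.

End Subgroup.

Section LieGroups.
Context (R : realType).

Fixpoint Ck (k p q : nat) (U : set 'rV[R]_p) (f : 'rV[R]_p -> 'rV[R]_q) : Prop :=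
  {in U, continuous f} /\
  if k is k'.+1 then
    forall i : 'I_p,
      (forall x, U x -> derivable f x (delta_mx 0 i)) /\
      Ck k' U (fun x => 'D_(delta_mx 0 i) f x)
  else True.

Definition smooth_on (p q : nat) (U : set 'rV[R]_p)
    (f : 'rV[R]_p -> 'rV[R]_q) : Prop :=
  forall k, Ck k U f.

(* Only the restrictions of chart_map to chart_dom and of chart_inv to the
   image chart_cod are meaningful. *)
Record chart (n : nat) (M : Type) := Chart {
  chart_dom : set M;
  chart_map : M -> 'rV[R]_n;
  chart_inv : 'rV[R]_n -> M
}.

Definition chart_cod n M (c : chart n M) : set 'rV[R]_n :=
  chart_map c @` chart_dom c.

Record is_chart n (M : topologicalType) (c : chart n M) : Prop := {
  chart_dom_open : open (chart_dom c);
  chart_cod_open : open (chart_cod c);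
  chart_mapK : {in chart_dom c, cancel (chart_map c) (chart_inv c)};
  chart_map_continuous : {within chart_dom c, continuous (chart_map c)};
  chart_inv_continuous : {within chart_cod c, continuous (chart_inv c)}
}.

Record is_smooth_atlas n (M : topologicalType) (A : set (chart n M)) : Prop := {
  atlas_chart : forall c, A c -> is_chart c;
  atlas_cover : forall x : M, exists2 c, A c & chart_dom c x;
  atlas_smooth : forall c d, A c -> A d ->
    smooth_on (chart_cod c `&` chart_inv c @^-1` chart_dom d)
      (chart_map d \o chart_inv c)
}.

(* Smoothness of the group operations is read in charts; a point of
   R^n x R^n is a row vector of length n + n. *)
Record is_lie_atlas n (H : topGroupType) (A : set (chart n H)) : Prop := {
  lie_smooth_atlas : is_smooth_atlas A;
  lie_mul_smooth : forall c d e, A c -> A d -> A e ->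
    let m (z : 'rV[R]_(n + n)) :=
      (chart_inv c (lsubmx z) * chart_inv d (rsubmx z))%g in
    smooth_on
      [set z | chart_cod c (lsubmx z) /\ chart_cod d (rsubmx z) /\
               chart_dom e (m z)]
      (chart_map e \o m);
  lie_inv_smooth : forall c d, A c -> A d ->
    let i (z : 'rV[R]_n) := ((chart_inv c z)^-1)%g in
    smooth_on (chart_cod c `&` i @^-1` chart_dom d) (chart_map d \o i)
}.

Definition lie_group (H : topGroupType) : Prop :=
  [/\ hausdorff_space H,
      @second_countable H
    & exists (n : nat) (A : set (chart n H)), is_lie_atlas A].

(* F (s, t): s is the path parameter and t the homotopy parameter. *)
Definition simply_connected (X : topologicalType) : Prop :=
  (forall x y : X, exists p : R -> X,
     [/\ {within `[0, 1], continuous p}, p 0 = x & p 1 = y]) /\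
  (forall p : R -> X, {within `[0, 1], continuous p} -> p 0 = p 1 ->
     exists F : R * R -> X,
       {within `[0, 1] `*` `[0, 1], continuous F} /\
       forall t, t \in `[0, 1] ->
         [/\ F (t, 0) = p t, F (t, 1) = p 0, F (0, t) = p 0 & F (1, t) = p 0]).

End LieGroups.

Section Flows.
Context (G : topGroupType).

Record flow (K : topologicalType) (act : G -> K -> K) : Prop := {
  flow_compact : compact [set: K];
  flow_hausdorff : hausdorff_space K;
  flow_act1 : forall x, act 1%g x = x;
  flow_actM : forall g h x, act (g * h)%g x = act g (act h x);
  flow_continuous : continuous (fun p : G * K => act p.1 p.2)
}.

Definition equivariant (K L : Type) (actK : G -> K -> K) (actL : G -> L -> L)
    (f : K -> L) : Prop :=
  forall g x, f (actK g x) = actL g (f x).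

Definition is_factor (K L : topologicalType)
    (actK : G -> K -> K) (actL : G -> L -> L) : Prop :=
  exists f : K -> L,
    [/\ continuous f, range f = [set: L] & equivariant actK actL f].

Definition flow_isomorphic (K L : topologicalType)
    (actK : G -> K -> K) (actL : G -> L -> L) : Prop :=
  exists (f : K -> L) (f' : L -> K),
    [/\ cancel f f', cancel f' f, continuous f, continuous f'
      & equivariant actK actL f].

Definition invariant_fun (K T : Type) (act : G -> K -> K) (f : K -> T) : Prop :=
  forall g x, f (act g x) = f x.

(* A compact Hausdorff space carries exactly one uniformity inducing its
   topology, so working over a uniformType adds no data. *)
Definition equicontinuous_flow (L : uniformType) (act : G -> L -> L) : Prop :=
  forall E : set (L * L), entourage E ->
    exists2 D : set (L * L), entourage D &
      forall g x y, D (x, y) -> E (act g x, act g y).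

Definition minimal_flow (K : topologicalType) (act : G -> K -> K) : Prop :=
  forall x, dense (range (act^~ x)).

End Flows.

Section Torus.
Context (R : realType) (m : nat).

Definition int_lattice : {pred 'rV[R]_m} :=
  fun v => [forall i, v 0 i \is a Num.int].

Lemma int_lattice_closed : zmod_closed int_lattice.
Proof.
split; first by apply/forallP => i; rewrite mxE rpred0.
move=> u v /forallP Zu /forallP Zv; apply/forallP => i.
by rewrite !mxE rpredB.
Qed.
HB.instance Definition _ :=
  GRing.isZmodClosed.Build 'rV[R]_m int_lattice int_lattice_closed.

Definition torus : Type := quotient_topology (Quotient.quot int_lattice).
HB.instance Definition _ := Topological.on torus.
HB.instance Definition _ := GRing.Zmodule.copy torus (Quotient.quot int_lattice).

Definition via_rotations (G : Type) (act : G -> torus -> torus) : Prop :=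
  forall g, exists a : torus, forall x, act g x = a + x.

End Torus.

Section Abelianization.
Context (gT : groupType).

Definition derived : {pred gT} :=
  fun x => `[< forall S : groupClosed gT, (forall a b, [~ a, b]%g \in S) ->
                 x \in S >].

Lemma derived_closed : group_closed derived.
Proof.
split; first by apply/asboolP => S _; exact: gpred1.
move=> x y /asboolP Dx /asboolP Dy; apply/asboolP => S SR.
by apply: gpredF; [exact: Dx | exact: Dy].
Qed.
HB.instance Definition _ :=
  isInvClosed.Build gT derived (group_closedV derived_closed).
HB.instance Definition _ :=
  isMulClosed.Build gT derived (group_closedM derived_closed).
HB.instance Definition _ := isMul1Closed.Build gT derived derived_closed.1.

Lemma derived_commg a b : [~ a, b]%g \in derived.
Proof. by apply/asboolP => S; apply. Qed.

Definition abelianization : Type := cosets derived.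
HB.instance Definition _ := Choice.on abelianization.
HB.instance Definition _ := EqQuotient.on abelianization.

Definition ab_pi (x : gT) : abelianization := \pi x.

Lemma ab_piP x y : ab_pi x = ab_pi y <-> (x^-1 * y)%g \in derived.
Proof. by split=> [/eqmodP | ?]; last exact/eqmodP. Qed.

Lemma ab_piC x y : ab_pi (x * y)%g = ab_pi (y * x)%g.
Proof.
apply/ab_piP; rewrite invgM.
have -> : (y^-1 * x^-1 * (y * x) = [~ y, x])%g by rewrite commgEl conjgE !mulgA.
exact: derived_commg.
Qed.

Lemma ab_piM x x' y y' : ab_pi x = ab_pi x' -> ab_pi y = ab_pi y' ->
  ab_pi (x * y)%g = ab_pi (x' * y')%g.
Proof.
have mulL a b c : ab_pi b = ab_pi c -> ab_pi (a * b)%g = ab_pi (a * c)%g.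
  by move/ab_piP=> D; apply/ab_piP; rewrite invgM -mulgA mulKg.
by move=> Ex Ey; rewrite (mulL _ _ _ Ey) ab_piC (mulL _ _ _ Ex) ab_piC.
Qed.

Definition ab_add (u v : abelianization) := ab_pi (repr u * repr v)%g.
Definition ab_opp (u : abelianization) := ab_pi (repr u)^-1%g.
Definition ab_zero : abelianization := ab_pi 1%g.

Lemma ab_reprK u : ab_pi (repr u) = u. Proof. exact: reprK. Qed.

Lemma ab_addE x y : ab_add (ab_pi x) (ab_pi y) = ab_pi (x * y)%g.
Proof. by apply: ab_piM; rewrite ab_reprK. Qed.

Lemma ab_addA : associative ab_add.
Proof.
move=> u v w; rewrite -(ab_reprK u) -(ab_reprK v) -(ab_reprK w).
by rewrite !ab_addE mulgA.
Qed.

Lemma ab_addC : commutative ab_add.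
Proof. by move=> u v; rewrite /ab_add ab_piC. Qed.

Lemma ab_add0 : left_id ab_zero ab_add.
Proof. by move=> u; rewrite -(ab_reprK u) ab_addE mul1g. Qed.

Lemma ab_addN : left_inverse ab_zero ab_opp ab_add.
Proof. by move=> u; rewrite -{2}(ab_reprK u) ab_addE mulVg. Qed.

HB.instance Definition _ :=
  GRing.isZmodule.Build abelianization ab_addA ab_addC ab_add0 ab_addN.

Lemma ab_piD x y : ab_pi (x * y)%g = ab_pi x + ab_pi y.
Proof. by rewrite -ab_addE. Qed.

End Abelianization.

Section RatTensor.
Context (A : zmodType).

(* A formal sum [:: (q1, a1); ...; (qn, an)] stands for
   q1 (x) a1 + ... + qn (x) an; tensor_eq is the additive congruence generated
   by biadditivity of (x), so that the quotient is Q (x)_Z A. *)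
Inductive tensor_eq : seq (rat * A) -> seq (rat * A) -> Prop :=
| tensor_eq_refl s : tensor_eq s s
| tensor_eq_sym s t : tensor_eq s t -> tensor_eq t s
| tensor_eq_trans s t u : tensor_eq s t -> tensor_eq t u -> tensor_eq s u
| tensor_eq_cat s s' t t' :
    tensor_eq s s' -> tensor_eq t t' -> tensor_eq (s ++ t) (s' ++ t')
| tensor_eq_catC s t : tensor_eq (s ++ t) (t ++ s)
| tensor_eq_0l a : tensor_eq [:: (0, a)] [::]
| tensor_eq_Dl q r a : tensor_eq [:: (q + r, a)] [:: (q, a); (r, a)]
| tensor_eq_Dr q a b : tensor_eq [:: (q, a + b)] [:: (q, a); (q, b)].

Definition tensor_eqb s t : bool := `[< tensor_eq s t >].

Lemma tensor_eqb_refl : reflexive tensor_eqb.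
Proof. by move=> s; apply/asboolP; exact: tensor_eq_refl. Qed.

Lemma tensor_eqb_sym : symmetric tensor_eqb.
Proof. by move=> s t; apply/asboolP/asboolP; exact: tensor_eq_sym. Qed.

Lemma tensor_eqb_trans : transitive tensor_eqb.
Proof.
move=> t s u /asboolP st /asboolP tu; apply/asboolP.
exact: tensor_eq_trans st tu.
Qed.

Canonical tensor_equiv :=
  EquivRel tensor_eqb tensor_eqb_refl tensor_eqb_sym tensor_eqb_trans.

Definition rat_tensor : Type := {eq_quot tensor_equiv}.
HB.instance Definition _ := Choice.on rat_tensor.
HB.instance Definition _ := EqQuotient.on rat_tensor.

Definition tensor_pi (s : seq (rat * A)) : rat_tensor := \pi s.
Definition tensor (q : rat) (a : A) : rat_tensor := tensor_pi [:: (q, a)].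

Lemma tensor_piP s t : tensor_pi s = tensor_pi t <-> tensor_eq s t.
Proof.
by split=> [/eqmodP /asboolP | E] //; apply/eqmodP/asboolP.
Qed.

Lemma tensor_reprK x : tensor_pi (repr x) = x. Proof. exact: reprK. Qed.

Definition scale_sum (c : rat) (s : seq (rat * A)) : seq (rat * A) :=
  [seq (c * p.1, p.2) | p <- s].

Lemma scale_sum_eq c s t :
  tensor_eq s t -> tensor_eq (scale_sum c s) (scale_sum c t).
Proof.
elim=> {s t}.
- by move=> s; exact: tensor_eq_refl.
- by move=> s t _; exact: tensor_eq_sym.
- by move=> s t u _ st _; exact: tensor_eq_trans.
- by move=> s s' t t' _ ss _ tt; rewrite /scale_sum !map_cat; exact: tensor_eq_cat.
- by move=> s t; rewrite /scale_sum !map_cat; exact: tensor_eq_catC.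
- by move=> a; rewrite /scale_sum /= mulr0; exact: tensor_eq_0l.
- by move=> q r a; rewrite /scale_sum /= mulrDr; exact: tensor_eq_Dl.
- by move=> q a b; exact: tensor_eq_Dr.
Qed.

Lemma scale_sumD c d s :
  tensor_eq (scale_sum (c + d) s) (scale_sum c s ++ scale_sum d s).
Proof.
elim: s => [|[q a] s IH] /=; first exact: tensor_eq_refl.
rewrite -[_ :: scale_sum (c + d) s]cat1s -[(d * q, a) :: _]cat1s.
rewrite -[(c * q, a) :: _]cat1s mulrDl.
apply: (tensor_eq_trans (tensor_eq_cat (tensor_eq_Dl _ _ _) IH)).
rewrite -[[:: _; _]]cat1s -!catA; apply: tensor_eq_cat (tensor_eq_refl _) _.
rewrite !catA; apply: tensor_eq_cat (tensor_eq_refl _).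
exact: tensor_eq_catC.
Qed.

Lemma scale_sum0 s : tensor_eq (scale_sum 0 s) [::].
Proof.
elim: s => [|[q a] s IH] /=; first exact: tensor_eq_refl.
rewrite mul0r -[_ :: _]cat1s -[[::]]cats0.
exact: tensor_eq_cat (tensor_eq_0l _) IH.
Qed.

Definition tensor_add (x y : rat_tensor) := tensor_pi (repr x ++ repr y).
Definition tensor_scale (c : rat) (x : rat_tensor) :=
  tensor_pi (scale_sum c (repr x)).
Definition tensor_opp := tensor_scale (-1).
Definition tensor_zero : rat_tensor := tensor_pi [::].

Lemma tensor_addE s t : tensor_add (tensor_pi s) (tensor_pi t) = tensor_pi (s ++ t).
Proof.
by apply/tensor_piP/tensor_eq_cat; apply/tensor_piP; rewrite tensor_reprK.
Qed.

Lemma tensor_scaleE c s : tensor_scale c (tensor_pi s) = tensor_pi (scale_sum c s).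
Proof. by apply/tensor_piP/scale_sum_eq/tensor_piP; rewrite tensor_reprK. Qed.

Lemma tensor_addA : associative tensor_add.
Proof.
move=> x y z; rewrite -(tensor_reprK x) -(tensor_reprK y) -(tensor_reprK z).
by rewrite !tensor_addE catA.
Qed.

Lemma tensor_addC : commutative tensor_add.
Proof. by move=> x y; apply/tensor_piP; exact: tensor_eq_catC. Qed.

Lemma tensor_add0 : left_id tensor_zero tensor_add.
Proof. by move=> x; rewrite -(tensor_reprK x) tensor_addE. Qed.

Lemma scale_sum1 s : scale_sum 1 s = s.
Proof. by rewrite /scale_sum -[RHS]map_id; apply: eq_map => -[q a]; rewrite mul1r. Qed.

Lemma tensor_addN : left_inverse tensor_zero tensor_opp tensor_add.
Proof.
move=> x; rewrite -(tensor_reprK x) /tensor_opp tensor_scaleE tensor_addE.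
apply/tensor_piP; rewrite -[X in _ ++ X]scale_sum1.
apply: tensor_eq_trans (tensor_eq_sym (scale_sumD _ _ _)) _.
by rewrite addNr; exact: scale_sum0.
Qed.

HB.instance Definition _ := GRing.isZmodule.Build rat_tensor
  tensor_addA tensor_addC tensor_add0 tensor_addN.

Lemma tensor_piD s t : tensor_pi (s ++ t) = tensor_pi s + tensor_pi t.
Proof. by rewrite -tensor_addE. Qed.

Lemma tensor_scaleA c d x :
  tensor_scale c (tensor_scale d x) = tensor_scale (c * d) x.
Proof.
rewrite -(tensor_reprK x) !tensor_scaleE /scale_sum -map_comp.
by congr tensor_pi; apply: eq_map => p /=; rewrite mulrA.
Qed.

Lemma tensor_scale1 : left_id 1 tensor_scale.
Proof. by move=> x; rewrite -(tensor_reprK x) tensor_scaleE scale_sum1. Qed.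

Lemma tensor_scaleDr : right_distributive tensor_scale +%R.
Proof.
move=> c x y; rewrite -(tensor_reprK x) -(tensor_reprK y).
by rewrite -tensor_piD !tensor_scaleE -tensor_piD /scale_sum map_cat.
Qed.

Lemma tensor_scaleDl x : {morph tensor_scale^~ x : c d / c + d}.
Proof.
move=> c d; rewrite -(tensor_reprK x) !tensor_scaleE -tensor_piD.
by apply/tensor_piP; exact: scale_sumD.
Qed.

HB.instance Definition _ := GRing.Zmodule_isLmodule.Build rat rat_tensor
  tensor_scaleA tensor_scale1 tensor_scaleDr tensor_scaleDl.

Lemma tensor_universal (W : zmodType) (b : rat -> A -> W) :
    (forall q r a, b (q + r) a = b q a + b r a) ->
    (forall q a a', b q (a + a') = b q a + b q a') ->
  exists2 f : rat_tensor -> W,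
    {morph f : x y / x + y} & forall q a, f (tensor q a) = b q a.
Proof.
move=> bDl bDr.
pose ev (s : seq (rat * A)) := \sum_(p <- s) b p.1 p.2.
have evP s t : tensor_eq s t -> ev s = ev t.
  elim=> {s t} //.
  - by move=> s t u _ -> _ ->.
  - by move=> s s' t t' _ + _ +; rewrite /ev !big_cat /= => -> ->.
  - by move=> s t; rewrite /ev !big_cat /= addrC.
  - move=> a; rewrite /ev big_seq1 big_nil /=.
    by apply: (addrI (b 0 a)); rewrite -bDl !addr0.
  - by move=> q r a; rewrite /ev !big_cons !big_nil /= bDl !addr0.
  - by move=> q a a'; rewrite /ev !big_cons !big_nil /= bDr !addr0.
have fE s : ev (repr (tensor_pi s)) = ev s.
  by apply: evP; apply/tensor_piP; rewrite tensor_reprK.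
exists (fun x => ev (repr x)) => [x y | q a]; last by rewrite fE /ev big_seq1.
rewrite -(tensor_reprK x) -(tensor_reprK y) -tensor_piD !fE.
by rewrite /ev big_cat.
Qed.

End RatTensor.

Definition lin_indep (V : lmodType rat) (m : nat) (v : 'I_m -> V) : Prop :=
  forall c : 'I_m -> rat, \sum_i c i *: v i = 0 -> forall i, c i = 0.

(* +oo for an infinite-dimensional V; R only supplies the codomain. *)
Definition rat_dim (R : realType) (V : lmodType rat) : \bar R :=
  ereal_sup [set m%:R%:E | m in
    [set m : nat | exists v : 'I_m -> V, lin_indep v]].

Definition rank (R : realType) (A : zmodType) : \bar R :=
  rat_dim R (rat_tensor A).

(* Main.v *)
From HB Require Import structures.
Require Import Defs.
From mathcomp Require Import all_boot all_order all_algebra complex.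
From mathcomp Require Import all_classical all_reals.
From mathcomp Require Import ereal topology normedtype derive.
From mathcomp Require Import generic_quotient ring_quotient spectral trigo.
From mathcomp Require Import ring lra zify.

(** Let [K] be the coset space and [L] the equicontinuous factor.

    The factor is minimal: for continuous [f] the function
    [z |-> sup_g f (g z)] on [L] is invariant, it is continuous by
    equicontinuity, and so it is constant ([equicont_minimal]).

    A minimal equicontinuous flow of an abelian group has enough continuous
    eigenfunctions to separate points ([rot_pair_separates]); this replaces the
    duality theory of compact abelian groups. Averages of a continuous function
    over finite sets of group elements approach a constant uniformly, which
    defines an invariant mean without measure theory ([is_mean_ex]). The orbit
    pseudometrics [sup_g |f (g x) - f (g y)|] are invariant continuous kernels;
    they give compact self-adjoint operators that commute with the action. If
    such an operator did not vanish on the orthogonal complement [V] of the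
    eigenfunctions, its square would have an eigenvector in [V]
    ([kop_sqr_eigen]), the eigenspace in [V] would be finite-dimensional by
    Bessel's inequality, and a common eigenvector of the commuting matrices by
    which the group acts on it would be an eigenfunction in [V], orthogonal to
    itself ([eig_eq0]). Kernels concentrated near the diagonal then show
    [V = 0].

    An eigenfunction has constant modulus, so it pulls back to a circle-valued
    function on the simply connected group [H], which has a continuous argument
    [h] ([circle_lift]). The function [h] changes under right multiplication by
    [Gamma] through a homomorphism from [Gamma] to the integers, the winding
    numbers. If they vanish, [h] is a bounded function on [K] that every [g]
    translates by a constant; the constant is 0 by boundedness, and [h] is
    constant because invariant functions are ([eigen_arg_eq0]). So the group of
    arguments embeds in the integer-valued homomorphisms of [Gamma]. Since
    [Gamma] is generated by a finite set ([fin_gen_lattice]), this group is free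
    of some finite rank [m] ([eigen_basis]), and independent homomorphisms of
    [Gamma] to the integers bound [m] by the rank of the abelianization
    ([basis_rank]).

    The [m] arguments of a basis map [L] continuously to the torus. The map is
    injective because eigenfunctions separate points, and surjective because the
    means of the eigenfunctions vanish, which contradicts the smallness on [L]
    of high powers of a kernel that peaks at a missed point ([torus_map_surj]).
    By compactness it is a homeomorphism, and it turns the action of each [g]
    into the rotation by the arguments of its eigenvalues. *)

Set Implicit Arguments.
Unset Strict Implicit.
Unset Printing Implicit Defensive.

Import Order.TTheory GRing.Theory Num.Theory numFieldNormedType.Exports.
Local Open Scope classical_set_scope.
Local Open Scope ring_scope.

(** * Continuous real functions *)

Lemma cont_comp (X Y Z : topologicalType) (g : Y -> X) (f : X -> Z) :
  continuous g -> continuous f -> continuous (fun y => f (g y)).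
Proof.
by move=> cg cf y; apply: (@continuous_comp _ _ _ g f); [exact: cg|exact: cf].
Qed.

Section RealContinuity.
Context (R : realType) (X : topologicalType).
Implicit Types f g : X -> R.

Lemma cont_cst (c : R) : continuous (fun _ : X => c).
Proof. by move=> x; exact: cvg_cst. Qed.

Lemma cont_add f g : continuous f -> continuous g ->
  continuous (fun x => f x + g x).
Proof. by move=> cf cg x; apply: cvgD; [exact: cf|exact: cg]. Qed.

Lemma cont_opp f : continuous f -> continuous (fun x => - f x).
Proof. by move=> cf x; apply: cvgN; exact: cf. Qed.

Lemma cont_sub f g : continuous f -> continuous g ->
  continuous (fun x => f x - g x).
Proof. by move=> cf cg; apply: cont_add => //; exact: cont_opp. Qed.

Lemma cont_mul f g : continuous f -> continuous g ->
  continuous (fun x => f x * g x).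
Proof. by move=> cf cg x; apply: cvgM; [exact: cf|exact: cg]. Qed.

Lemma cont_exp f n : continuous f -> continuous (fun x => f x ^+ n).
Proof.
move=> cf; elim: n => [|n IHn].
  by under eq_fun do rewrite expr0; exact: cont_cst.
by under eq_fun do rewrite exprS; exact: cont_mul.
Qed.

Lemma cont_norm f : continuous f -> continuous (fun x => `|f x|).
Proof. by move=> cf x; apply: cvg_norm; exact: cf. Qed.

Lemma cont_sum (I : Type) (s : seq I) (F : I -> X -> R) :
  (forall i, continuous (F i)) -> continuous (fun x => \sum_(i <- s) F i x).
Proof.
move=> cF; elim: s => [|i s IHs].
  by under eq_fun do rewrite big_nil; exact: cont_cst.
by under eq_fun do rewrite big_cons; exact: cont_add.
Qed.

Lemma cont_near f x (e : R) : continuous f -> 0 < e ->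
  \forall x' \near x, `|f x' - f x| <= e.
Proof.
move=> cf e0; have /cvgrPdist_le/(_ e e0) := cf x.
by apply: filterS => y; rewrite distrC.
Qed.

Lemma cont_nearP f :
  (forall x (e : R), 0 < e -> \forall x' \near x, `|f x' - f x| <= e) ->
  continuous f.
Proof.
move=> nf x; apply/cvgrPdist_le => e e0.
by have := nf x e e0; apply: filterS => y; rewrite distrC.
Qed.

Lemma compact_bounded_fun f : compact [set: X] -> continuous f ->
  exists2 B : R, 0 < B & forall x, `|f x| <= B.
Proof.
move=> /compact_near_coveringP Xc cf.
have := Xc R (+oo%R : set_system R) (fun B x => `|f x| <= B) _.
case=> [x _|B [_ HB]].
  have := cont_near x cf (@ltr01 R).
  move=> nx; exists ([set y | `|f y - f x| <= 1], [set B | `|f x| + 1 <= B]).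
    split=> //=; exists (`|f x| + 1); split; first exact: num_real.
    by move=> y /ltW.
  move=> [y b] [/= fy fb]; apply: le_trans fb.
  have -> : f y = f x + (f y - f x) by ring.
  by apply: le_trans (ler_normD _ _) _; rewrite lerD2l.
exists (`|B| + 1) => [|x]; first by rewrite ltr_wpDl.
apply: HB => //; apply: le_lt_trans (ler_norm B) _.
by rewrite ltrDl.
Qed.

End RealContinuity.

Lemma compact_finite_cover (X : topologicalType) (I : choiceType) (A : set X)
    (U : I -> set X) :
  compact A -> (forall x, A x -> exists i, nbhs x (U i)) ->
  exists s : seq I, forall x, A x -> exists2 i, i \in s & U i x.
Proof.
move=> /compact_near_coveringP Ac AU.
(* finite lists of indices, directed by inclusion *)
pose FS : set_system (seq I) :=
  filter_from setT (fun s : seq I => [set t : seq I | {subset s <= t}]).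
have FF : Filter FS.
  apply: filter_from_filter; first by exists [::].
  move=> s1 s2 _ _; exists (s1 ++ s2) => // t st.
  by split=> i si; apply: st; rewrite mem_cat si ?orbT.
have near_x x : A x -> \forall x' \near x & s \near FS,
    exists2 i, i \in s & U i x'.
  move=> Ax; have [i Ui] := AU x Ax; exists (U i, [set s : seq I | i \in s]).
    by split=> //=; exists [:: i] => // t; apply; rewrite mem_head.
  by move=> [y t] /= [Uy it]; exists i.
have [s _ sP] := Ac _ _ _ FF near_x.
by exists s => x Ax; have := sP s (fun _ => id) x Ax.
Qed.

Lemma invSn_small (R : realType) (e : R) : 0 < e ->
  exists N, forall n, (N <= n)%N -> n.+1%:R^-1 <= e.
Proof.
move=> e0; exists (Num.bound e^-1) => n Nn.
have e0' : 0 <= e^-1 by rewrite invr_ge0 ltW.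
have bd := archi_boundP e0'.
rewrite -[leRHS]invrK lef_pV2 ?posrE ?invr_gt0 //.
by apply: (le_trans (ltW bd)); rewrite ler_nat (leq_trans Nn).
Qed.

(** A form of the Arzela-Ascoli theorem that avoids metrizability: the limit is
    taken pointwise along an ultrafilter, and equicontinuity makes it
    uniform. *)
Lemma ascoli_cluster (R : realType) (L : topologicalType) (u : nat -> L -> R)
    (B : R) :
  compact [set: L] -> (forall n x, `|u n x| <= B) ->
  (forall x (e : R), 0 < e ->
    \forall x' \near x, forall n, `|u n x' - u n x| <= e) ->
  exists2 v : L -> R, continuous v & forall (e : R) N, 0 < e ->
    exists2 n, (N <= n)%N & forall x, `|u n x - v x| <= e.
Proof.
move=> /compact_near_coveringP Lc uB ueq.
have [U [UU oU]] := ultraFilterLemma (eventually_filter : ProperFilter \oo).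
have UF : Filter U := @filter_filter _ _ (@ultra_proper _ _ UU).
have ptlim x : exists p : R, (u ^~ x) @ U --> p.
  have FF : ProperFilter ((u ^~ x) @ U) by exact: fmap_proper_filter.
  have UB : ((u ^~ x) @ U) [set` `[- B, B]].
    by apply: (@filterE _ U) => n; rewrite /= in_itv /= -ler_norml.
  have [p [_ cp]] := @segment_compact R (- B) B _ FF UB.
  exists p => V pV; have [//|UVc] := in_ultra_setVsetC (u ^~ x @^-1` V) UU.
  by have [y [yVc yV]] := cp (~` V) V UVc pV.
pose v x := xget 0 [set p | (u ^~ x) @ U --> p].
have vP x : (u ^~ x) @ U --> v x by exact: (xgetPex 0 (ptlim x)).
have near_v x (e : R) : 0 < e -> U [set n | `|u n x - v x| <= e].
  by move=> e0; have /cvgrPdist_le/(_ e e0) := vP x; apply: filterS => n; rewrite distrC.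
have veq x (e : R) : 0 < e -> \forall x' \near x, `|v x' - v x| <= e.
  move=> e0; have e30 : 0 < e / 3 by rewrite divr_gt0.
  have := ueq x (e / 3) e30; apply: filterS => x' xP.
  have [n [/= n1 n2]] := filter_ex (filterI (near_v x _ e30) (near_v x' _ e30)).
  move: n1 n2 (xP n); rewrite !ler_norml => /andP[? ?] /andP[? ?] /andP[? ?].
  by apply/andP; split; lra.
exists v; first by apply: cont_nearP.
move=> e N e0; have e30 : 0 < e / 3 by rewrite divr_gt0.
have /Lc unif : forall x, [set: L] x -> \forall x' \near x & n \near U,
    `|u n x' - v x'| <= e.
  move=> x _; exists ([set x' | (forall n, `|u n x' - u n x| <= e / 3) /\
      `|v x' - v x| <= e / 3], [set n | `|u n x - v x| <= e / 3]).
    split=> /=; last exact: near_v.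
    by apply: filterI; [exact: ueq|exact: veq].
  move=> [x' n] /= [[h1 h2] h3].
  move: (h1 n) h2 h3; rewrite !ler_norml => /andP[? ?] /andP[? ?] /andP[? ?].
  by apply/andP; split; lra.
have UN : U [set n | (N <= n)%N] by apply: oU; exists N.
by have [n [/= Nn nP]] := filter_ex (filterI UN unif); exists n => // x; exact: nP.
Qed.

(** * The invariant mean of a minimal equicontinuous flow *)

(** What the construction of eigenfunctions uses of a flow.  The field
    [emf_equi] is equicontinuity as seen by real functions: the orbit
    pseudometrics [sup_g |f (g x) - f (g y)|] are continuous. *)
Record eq_min_flow (R : realType) (G : groupType) (L : topologicalType)
    (act : G -> L -> L) : Prop := {
  emf_compact : compact [set: L];
  emf_act1 : forall x, act 1%g x = x;
  emf_actM : forall g h x, act (g * h)%g x = act g (act h x);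
  emf_cont : forall g, continuous (act g);
  emf_equi : forall f : L -> R, continuous f -> forall y (e : R), 0 < e ->
    \forall x \near y, forall g, `|f (act g x) - f (act g y)| <= e;
  emf_mini : forall (x y : L) (U : set L), nbhs y U -> exists g, U (act g x);
  emf_comm : forall g h : G, commute g h;
  emf_nonempty : [set: L] !=set0
}.

Section Mean.
Context (R : realType) (G : groupType) (L : topologicalType).
Context (act : G -> L -> L).
Hypothesis F : eq_min_flow R act.

Let Lc : compact [set: L] := emf_compact F.
Let actM := emf_actM F.
Let act_cont := emf_cont F.
Let Gab := emf_comm F.
Let equi := emf_equi F.
Let mini := emf_mini F.

Implicit Types (f : L -> R) (s t : seq G).

Definition avg s f x : R := (size s)%:R^-1 * \sum_(g <- s) f (act g x).

Definition seq_mul s t : seq G := [seq (h * g)%g | g <- s, h <- t].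

Lemma seq_mul_neq0 s t : s != [::] -> t != [::] -> seq_mul s t != [::].
Proof. by case: s => // a s; case: t => // b t. Qed.

Lemma avg_mul s t f x : avg (seq_mul s t) f x = avg s (avg t f) x.
Proof.
rewrite /avg big_allpairs_dep /= size_allpairs natrM invfM -mulrA; congr (_ * _).
rewrite mulr_sumr; apply: eq_bigr => g _; congr (_ * _).
by apply: eq_bigr => h _; rewrite actM.
Qed.

Lemma avgC s t f x : avg s (avg t f) x = avg t (avg s f) x.
Proof.
rewrite /avg.
under eq_bigr do rewrite mulr_sumr.
under [in RHS]eq_bigr do rewrite mulr_sumr.
rewrite !mulr_sumr.
under eq_bigr do rewrite mulr_sumr.
under [in RHS]eq_bigr do rewrite mulr_sumr.
rewrite exchange_big /=; apply: eq_bigr => h _; apply: eq_bigr => g _.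
by rewrite -!actM Gab mulrCA.
Qed.

Lemma avg_cst s c x : s != [::] -> avg s (fun=> c) x = c.
Proof.
move=> s0; rewrite /avg big_const_seq count_predT iter_addr_0.
by rewrite -[c *+ _]mulr_natl mulKf // pnatr_eq0 size_eq0.
Qed.

Lemma avgD s f g x : avg s (fun y => f y + g y) x = avg s f x + avg s g x.
Proof. by rewrite /avg big_split /= mulrDr. Qed.

Lemma avgZ s c f x : avg s (fun y => c * f y) x = c * avg s f x.
Proof. by rewrite /avg -mulr_sumr mulrCA. Qed.

Lemma avg_le s f h x : (forall g, f (act g x) <= h (act g x)) ->
  avg s f x <= avg s h x.
Proof.
by move=> fh; rewrite ler_wpM2l ?invr_ge0 ?ler0n // ler_sum.
Qed.

Lemma avg_near s f x y e : s != [::] ->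
  (forall g, `|f (act g x) - f (act g y)| <= e) -> `|avg s f x - avg s f y| <= e.
Proof.
move=> s0 fxy; rewrite /avg -mulrBr -sumrB -[e](avg_cst e x s0) /avg normrM.
rewrite ger0_norm ?invr_ge0 ?ler0n // ler_wpM2l ?invr_ge0 ?ler0n //.
by apply: le_trans (ler_norm_sum _ _ _) _; apply: ler_sum.
Qed.

Lemma avg_dist s f c e x : s != [::] -> (forall y, `|f y - c| <= e) ->
  `|avg s f x - c| <= e.
Proof.
move=> s0 fce; rewrite ler_distl -[c - e](avg_cst _ x s0) -[c + e](avg_cst _ x s0).
by apply/andP; split; apply: avg_le => g; have := fce (act g x);
  rewrite ler_distl => /andP[].
Qed.

Lemma avg_act s f h x : avg s (fun y => f (act h y)) x = avg s f (act h x).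
Proof.
by congr (_ * _); apply: eq_bigr => g _; rewrite -!actM Gab.
Qed.

(** Averaging operators are directed by composition, which makes sense because
    they commute. *)
Definition avgF : set_system (seq G) :=
  filter_from [set s | s != [::]]
    (fun s => [set t | t != [::] /\ exists2 r, r != [::] &
       forall f x, avg t f x = avg r (avg s f) x]).

Lemma avgF_filter : ProperFilter avgF.
Proof.
apply: filter_from_proper.
  apply: filter_from_filter; first by exists [:: 1%g].
  move=> s1 s2 s10 s20; exists (seq_mul s1 s2); first exact: seq_mul_neq0.
  move=> t [t0 [r r0 tr]]; split; split=> //.
    exists (seq_mul r s2) => [|f x]; first exact: seq_mul_neq0.
    rewrite tr avg_mul; congr (_ * _); apply: eq_bigr => g _.
    by rewrite avg_mul avgC.
  exists (seq_mul r s1) => [|f x]; first exact: seq_mul_neq0.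
  rewrite tr avg_mul; congr (_ * _); apply: eq_bigr => g _.
  by rewrite avg_mul.
move=> s s0; exists s; split=> //; exists [:: 1%g] => // f x.
rewrite {2}/avg /= big_seq1 invr1 mul1r; congr (_ * _).
by apply: eq_bigr => g _; rewrite -actM mulg1.
Qed.
#[local] Existing Instance avgF_filter.

(** Stated along the filter [avgF], so that finitely many functions have a
    common good average. *)
Definition is_mean f c : Prop :=
  forall e : R, 0 < e -> avgF [set s | forall x, `|avg s f x - c| <= e].

Lemma is_meanP f c :
  (forall e : R, 0 < e -> exists2 s, s != [::] & forall x, `|avg s f x - c| <= e) ->
  is_mean f c.
Proof.
move=> fc e /fc[s s0 sfc]; exists s => // t [_ [r r0 tr]] x.
by rewrite tr; apply: avg_dist.
Qed.

Lemma avgF_neq0 : avgF [set s | s != [::]].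
Proof. by exists [:: 1%g] => // t []. Qed.

Lemma is_mean_unique f c d : is_mean f c -> is_mean f d -> c = d.
Proof.
move=> fc fd; have [x0 _] := emf_nonempty F.
apply/eqP; rewrite eq_sym -subr_eq0 -normr_le0.
apply/ler_addgt0Pl => e e0; rewrite addr0.
have e20 : 0 < e / 2 by rewrite divr_gt0.
have [s [/= sc sd]] := filter_ex (filterI (fc _ e20) (fd _ e20)).
have := sc x0; have := sd x0; rewrite !ler_norml => /andP[? ?] /andP[? ?].
by apply/andP; split; lra.
Qed.

(** The infimum [c] of all upper bounds of averages of [f] is the mean: an
    average [phi] that is nearly below [c] cannot dip below [c - e], since a
    point of [phi] that low would, by equicontinuity and minimality, be felt
    with a fixed weight everywhere after one more averaging, and the resulting
    average would lie below [c]. *)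
Lemma is_mean_ex f : continuous f -> exists c, is_mean f c.
Proof.
move=> cf; have [x0 _] := emf_nonempty F.
pose U := [set u | exists2 s, s != [::] & forall x, avg s f x <= u].
have [B B0 fB] := compact_bounded_fun Lc cf.
have U0 : U !=set0.
  exists B; exists [:: 1%g] => // x.
  rewrite -[leRHS](avg_cst B x (isT : [:: 1%g : G] != [::])); apply: avg_le => g.
  by apply: le_trans (ler_norm _) _.
have lbU : has_lbound U.
  exists (- B) => u [s s0 su]; apply: le_trans (su x0).
  rewrite -[leLHS](avg_cst _ x0 s0); apply: avg_le => g.
  by rewrite lerNl; apply: le_trans (ler_norm _) _; rewrite normrN.
exists (inf U); apply: is_meanP => e e0; set c := inf U.
have Uc u : U u -> c <= u by move=> Uu; exact: ge_inf.
have e40 : 0 < e / 4 by rewrite divr_gt0.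
(* finitely many group elements bring every point close to [x0] *)
have [r r0 rP] : exists2 r, r != [::] & forall x, exists2 g, g \in r &
    forall h, `|f (act h (act g x)) - f (act h x0)| <= e / 4.
  pose Ux := [set y | forall h, `|f (act h y) - f (act h x0)| <= e / 4].
  have nUx : nbhs x0 Ux by exact: equi.
  have [|s sP] := compact_finite_cover (U := fun g => act g @^-1` Ux) Lc.
    move=> x _; have [g gU] := mini x (nbhs_interior nUx).
    by exists g; exact: act_cont.
  exists s => [|x]; last exact: sP.
  by have [g] := sP x0 Logic.I; case: (s).
pose k := (size r)%:R : R.
have k0 : 0 < k by rewrite ltr0n lt0n size_eq0.
have ek0 : 0 < e / 4 / k by rewrite divr_gt0.
have [u [s s0 su] uc] := inf_adherent ek0 (conj U0 lbU).
have ele : e / 4 / k <= e.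
  rewrite ler_pdivrMr // ler_pdivrMr // -mulrA ler_peMr ?(ltW e0) //.
  have k1 : 1 <= k by rewrite ler1n lt0n size_eq0.
  by lra.
exists s => // y; rewrite ler_norml; apply/andP; split; last first.
  by rewrite lerBlDl; apply: le_trans (su y) _; apply: (le_trans (ltW uc)); rewrite lerD2l.
rewrite leNgt; apply/negP => low.
have [h hP] := mini x0 (@equi _ cf y _ e40).
suff /Uc : U (c - e / 4 / k) by rewrite lerBrDl gerDr leNgt ek0.
exists (seq_mul r (seq_mul [:: h] s)) => [|x]; first by rewrite !seq_mul_neq0.
have -> : avg (seq_mul r (seq_mul [:: h] s)) f x
        = k^-1 * \sum_(g <- r) avg s f (act h (act g x)).
  rewrite avg_mul {1}/avg; congr (_ * _); apply: eq_bigr => g _.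
  by rewrite avg_mul {1}/avg big_seq1 invr1 mul1r.
have [g gr gP] := rP x.
have smallg : avg s f (act h (act g x)) <= c - e / 2.
  have h1 : `|avg s f (act h (act g x)) - avg s f (act h x0)| <= e / 4.
    by apply: avg_near => // g'; have := gP (g' * h)%g; rewrite !actM.
  have h2 : `|avg s f (act h x0) - avg s f y| <= e / 4 by apply: avg_near.
  move: h1 h2; rewrite !ler_norml => /andP[_ ?] /andP[_ ?].
  by move: low; lra.
rewrite ler_pdivrMl // mulrBr mulrCA divff ?gt_eqF // mulr1.
rewrite (big_rem g) //=.
have : \sum_(z <- rem g r) avg s f (act h (act z x)) <=
       \sum_(z <- rem g r) (c + e / 4 / k).
  by apply: ler_sum => z _; apply: le_trans (su _) (ltW uc).
rewrite big_const_seq count_predT iter_addr_0 size_rem //.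
rewrite -[_ *+ (size r).-1]mulr_natl.
have -> : ((size r).-1)%:R = k - 1 :> R.
  by rewrite -subn1 natrB ?lt0n ?size_eq0.
rewrite mulrBl mulrDr mul1r => bound.
have kek : k * (e / 4 / k) = e / 4 by rewrite mulrCA divff ?gt_eqF // mulr1.
rewrite kek in bound *.
by lra.
Qed.

Definition mean f : R := xget 0 [set c | is_mean f c].

Lemma meanE f c : is_mean f c -> mean f = c.
Proof. by move=> fc; apply: xget_unique => // d /is_mean_unique; apply. Qed.

Lemma meanP f : continuous f -> is_mean f (mean f).
Proof. by move=> /is_mean_ex[c fc]; rewrite (meanE fc). Qed.

Lemma mean_cst c : mean (fun=> c) = c.
Proof.
apply: meanE; apply: is_meanP => e e0; exists [:: 1%g] => // x.
by rewrite avg_cst // subrr normr0 ltW.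
Qed.

Lemma meanD f g : continuous f -> continuous g ->
  mean (fun x => f x + g x) = mean f + mean g.
Proof.
move=> cf cg; apply: meanE => e e0.
have e20 : 0 < e / 2 by rewrite divr_gt0.
apply: filterS2 (meanP cf e20) (meanP cg e20) => s /= sf sg x; rewrite avgD.
have -> : avg s f x + avg s g x - (mean f + mean g) =
  (avg s f x - mean f) + (avg s g x - mean g) by ring.
apply: le_trans (ler_normD _ _) _; by rewrite (splitr e) lerD.
Qed.

Lemma meanZ c f : continuous f -> mean (fun x => c * f x) = c * mean f.
Proof.
move=> cf; apply: meanE => e e0.
have e20 : 0 < e / (`|c| + 1) by rewrite divr_gt0 // ltr_wpDl.
have := meanP cf e20; apply: filterS => s /= sP x.
rewrite avgZ -mulrBr normrM.
apply: (@le_trans _ _ (`|c| * (e / (`|c| + 1)))); first by rewrite ler_wpM2l.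
rewrite mulrCA ler_piMr ?(ltW e0) // ler_pdivrMr ?ltr_wpDl // mul1r.
by rewrite lerDl.
Qed.

Lemma meanN f : continuous f -> mean (fun x => - f x) = - mean f.
Proof.
by move=> cf; rewrite -mulN1r -meanZ //; congr mean; apply/funext => x; rewrite mulN1r.
Qed.

Lemma meanB f g : continuous f -> continuous g ->
  mean (fun x => f x - g x) = mean f - mean g.
Proof. by move=> cf cg; rewrite meanD ?meanN //; exact: cont_opp. Qed.

Lemma mean_sum (I : Type) (s : seq I) (h : I -> L -> R) :
  (forall i, continuous (h i)) ->
  mean (fun x => \sum_(i <- s) h i x) = \sum_(i <- s) mean (h i).
Proof.
move=> ch; elim: s => [|i s IHs].
  by rewrite big_nil -[RHS]mean_cst; congr mean; apply/funext => x; rewrite big_nil.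
rewrite big_cons -IHs -meanD //; last exact: cont_sum.
by congr mean; apply/funext => x; rewrite big_cons.
Qed.

Lemma mean_le f g : continuous f -> continuous g -> (forall x, f x <= g x) ->
  mean f <= mean g.
Proof.
move=> cf cg fg; have [x0 _] := emf_nonempty F; apply/ler_addgt0Pl => e e0.
have e20 : 0 < e / 2 by rewrite divr_gt0.
have [s [/= sf sg]] := filter_ex (filterI (meanP cf e20) (meanP cg e20)).
have := sf x0; have := sg x0; rewrite !ler_norml => /andP[_ ?] /andP[? _].
have : avg s f x0 <= avg s g x0 by exact: avg_le.
by lra.
Qed.

Lemma mean_ge0 f : continuous f -> (forall x, 0 <= f x) -> 0 <= mean f.
Proof. by move=> cf f0; rewrite -(mean_cst 0); apply: mean_le => //; exact: cont_cst. Qed.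

(** Averages of a translate are translates of averages, as the group is
    abelian. *)
Lemma mean_act f g : continuous f -> mean (fun x => f (act g x)) = mean f.
Proof.
move=> cf; apply: meanE => e e0; have := meanP cf e0.
by apply: filterS => s /= sP x; rewrite avg_act.
Qed.

(** By minimality finitely many translates of a neighbourhood cover the space,
    so the mean charges every non-empty open set. *)
Lemma mean_gt0 f x : continuous f -> (forall y, 0 <= f y) -> 0 < f x -> 0 < mean f.
Proof.
move=> cf f0 fx0.
have fx20 : 0 < f x / 2 by rewrite divr_gt0.
have nU : \forall y \near x, f x / 2 <= f y.
  have := cont_near x cf fx20; apply: filterS => y.
  by rewrite ler_norml => /andP[? _]; lra.
have [|s sP] := compact_finite_cover
    (U := fun g => act g @^-1` [set y | f x / 2 <= f y]) Lc.
  move=> y _; have [g gU] := mini y (nbhs_interior nU).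
  by exists g; exact: act_cont.
have sum_ge y : f x / 2 <= \sum_(g <- s) f (act g y).
  have [g gs gy] := sP y I.
  rewrite (big_rem g) //=; apply: le_trans gy _; rewrite lerDl.
  by apply: sumr_ge0.
have cS : continuous (fun y => \sum_(g <- s) f (act g y)).
  by apply: cont_sum => g; exact: cont_comp.
have := mean_le (@cont_cst _ L (f x / 2)) cS sum_ge.
rewrite mean_cst mean_sum => [|g]; last exact: cont_comp.
rewrite (eq_bigr (fun=> mean f)) => [|g _]; last exact: mean_act.
rewrite big_const_seq count_predT iter_addr_0 -[_ *+ size s]mulr_natl => le.
rewrite ltNge; apply/negP => m0; have := lt_le_trans fx20 le.
by rewrite ltNge mulr_ge0_le0.
Qed.

Lemma mean_sqr_eq0 f : continuous f -> mean (fun x => f x ^+ 2) = 0 ->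
  forall x, f x = 0.
Proof.
move=> cf m0 x; apply/eqP; apply: contraPT (m0) => fx0; apply/eqP.
rewrite gt_eqF //; apply: (@mean_gt0 _ x) => [|y|]; first exact: cont_exp.
  exact: sqr_ge0.
by rewrite lt_neqAle eq_sym sqrf_eq0 fx0 sqr_ge0.
Qed.

(** The discriminant of the non-negative quadratic polynomial
    [t |-> mean (f - t g) ^+ 2]. *)
Lemma mean_CauchySchwarz f g : continuous f -> continuous g ->
  mean (fun x => f x * g x) ^+ 2 <=
  mean (fun x => f x ^+ 2) * mean (fun x => g x ^+ 2).
Proof.
move=> cf cg; have cf2 := @cont_exp _ _ _ 2 cf; have cg2 := @cont_exp _ _ _ 2 cg.
have cfg := cont_mul cf cg.
set a := mean (fun x => f x ^+ 2); set b := mean (fun x => g x ^+ 2).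
set c := mean (fun x => f x * g x).
have quad (t : R) : 0 <= a - t * c *+ 2 + t ^+ 2 * b.
  have -> : a - t * c *+ 2 + t ^+ 2 * b =
            mean (fun x => f x ^+ 2 + (- (t *+ 2) * (f x * g x) + t ^+ 2 * g x ^+ 2)).
    rewrite !meanD ?meanZ -/a -/b -/c //; first by rewrite mulr2n; ring.
    - by apply: cont_mul => //; exact: cont_cst.
    - by apply: cont_mul => //; exact: cont_cst.
    - by apply: cont_add; apply: cont_mul => //; exact: cont_cst.
  apply: mean_ge0 => [|x].
    by apply: cont_add => //; apply: cont_add; apply: cont_mul => //; exact: cont_cst.
  have -> : f x ^+ 2 + (- (t *+ 2) * (f x * g x) + t ^+ 2 * g x ^+ 2)
            = (f x - t * g x) ^+ 2 by rewrite mulr2n; ring.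
  exact: sqr_ge0.
have b0 : 0 <= b by apply: mean_ge0 => // x; exact: sqr_ge0.
have [b_eq0|bn0] := eqVneq b 0.
  have g0 := mean_sqr_eq0 cg b_eq0.
  suff -> : c = 0 by rewrite expr0n /= b_eq0 mulr0.
  by rewrite /c -[RHS](mean_cst 0); congr mean; apply/funext => x; rewrite g0 mulr0.
have bgt0 : 0 < b by rewrite lt_neqAle eq_sym bn0.
have := quad (c / b).
have -> : a - c / b * c *+ 2 + (c / b) ^+ 2 * b = (a * b - c ^+ 2) / b.
  by rewrite mulr2n; field.
by rewrite pmulr_lge0 ?invr_gt0 // subr_ge0.
Qed.

End Mean.

(** * Invariant kernels and their eigenfunctions *)

Section Kernels.
Context (R : realType) (G : groupType) (L : topologicalType).
Context (act : G -> L -> L).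
Hypothesis F : eq_min_flow R act.
Local Notation mean := (mean act).
Implicit Types (f h : L -> R) (k : L -> L -> R).

Definition dot f h : R := mean (fun x => f x * h x).

Lemma dotC f h : dot f h = dot h f.
Proof. by congr mean; apply/funext => x; rewrite mulrC. Qed.

Lemma dotDl f f' h : continuous f -> continuous f' -> continuous h ->
  dot (fun x => f x + f' x) h = dot f h + dot f' h.
Proof.
move=> cf cf' ch; rewrite /dot -(meanD F); [|exact: cont_mul..].
by congr mean; apply/funext => x; rewrite mulrDl.
Qed.

Lemma dotZl c f h : continuous f -> continuous h ->
  dot (fun x => c * f x) h = c * dot f h.
Proof.
move=> cf ch; rewrite /dot -(meanZ F); last exact: cont_mul.
by congr mean; apply/funext => x; rewrite mulrA.
Qed.

Lemma cont_scale c f : continuous f -> continuous (fun x => c * f x).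
Proof. by move=> cf; apply: cont_mul => //; exact: cont_cst. Qed.

Lemma dotBl f f' h : continuous f -> continuous f' -> continuous h ->
  dot (fun x => f x - f' x) h = dot f h - dot f' h.
Proof.
move=> cf cf' ch; rewrite -mulN1r -dotZl // -dotDl //; last exact: cont_scale.
by congr dot; apply/funext => x; rewrite mulN1r.
Qed.

Lemma dot_suml (I : Type) (s : seq I) (e : I -> L -> R) h :
  (forall i, continuous (e i)) -> continuous h ->
  dot (fun x => \sum_(i <- s) e i x) h = \sum_(i <- s) dot (e i) h.
Proof.
move=> ce ch; rewrite /dot -(mean_sum F) => [|i]; last exact: cont_mul.
by congr mean; apply/funext => x; rewrite mulr_suml.
Qed.

Lemma dot_ge0 f : continuous f -> 0 <= dot f f.
Proof.
move=> cf; apply: (mean_ge0 F); first exact: cont_mul.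
by move=> x; rewrite -expr2 sqr_ge0.
Qed.

Lemma dot_eq0 f : continuous f -> dot f f = 0 -> forall x, f x = 0.
Proof.
move=> cf f0; apply: (mean_sqr_eq0 F cf); rewrite -[RHS]f0.
by congr mean; apply/funext => x; rewrite expr2.
Qed.

Lemma dot_sqr_le f h : continuous f -> continuous h ->
  dot f h ^+ 2 <= dot f f * dot h h.
Proof. exact: (mean_CauchySchwarz F). Qed.

Lemma dot_bounded f (b : R) : continuous f -> (forall x, `|f x| <= b) ->
  dot f f <= b ^+ 2.
Proof.
move=> cf fb; rewrite -[leRHS](mean_cst F); apply: (mean_le F).
- exact: cont_mul.
- exact: cont_cst.
- move=> x; rewrite -expr2 -real_normK ?num_real // ler_sqr ?nnegrE //.
  exact: le_trans (fb x).
Qed.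

Lemma dot_bound f h (b : R) : continuous f -> continuous h ->
  (forall x, `|f x| <= b) -> `|dot f h| <= b * Num.sqrt (dot h h).
Proof.
move=> cf ch fb; have [x0 _] := emf_nonempty F.
have b0 : 0 <= b by apply: le_trans (fb x0).
rewrite -ler_sqr ?nnegrE ?mulr_ge0 ?sqrtr_ge0 //.
rewrite real_normK ?num_real // exprMn sqr_sqrtr ?dot_ge0 //.
apply: le_trans (dot_sqr_le cf ch) _.
by rewrite ler_wpM2r ?dot_ge0 // dot_bounded.
Qed.

Lemma dot_act f h g : continuous f -> continuous h ->
  dot (fun x => f (act g x)) (fun x => h (act g x)) = dot f h.
Proof. by move=> cf ch; apply: (mean_act F (f := fun x => f x * h x)); exact: cont_mul. Qed.

(** Continuity in the first variable, uniformly in the second, is what the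
    integral operators need; symmetry transfers it to the second variable. *)
Record kernel k : Prop := {
  ker_sym : forall x y, k x y = k y x;
  ker_inv : forall g x y, k (act g x) (act g y) = k x y;
  ker_near : forall x (e : R), 0 < e ->
    \forall x' \near x, forall y, `|k x' y - k x y| <= e
}.

Definition kop k f x : R := mean (fun y => k x y * f y).

Lemma kopE k f x : kop k f x = dot (k x) f. Proof. by []. Qed.

Section OneKernel.
Variable k : L -> L -> R.
Hypothesis K : kernel k.
Local Notation T := (kop k).

Lemma ker_cont x : continuous (k x).
Proof.
apply: cont_nearP => y e e0; have := ker_near K y e0; apply: filterS => y' yP.
by rewrite ![k x _](ker_sym K).
Qed.
#[local] Hint Resolve ker_cont : core.

Lemma ker_contl y : continuous (fun x => k x y).
Proof. by under eq_fun do rewrite (ker_sym K); exact: ker_cont. Qed.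
#[local] Hint Resolve ker_contl : core.

Lemma ker_bounded : exists2 C : R, 0 < C & forall x y, `|k x y| <= C.
Proof.
have [x0 _] := emf_nonempty F.
have [B B0 kB] := compact_bounded_fun (emf_compact F) (@ker_cont x0).
exists (B + 1) => [|x y]; first by rewrite addr_gt0.
(* every orbit approaches [x0], and [k] is invariant *)
have [g gP] := emf_mini F x (ker_near K x0 (@ltr01 R)).
have -> : k x y = k x0 (act g y) + (k (act g x) (act g y) - k x0 (act g y)).
  by rewrite (ker_inv K); ring.
by apply: le_trans (ler_normD _ _) _; rewrite lerD.
Qed.

Lemma kop_near x (e : R) : 0 < e -> \forall x' \near x, forall f, continuous f ->
  `|T f x' - T f x| <= e * Num.sqrt (dot f f).
Proof.
move=> e0; have := ker_near K x e0; apply: filterS => x' xP f cf.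
rewrite !kopE -dotBl //; apply: dot_bound => //.
by apply: cont_sub.
Qed.

Lemma kop_bound C f : (forall x y, `|k x y| <= C) -> continuous f ->
  forall x, `|T f x| <= C * Num.sqrt (dot f f).
Proof. by move=> kC cf x; apply: dot_bound. Qed.

Lemma kop_cont f : continuous f -> continuous (T f).
Proof.
move=> cf; apply: cont_nearP => x e e0.
pose d := Num.sqrt (dot f f) + 1.
have d0 : 0 < d by rewrite ltr_wpDl ?sqrtr_ge0.
have := kop_near x (divr_gt0 e0 d0); apply: filterS => x' /(_ f cf) xP.
apply: le_trans xP _; rewrite -mulrA ler_piMr ?(ltW e0) // mulrC.
by rewrite ler_pdivrMr // mul1r lerDl.
Qed.
#[local] Hint Resolve kop_cont : core.

Lemma kopD f h x : continuous f -> continuous h ->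
  T (fun y => f y + h y) x = T f x + T h x.
Proof. by move=> cf ch; rewrite !kopE ![dot (k x) _]dotC dotDl. Qed.

Lemma kopZ c f x : continuous f -> T (fun y => c * f y) x = c * T f x.
Proof. by move=> cf; rewrite !kopE ![dot (k x) _]dotC dotZl. Qed.

Lemma kopB f h x : continuous f -> continuous h ->
  T (fun y => f y - h y) x = T f x - T h x.
Proof. by move=> cf ch; rewrite !kopE ![dot (k x) _]dotC dotBl. Qed.

Lemma kop_act f g x : continuous f -> T (fun y => f (act g y)) x = T f (act g x).
Proof.
move=> cf; rewrite !kopE -[RHS](dot_act g) //.
by congr dot; apply/funext => y; rewrite (ker_inv K).
Qed.

(** Fubini for the invariant mean: by compactness a single average over
    finitely many translates approximates the inner mean uniformly in the
    outer variable, and finite sums commute with the outer mean. *)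
Lemma kop_self_adjoint f h : continuous f -> continuous h ->
  dot f (T h) = dot h (T f).
Proof.
move=> cf ch; apply/esym/(meanE F) => e e0.
pose N := Num.sqrt (dot f f) + 1.
have N0 : 0 < N by rewrite ltr_wpDl ?sqrtr_ge0.
have eN0 : 0 < e / N by rewrite divr_gt0.
have [B B0 hB] := compact_bounded_fun (emf_compact F) ch.
pose d := e / N / 3 / (B + Num.sqrt (dot h h)).
have BS0 : 0 < B + Num.sqrt (dot h h) by rewrite ltr_wpDr ?sqrtr_ge0.
have d0 : 0 < d by rewrite divr_gt0 // divr_gt0.
have dE : d * B + d * Num.sqrt (dot h h) = e / N / 3.
  by rewrite -mulrDr /d divfK // gt_eqF.
have FF := avgF_filter F.
have ckh x : continuous (fun z => k x z * h z) by apply: cont_mul.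
have unif : avgF R act [set s | s != [::] /\ forall x y,
    `|avg act s (fun z => k x z * h z) y - T h x| <= e / N].
  have /compact_near_coveringP cover := emf_compact F.
  have near_x x : [set: L] x -> \forall x' \near x & s \near avgF R act,
      s != [::] -> forall y, `|avg act s (fun z => k x' z * h z) y - T h x'| <= e / N.
    move=> _.
    have eN30 : 0 < e / N / 3 by rewrite divr_gt0.
    exists ([set x' | (forall y, `|k x' y - k x y| <= d) /\
                      `|T h x' - T h x| <= d * Num.sqrt (dot h h)],
      [set s | forall y, `|avg act s (fun z => k x z * h z) y - T h x| <= e / N / 3]).
      split=> /=; last exact: (meanP F (ckh x)).
      apply: filterS2 (ker_near K x d0) (kop_near x d0) => x' kx Tx.
      by split=> //; exact: Tx.
    move=> [x' s] /= [[kx Tx] sx] s0 y.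
    have Ax : `|avg act s (fun z => k x' z * h z) y -
                avg act s (fun z => k x z * h z) y| <= d * B.
      have -> : avg act s (fun z => k x' z * h z) y -
                avg act s (fun z => k x z * h z) y =
                avg act s (fun z => (k x' z - k x z) * h z) y - 0.
        rewrite subr0 -mulN1r -avgZ -avgD; congr (_ * _); apply: eq_bigr => g _.
        by rewrite mulrBl mulN1r.
      by apply: avg_dist => // z; rewrite subr0 normrM ler_pM.
    move: (sx y) Ax Tx; rewrite !ler_norml. move=> /andP[? ?] /andP[? ?] /andP[? ?].
    by apply/andP; split; move: dE; lra.
  have An0 : avgF R act [set s | s != [::]] by exact: avgF_neq0.
  have FFF : Filter (avgF R act) := @filter_filter _ _ FF.
  have cov := cover _ _ _ FFF near_x.
  apply: (@filterS2 _ _ FFF _ _ _ _ An0 cov) => s /= s0 sP.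
  by split=> // x y; exact: sP.
apply: filterS unif => s [s0 sP] y.
have -> : avg act s (fun x => h x * T f x) y =
          dot f (fun x => avg act s (fun z => k x z * h z) y).
  rewrite dotC /avg dotZl //; last first.
    by apply: cont_sum => g; apply: cont_mul => //; exact: cont_cst.
  congr (_ * _); rewrite dot_suml // => [|g]; last first.
    by apply: cont_mul => //; exact: cont_cst.
  apply: eq_bigr => g _; rewrite kopE -dotZl //.
  by congr dot; apply/funext => x; rewrite mulrC (ker_sym K).
rewrite dotC [dot f (T h)]dotC -dotBl //; last first.
- exact: kop_cont.
- apply: cont_mul; first exact: cont_cst.
  by apply: cont_sum => g; apply: cont_mul => //; exact: cont_cst.
have cA : continuous (fun x => avg act s (fun z => k x z * h z) y).
  apply: cont_mul; first exact: cont_cst.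
  by apply: cont_sum => g; apply: cont_mul => //; exact: cont_cst.
apply: le_trans (dot_bound _ cf (fun x => sP x y)) _.
  by apply: cont_sub => //; exact: kop_cont.
rewrite -mulrA ler_piMr ?(ltW e0) // mulrC ler_pdivrMr // mul1r.
by rewrite /N lerDl.
Qed.

End OneKernel.

(** A pair [(c, s)] of this kind is the real form of an eigenfunction
    [c + i s] of the flow; the eigenvalue [a + i b] may depend on [g]. *)
Definition rot_pair (c s : L -> R) : Prop :=
  [/\ continuous c, continuous s & forall g, exists a b, forall x,
     c (act g x) = a * c x - b * s x /\ s (act g x) = b * c x + a * s x].

Lemma rot_pair_swap c s : rot_pair c s -> rot_pair s (fun x => - c x).
Proof.
move=> [cc cs rot]; split=> // [|g]; first exact: cont_opp.
by have [a [b ab]] := rot g; exists a, b => x; have [-> ->] := ab x; split; ring.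
Qed.

Lemma rot_pair_kop k c s : kernel k -> rot_pair c s -> rot_pair (kop k c) (kop k s).
Proof.
move=> K [cc cs rot]; split; [exact: kop_cont|exact: kop_cont|move=> g].
have [a [b ab]] := rot g; exists a, b => x.
split; rewrite -kop_act //; rewrite -!kopZ //.
  rewrite -kopB //; [|exact: cont_scale..].
  by congr kop; apply/funext => y; have [] := ab y.
rewrite -kopD //; [|exact: cont_scale..].
by congr kop; apply/funext => y; have [] := ab y.
Qed.

(** By [rot_pair_swap] the second component of an eigenfunction is the first
    component of another, so this is orthogonality to all eigenfunctions. *)
Definition orth f : Prop :=
  continuous f /\ forall c s, rot_pair c s -> dot f c = 0.

Lemma orth_lin a f h : orth f -> orth h -> orth (fun x => f x + a * h x).
Proof.
move=> [cf of_] [ch oh]; split; first by apply: cont_add => //; exact: cont_scale.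
move=> c s rcs; have [cc _ _] := rcs.
by rewrite dotDl ?dotZl ?(of_ _ _ rcs) ?(oh _ _ rcs) ?mulr0 ?addr0 //; exact: cont_scale.
Qed.

Lemma orth_scale a f : orth f -> orth (fun x => a * f x).
Proof.
move=> [cf of_]; split=> [|c s rcs]; first exact: cont_scale.
by have [cc _ _] := rcs; rewrite dotZl // (of_ _ _ rcs) mulr0.
Qed.

(** The action is by isometries and preserves the span of an eigenfunction. *)
Lemma orth_act f g : orth f -> orth (fun x => f (act g x)).
Proof.
move=> [cf of_]; split=> [|c s rcs]; first exact/cont_comp/cf/(emf_cont F).
have [cc cs rot] := rcs; have [a [b ab]] := rot (g^-1)%g.
pose c' x := a * c x - b * s x.
have cc' : continuous c' by apply: cont_sub; exact: cont_scale.
have -> : c = (fun x => c' (act g x)).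
  by apply/funext => x; rewrite /c' -(ab _).1 -(emf_actM F) mulVg (emf_act1 F).
rewrite dot_act // dotC dotBl ?dotZl //; [|exact: cont_scale..].
rewrite dotC (of_ _ _ rcs) [dot s f]dotC (of_ _ _ (rot_pair_swap rcs)).
by rewrite !mulr0 subrr.
Qed.

(** The integral operator of an invariant kernel preserves the orthogonal
    complement of the eigenfunctions, being self-adjoint and commuting with
    the action. *)
Lemma orth_kop k f : kernel k -> orth f -> orth (kop k f).
Proof.
move=> K [cf of_]; split=> [|c s rcs]; first exact: kop_cont.
have [cc _ _] := rcs.
by rewrite dotC kop_self_adjoint // (of_ _ _ (rot_pair_kop K rcs)).
Qed.

Section Extremal.
Variable k : L -> L -> R.
Hypothesis K : kernel k.
Local Notation T := (kop k).
Local Notation nrm f := (dot f f).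

(** If [T] does not vanish on the orthogonal complement of the eigenfunctions
    then [T^2] has an eigenvector there: a maximizing sequence for the norm of
    [T f] on the unit ball is almost made of eigenvectors, and its image by [T]
    clusters uniformly. *)
Lemma kop_sqr_eigen f x1 : orth f -> T f x1 != 0 ->
  exists (m : R) (v : L -> R), [/\ 0 < m, orth v, ~ (forall x, v x = 0) &
    forall x, T (T v) x = m * v x].
Proof.
move=> of_ Tf0; have [C C0 kC] := ker_bounded K.
have cT h : continuous h -> continuous (T h) by exact: kop_cont.
pose A : set R := [set nrm (T h) | h in [set h | orth h /\ nrm h <= 1]].
have TC h : continuous h -> nrm (T h) <= C ^+ 2 * nrm h.
  move=> ch; rewrite -[X in _ * X]sqr_sqrtr ?dot_ge0 // -exprMn.
  by apply: dot_bounded => [|x]; [exact: cT|exact: kop_bound].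
have Asup : has_sup A.
  split.
    exists (nrm (T (fun=> 0))), (fun=> 0) => //; split.
      split=> [|c s [cc _ _]]; first exact: cont_cst.
      have -> : (fun=> 0) = (fun x : L => 0 * c x) by apply/funext => x; rewrite mul0r.
      by rewrite dotZl // mul0r.
    rewrite /dot; under eq_fun do rewrite mulr0.
    by rewrite (mean_cst F) ler01.
  exists (C ^+ 2) => _ [h [[ch _] h1] <-]; apply: le_trans (TC h ch) _.
  by rewrite ler_piMr ?sqr_ge0.
pose m := sup A.
have nT c h : continuous h -> nrm (T (fun y => c * h y)) = c ^+ 2 * nrm (T h).
  move=> ch; have -> : T (fun y => c * h y) = (fun x => c * T h x).
    by apply/funext => x; rewrite kopZ.
  by rewrite dotZl ?[dot (T h) _]dotC ?dotZl ?mulrA ?expr2 //; try exact: cT; exact/cont_scale/cT.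
have nZ c h : continuous h -> nrm (fun y => c * h y) = c ^+ 2 * nrm h.
  move=> ch.
  by rewrite dotZl ?[dot h _]dotC ?dotZl ?mulrA ?expr2 //; exact: cont_scale.
have mP h : orth h -> nrm (T h) <= m * nrm h.
  move=> oh; have [ch _] := oh; have := dot_ge0 ch.
  rewrite le_eqVlt => /orP[/eqP h0|h0].
    have h_eq0 : h = (fun=> 0) by apply/funext; apply: dot_eq0.
    by rewrite -h0 mulr0; apply: le_trans (TC h ch) _; rewrite -h0 mulr0.
  have : A (nrm (T (fun y => (Num.sqrt (nrm h))^-1 * h y))).
    exists (fun y => (Num.sqrt (nrm h))^-1 * h y) => //; split; first exact: orth_scale.
    by rewrite nZ // exprVn sqr_sqrtr ?(ltW h0) // mulVf ?gt_eqF ?lexx.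
  move=> /(sup_upper_bound Asup); rewrite -/m nT // exprVn sqr_sqrtr ?(ltW h0) //.
  by rewrite ler_pdivrMl // mulrC.
have m0 : 0 < m.
  have [cf _] := of_; have nTf : 0 < nrm (T f).
    rewrite lt_neqAle dot_ge0 ?andbT; last exact: cT.
    apply/negP => /eqP/esym/(dot_eq0 (cT _ cf))/(_ x1)/eqP.
    by rewrite (negbTE Tf0).
  have := lt_le_trans nTf (mP f of_).
  by move=> mf; rewrite ltNge; apply/negP => m0; move: mf; rewrite ltNge mulr_le0_ge0 ?dot_ge0.
have /choice [u uP] n : exists h, [/\ orth h, nrm h <= 1 & m - n.+1%:R^-1 < nrm (T h)].
  have n0 : 0 < n.+1%:R^-1 :> R by rewrite invr_gt0.
  by have [_ [h [oh h1] <-] hm] := sup_adherent n0 Asup; exists h.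
have TuB n x : `|T (u n) x| <= C.
  have [[cu _] u1 _] := uP n; apply: le_trans (kop_bound K kC cu x) _.
  by rewrite ler_piMr ?(ltW C0) // -[1]sqrtr1 ler_wsqrtr.
have Tueq x (e : R) : 0 < e -> \forall x' \near x, forall n, `|T (u n) x' - T (u n) x| <= e.
  move=> e0; have := kop_near K x e0; apply: filterS => x' xP n.
  have [[cu _] u1 _] := uP n; apply: le_trans (xP _ cu) _.
  by rewrite ler_piMr ?(ltW e0) // -[1]sqrtr1 ler_wsqrtr.
have [v cv vP] := ascoli_cluster (emf_compact F) TuB Tueq.
have ov : orth v.
  split=> // c s rcs; have [cc _ _] := rcs.
  apply/eqP; rewrite -normr_le0; apply/ler_addgt0Pl => e e0; rewrite addr0.
  have d0 : 0 < Num.sqrt (nrm c) + 1 by rewrite ltr_wpDl ?sqrtr_ge0.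
  have [n _ nP] := vP (e / (Num.sqrt (nrm c) + 1)) 0%N (divr_gt0 e0 d0).
  have [ou _ _] := uP n; have [cu _] := ou; have [cTu oTu] := orth_kop K ou.
  rewrite -normrN -[- _]add0r -(oTu _ _ rcs) -dotBl //.
  apply: le_trans (dot_bound _ cc nP) _; first exact: cont_sub.
  by rewrite -mulrA ler_piMr ?(ltW e0) // mulrC ler_pdivrMr // mul1r lerDl.
have sqrt_le h (b : R) : continuous h -> 0 <= b -> (forall x, `|h x| <= b) ->
    Num.sqrt (nrm h) <= b.
  move=> ch b0 hb; rewrite -[leRHS](ger0_norm b0) -sqrtr_sqr.
  by rewrite ler_wsqrtr // dot_bounded.
exists m, v; split=> //.
- move=> v0; have m20 : 0 < m / 2 by rewrite divr_gt0.
  have [N NP] := invSn_small m20.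
  have s0 : 0 < Num.sqrt (m / 2) by rewrite sqrtr_gt0.
  have [n /NP nN nP] := vP _ N s0; have [[cu _] _ mn] := uP n.
  have := @dot_bounded (T (u n)) (Num.sqrt (m / 2)) (cT _ cu).
  rewrite (sqr_sqrtr (ltW m20)) => bnd.
  have : nrm (T (u n)) <= m / 2 by apply: bnd => x; have := nP x; rewrite v0 subr0.
  by move: mn nN; move: (nrm _) (n.+1%:R^-1) => a b; lra.
- move=> x; apply/eqP; rewrite -subr_eq0 -normr_le0; apply/ler_addgt0Pl => e' e'0.
  pose d := C * C + C + m; have d0 : 0 < d by rewrite !addr_gt0 // mulr_gt0.
  pose e := e' / d; have e0 : 0 < e by rewrite divr_gt0.
  have -> : e' + 0 = e * d by rewrite addr0 /e divfK // gt_eqF.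
  have em0 : 0 < e ^+ 2 / m by rewrite divr_gt0 // exprn_gt0.
  have [N NP] := invSn_small em0; have [n /NP nN nP] := vP e N e0.
  have [ou u1 mn] := uP n; have [cu _] := ou.
  pose w := T (u n); pose D y := w y - v y; pose r y := T w y - m * u n y.
  have cw : continuous w by exact: cT.
  have cD : continuous D by exact: cont_sub.
  have cTw : continuous (T w) by exact: cT.
  have cmu : continuous (fun y => m * u n y) by exact: cont_scale.
  have cr : continuous r by exact: cont_sub.
  have -> : T (T v) x - m * v x = - T (T D) x + T r x + m * (w x - v x).
    rewrite /r kopB // kopZ // -/w.
    have -> : T D = (fun y => T w y - T v y) by apply/funext => y; rewrite kopB.
    by rewrite kopB //; [ring|exact: cT].
  have b1 : `|T (T D) x| <= C * C * e.
    apply: le_trans (kop_bound K kC (cT _ cD) x) _; rewrite -mulrA ler_pM2l //.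
    apply: (sqrt_le); [exact: cT|by rewrite mulr_ge0 ?ltW|move=> y].
    apply: le_trans (kop_bound K kC cD y) _; rewrite ler_pM2l //.
    by apply: (sqrt_le) => //; exact: ltW.
  have nr : nrm r <= e ^+ 2.
    have -> : nrm r = nrm (T w) - 2 * m * nrm w + m ^+ 2 * nrm (u n).
      rewrite {1}/r dotBl // dotZl // [dot _ r]dotC [dot (u n) r]dotC /r.
      rewrite !dotBl // !dotZl // [dot (u n) (T w)]dotC.
      have -> : dot (T w) (u n) = nrm w by rewrite dotC kop_self_adjoint.
      by ring.
    have h1 := mP w (orth_kop K ou).
    have h2 : m ^+ 2 * nrm (u n) <= m ^+ 2 by rewrite ler_piMr // sqr_ge0.
    have h3 : m * (m - n.+1%:R^-1) <= m * nrm w by rewrite ler_pM2l // ltW.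
    have h4 : m * n.+1%:R^-1 <= e ^+ 2 by rewrite mulrC -ler_pdivlMr.
    move: h1 h2 h3 h4; rewrite mulrBr.
    move: (nrm (T w)) (nrm w) (nrm (u n)) (n.+1%:R^-1) => a b c i; nra.
  have b2 : `|T r x| <= C * e.
    apply: le_trans (kop_bound K kC cr x) _; rewrite ler_pM2l //.
    by rewrite -[leRHS](ger0_norm (ltW e0)) -sqrtr_sqr ler_wsqrtr.
  have b3 : `|m * (w x - v x)| <= m * e by rewrite normrM (gtr0_norm m0) ler_pM2l.
  apply: le_trans (ler_normD _ _) _.
  apply: (@le_trans _ _ (C * C * e + C * e + m * e)); last by rewrite /d; lra.
  by rewrite lerD // (le_trans (ler_normD _ _)) // normrN lerD.
Qed.

End Extremal.
End Kernels.

(** * Common eigenvectors of commuting matrices *)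

(** By induction on the dimension, restricting to an eigenspace of a
    non-scalar member of the family; the family may be infinite. *)
Lemma commuting_stable_vector (C : numClosedFieldType) (I : Type) n
    (A : I -> 'M[C]_n) : (0 < n)%N -> (forall i j, comm_mx (A i) (A j)) ->
  exists2 v : 'rV_n, v != 0 & forall i, stablemx v (A i).
Proof.
elim/ltn_ind: n A => n IHn A n0 Acomm.
have [scal|] := pselect (forall i, exists a, A i = a%:M).
  exists (const_mx 1) => [|i].
    by apply/negP => /eqP/rowP/(_ (Ordinal n0)); rewrite !mxE => /eqP; rewrite oner_eq0.
  by have [a ->] := scal i; exact: stablemxC.
move=> /existsNP[i nscal].
have [a a_eigen] := eigenvalue_closed (A i) n0.
pose W := eigenspace (A i) a.
have rW : (\rank W < n)%N.
  rewrite ltn_neqAle rank_leq_row andbT; apply/negP => fullW.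
  apply: nscal; exists a; rewrite -[LHS]mul1mx -[RHS]mul1mx mul_mx_scalar.
  by apply/eigenspaceP; rewrite submx_full.
have stabW j : stablemx W (A j) by apply: comm_mx_stable_eigenspace.
have [||v v0 vP] := IHn _ rW (fun j => restrictmx W (A j)).
- by rewrite lt0n mxrank_eq0.
- move=> j l; rewrite /comm_mx -!conjmxM ?inE ?stablemx_row_base //.
  by rewrite (Acomm j l).
exists (v *m row_base W); first by rewrite mulmx_free_eq0 ?row_base_free.
by move=> j; rewrite -stablemx_restrict.
Qed.

(** The real form of a common complex eigenvector [v + i w]. *)
Lemma commuting_real_eigenpair (R : rcfType) (I : Type) n (A : I -> 'M[R]_n) :
  (0 < n)%N -> (forall i j, comm_mx (A i) (A j)) ->
  exists v w : 'rV_n, (v != 0) || (w != 0) /\ forall i, exists a b,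
    v *m A i = a *: v - b *: w /\ w *m A i = b *: v + a *: w.
Proof.
move=> n0 Acomm; pose CA i := map_mx (real_complex R) (A i).
have [i j|z z0 zP] := @commuting_stable_vector _ _ _ CA n0.
  by rewrite /comm_mx -!map_mxM (Acomm i j).
have ReD : {morph (@complex.Re R) : x y / x + y} by move=> [? ?] [? ?].
have ImD : {morph (@complex.Im R) : x y / x + y} by move=> [? ?] [? ?].
pose v := map_mx (@complex.Re R) z; pose w := map_mx (@complex.Im R) z.
exists v, w; split.
  apply: contraNT z0; rewrite negb_or !negbK => /andP[/eqP v0 /eqP w0].
  apply/eqP/rowP => i; have := congr1 (fun u : 'rV_n => u 0 i) v0.
  have := congr1 (fun u : 'rV_n => u 0 i) w0; rewrite !mxE.
  by case: (z 0 i) => x y /= -> ->.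
move=> i; have /eigenvectorP[[a b] /eigenspaceP zA] := zP i.
exists a, b; split; apply/rowP => j;
  have := congr1 (fun u : 'rV_n => u 0 j) zA; rewrite !mxE.
  move=> /(congr1 (@complex.Re R)); rewrite (big_morph _ ReD erefl).
  case: (z 0 j) => x y /= <-; apply: eq_bigr => l _; rewrite !mxE.
  by case: (z 0 l) => x' y' /=; rewrite mulr0 subr0.
move=> /(congr1 (@complex.Im R)); rewrite (big_morph _ ImD erefl).
case: (z 0 j) => x y /=; rewrite addrC => <-; apply: eq_bigr => l _; rewrite !mxE.
by case: (z 0 l) => x' y' /=; rewrite mulr0 add0r.
Qed.

(** * Eigenfunctions separate points *)

Section Separation.
Context (R : realType) (G : groupType) (L : topologicalType).
Context (act : G -> L -> L).
Hypothesis F : eq_min_flow R act.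
Local Notation mean := (mean act).
Local Notation orth := (orth act).
Local Notation rot_pair := (rot_pair act).
Implicit Types (f h : L -> R).

Definition orthonormal n (e : 'I_n -> L -> R) : Prop :=
  (forall i, continuous (e i)) /\ forall i j, dot act (e i) (e j) = (i == j)%:R.

Definition proj n (e : 'I_n -> L -> R) f x : R := \sum_i dot act f (e i) * e i x.

Section Bessel.
Variables (n : nat) (e : 'I_n -> L -> R).
Hypothesis eo : orthonormal e.

Let ce i : continuous (e i). Proof. exact: eo.1. Qed.

Lemma proj_cont f : continuous (proj e f).
Proof. by apply: cont_sum => i; exact: cont_scale. Qed.

Lemma dot_comb (c : 'I_n -> R) j :
  dot act (fun x => \sum_i c i * e i x) (e j) = c j.
Proof.
rewrite (dot_suml F) // => [|i]; last exact: cont_scale.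
rewrite (bigD1 j) //= big1 ?addr0 => [|i ij]; rewrite (dotZl F) // eo.2.
  by rewrite eqxx mulr1.
by rewrite (negbTE ij) mulr0.
Qed.

Lemma proj_residual f j : continuous f -> dot act (fun x => f x - proj e f x) (e j) = 0.
Proof.
by move=> cf; rewrite (dotBl F) //; [rewrite dot_comb subrr|exact: proj_cont].
Qed.

Lemma bessel f : continuous f -> \sum_i dot act f (e i) ^+ 2 <= dot act f f.
Proof.
move=> cf; have cp := @proj_cont f.
pose r x := f x - proj e f x; have cr : continuous r by exact: cont_sub.
have dot_proj h : continuous h -> dot act (proj e f) h = \sum_i dot act f (e i) * dot act (e i) h.
  move=> ch; rewrite (dot_suml F) // => [|i]; last exact: cont_scale.
  by apply: eq_bigr => i _; rewrite (dotZl F).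
have pr0 : dot act (proj e f) r = 0.
  rewrite dot_proj // big1 // => i _.
  by rewrite [dot act (e i) r]dotC proj_residual // mulr0.
have <- : dot act (proj e f) f = \sum_i dot act f (e i) ^+ 2.
  by rewrite dot_proj //; apply: eq_bigr => i _; rewrite [dot act (e i) f]dotC expr2.
have : 0 <= dot act r r by exact: (dot_ge0 F).
by rewrite {1}/r (dotBl F) // pr0 subr0 [dot act f r]dotC (dotBl F) // subr_ge0.
Qed.

End Bessel.

Lemma orthonormal_rcons n (e : 'I_n -> L -> R) f :
  orthonormal e -> continuous f -> dot act f f = 1 -> (forall i, dot act f (e i) = 0) ->
  orthonormal (fun i : 'I_n.+1 => if unlift ord_max i is Some j then e j else f).
Proof.
move=> [ce oe] cf f1 fe; split=> [i|i j]; first by case: unliftP.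
case: (unliftP ord_max i) => [i' ->|->]; case: (unliftP ord_max j) => [j' ->|->].
- by rewrite oe (inj_eq (@lift_inj _ _)).
- by rewrite dotC fe eq_sym (negbTE (neq_lift _ _)).
- by rewrite fe (negbTE (neq_lift _ _)).
- by rewrite f1 eqxx.
Qed.

Section Eigenspace.
Variables (k : L -> L -> R) (m : R).
Hypotheses (K : kernel act k) (m0 : 0 < m).
Local Notation T := (kop act k).

Definition eig f : Prop := orth f /\ forall x, T (T f) x = m * f x.

Lemma eig_lin a f h : eig f -> eig h -> eig (fun x => f x + a * h x).
Proof.
move=> [of_ Tf] [oh Th]; split=> [|x]; first exact: (orth_lin F).
have [[cf _] [ch _]] := (of_, oh).
have -> : T (fun y => f y + a * h y) = (fun y => T f y + a * T h y).
  by apply/funext => y; rewrite (kopD F K) ?(kopZ F K) //; exact: cont_scale.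
rewrite (kopD F K) ?(kopZ F K) ?Tf ?Th; first by ring.
all: try apply: cont_scale; exact: (kop_cont F K).
Qed.

Lemma eig_act f g : eig f -> eig (fun x => f (act g x)).
Proof.
move=> [of_ Tf]; split=> [|x]; first exact: (orth_act F).
have [cf _] := of_.
have -> : T (fun y => f (act g y)) = (fun y => T f (act g y)).
  by apply/funext => y; rewrite (kop_act F K).
by rewrite (kop_act F K) ?Tf //; exact: (kop_cont F K).
Qed.

Lemma eig0 : eig (fun=> 0).
Proof.
have T0 : T (fun=> 0) = (fun=> 0).
  apply/funext => x; rewrite /kop; under eq_fun do rewrite mulr0.
  by rewrite (mean_cst F).
split=> [|x]; last by rewrite !T0 mulr0.
split=> [|c s [cc _ _]]; first exact: cont_cst.
rewrite /dot; under eq_fun do rewrite mul0r.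
by rewrite (mean_cst F).
Qed.

Lemma eig_scale a f : eig f -> eig (fun x => a * f x).
Proof.
move=> /(eig_lin a eig0); congr eig; by apply/funext => x; rewrite add0r.
Qed.

Lemma eig_sum (I : Type) (s : seq I) (c : I -> R) (e : I -> L -> R) :
  (forall i, eig (e i)) -> eig (fun x => \sum_(i <- s) c i * e i x).
Proof.
move=> ee; elim: s => [|i s IHs].
  by under eq_fun do rewrite big_nil; exact: eig0.
have := eig_lin (c i) IHs (ee i); congr eig; apply/funext => x.
by rewrite big_cons addrC.
Qed.

(** Bessel's inequality for [k x _], averaged over [x]: the Hilbert-Schmidt
    norm of the kernel bounds the dimension of an eigenspace. *)
Lemma eig_dim_bounded : exists B : nat, forall n (e : 'I_n -> L -> R),
  orthonormal e -> (forall i, eig (e i)) -> (n <= B)%N.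
Proof.
have [C C0 kC] := ker_bounded F K.
have B0 : 0 <= C ^+ 2 / m by rewrite divr_ge0 ?sqr_ge0 ?ltW.
exists (Num.bound (C ^+ 2 / m)) => n e eo ee.
rewrite -(ler_nat R) (le_trans _ (ltW (archi_boundP B0))) //.
rewrite ler_pdivlMr //; have [ce oe] := eo.
have cTe i : continuous (T (e i)) by exact: (kop_cont F K).
have -> : n%:R * m = mean (fun x => \sum_i T (e i) x ^+ 2).
  rewrite (mean_sum F) => [|i]; last exact: cont_exp.
  rewrite (eq_bigr (fun=> m)) => [|i _].
    by rewrite sumr_const card_ord mulr_natl.
  transitivity (dot act (T (e i)) (T (e i))).
    by rewrite /dot; congr (mean _); apply/funext => x; rewrite expr2.
  rewrite (kop_self_adjoint F K) //.
  have -> : T (T (e i)) = (fun x => m * e i x) by apply/funext => x; have [_ ->] := ee i.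
  by rewrite dotC (dotZl F) // oe eqxx mulr1.
rewrite -[leRHS](mean_cst F); apply: (mean_le F).
- by apply: cont_sum => i; exact: cont_exp.
- exact: cont_cst.
- move=> x; apply: le_trans (bessel eo (ker_cont K (x:=x))) _.
  exact: (dot_bounded F (ker_cont K (x:=x))).
Qed.

(** A maximal orthonormal system of eigenvectors: a residual of an eigenvector
    would extend it. *)
Lemma eig_basis : exists n (e : 'I_n -> L -> R),
  [/\ orthonormal e, forall i, eig (e i) & forall f, eig f -> f =1 proj e f].
Proof.
pose P n := `[< exists e : 'I_n -> L -> R, orthonormal e /\ forall i, eig (e i) >].
have [B BP] := eig_dim_bounded.
have exP : exists n, P n.
  by exists 0%N; apply/asboolP; exists (fun _ _ => 0); split=> [|[]//]; split=> [[]|[]].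
have ubP n : P n -> (n <= B)%N by move=> /asboolP[e [eo ee]]; exact: BP eo ee.
case: (ex_maxnP exP ubP) => n /asboolP[e [eo ee]] maxn.
exists n, e; split=> // f ef; have [[cf _] _] := ef.
pose r x := f x - proj e f x.
have er : eig r.
  have := eig_lin (-1) ef (eig_sum (index_enum 'I_n) (fun i => dot act f (e i)) ee).
  by congr eig; apply/funext => x; rewrite mulN1r.
have [[cr _] _] := er.
have [r0|rn0] := eqVneq (dot act r r) 0.
  by move=> x; have := dot_eq0 F cr r0 x; move=> /eqP; rewrite subr_eq0 => /eqP.
have rgt0 : 0 < dot act r r by rewrite lt_neqAle eq_sym rn0 (dot_ge0 F).
pose c := (Num.sqrt (dot act r r))^-1.
suff /maxn : P n.+1 by rewrite ltnn.
apply/asboolP; exists (fun i => if unlift ord_max i is Some j then e j else fun x => c * r x).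
split; last by move=> i; case: unliftP => [j _|_] //; exact: eig_scale.
apply: orthonormal_rcons => //; first exact: cont_scale.
  rewrite (dotZl F) ?[dot act r _]dotC ?(dotZl F) //; last exact: cont_scale.
  by rewrite mulrA -expr2 exprVn sqr_sqrtr ?(ltW rgt0) // mulVf.
by move=> i; rewrite (dotZl F) ?(proj_residual eo) ?mulr0 //; have [] := eo.
Qed.

(** A non-zero eigenspace inside the orthogonal complement of the
    eigenfunctions is finite-dimensional and invariant, so the commuting
    operators of the action have a common eigenvector in it, an eigenfunction
    orthogonal to itself. *)
Lemma eig_eq0 f : eig f -> forall x, f x = 0.
Proof.
have [n [e [eo ee span]]] := eig_basis; move=> ef x; rewrite span //.
have [ce oe] := eo.
have [n0|n0] := posnP n.
  by rewrite /proj big1 // => -[i ilt]; exfalso; rewrite n0 in ilt.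
pose A g : 'M[R]_n := \matrix_(i, j) dot act (fun x => e i (act g x)) (e j).
have AE g i y : e i (act g y) = \sum_j A g i j * e j y.
  rewrite (span _ (eig_act g (ee i))) /proj.
  by apply: eq_bigr => j _; rewrite mxE.
have AM g g' : A g *m A g' = A (g * g')%g.
  apply/matrixP => i l; rewrite [RHS]mxE.
  rewrite -(dot_comb eo (fun l => (A g *m A g') i l) l).
  congr dot; apply/funext => y; rewrite (emf_actM F) AE.
  under eq_bigr do rewrite mxE mulr_suml.
  rewrite exchange_big /=; apply: eq_bigr => j _; rewrite AE mulr_sumr.
  by apply: eq_bigr => j' _; rewrite mulrA.
have Acomm g g' : comm_mx (A g) (A g') by rewrite /comm_mx !AM (emf_comm F).
have [v [w [vw rot]]] := commuting_real_eigenpair n0 Acomm.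
pose c y := \sum_i v 0 i * e i y; pose s y := \sum_i w 0 i * e i y.
have ec : eig c by exact: eig_sum.
have es : eig s by exact: eig_sum.
have comb_act (u : 'rV[R]_n) g y :
    \sum_i u 0 i * e i (act g y) = \sum_j (u *m A g) 0 j * e j y.
  under eq_bigr do rewrite AE mulr_sumr.
  rewrite exchange_big /=; apply: eq_bigr => j _; rewrite mxE mulr_suml.
  by apply: eq_bigr => i _; rewrite mulrA.
have rcs : rot_pair c s.
  split; [by have [[]] := ec|by have [[]] := es|move=> g].
  have [a [b [va wa]]] := rot g; exists a, b => y.
  rewrite /c /s !comb_act va wa !mulr_sumr -sumrB -big_split /=.
  by split; apply: eq_bigr => j _; rewrite !mxE; ring.
have dcc : dot act c c = 0 by have [[_ oc] _] := ec; exact: oc rcs.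
have dss : dot act s s = 0 by have [[_ os] _] := es; exact: os (rot_pair_swap rcs).
have [[[cc _] _] [[cs _] _]] := (ec, es).
have c0 := dot_eq0 F cc dcc; have s0 := dot_eq0 F cs dss.
have comb0 (u : 'rV[R]_n) : (forall y, \sum_i u 0 i * e i y = 0) -> u = 0.
  move=> u0; apply/rowP => j; rewrite !mxE -(dot_comb eo (fun i => u 0 i) j).
  rewrite /dot; under eq_fun do rewrite u0 mul0r.
  by rewrite (mean_cst F).
by move: vw; rewrite (comb0 v c0) (comb0 w s0) !eqxx.
Qed.

End Eigenspace.

Lemma kop_orth_eq0 k f : kernel act k -> orth f -> forall x, kop act k f x = 0.
Proof.
move=> K of_ x; apply/eqP; apply/negPn/negP => Tf0.
have [m [v [m0 ov vn0 Tv]]] := kop_sqr_eigen F K of_ Tf0.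
by apply: vn0; apply: (@eig_eq0 k m).
Qed.

(** The orbit pseudometric of [f] is invariant by construction and continuous
    by equicontinuity: it is the source of invariant kernels. *)
Definition orb_dist f x y : R := sup (range (fun g => `|f (act g x) - f (act g y)|)).

Section OrbitDistance.
Variable f : L -> R.
Hypothesis cf : continuous f.

Lemma orb_dist_sup x y : has_sup (range (fun g => `|f (act g x) - f (act g y)|)).
Proof.
have [B B0 fB] := compact_bounded_fun (emf_compact F) cf.
split; first by exists `|f (act 1%g x) - f (act 1%g y)|, 1%g.
exists (B + B) => _ [g _ <-]; apply: le_trans (ler_normB _ _) _; exact: lerD.
Qed.

Lemma orb_dist_ge x y g : `|f (act g x) - f (act g y)| <= orb_dist f x y.
Proof. by apply: sup_upper_bound; [exact: orb_dist_sup|exists g]. Qed.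

Lemma orb_dist_le x y b :
  (forall g, `|f (act g x) - f (act g y)| <= b) -> orb_dist f x y <= b.
Proof.
move=> fb; apply: ge_sup; first by have [] := orb_dist_sup x y.
by move=> _ [g _ <-].
Qed.

Lemma orb_distC x y : orb_dist f x y = orb_dist f y x.
Proof.
by congr sup; congr image; apply/funext => g; rewrite distrC.
Qed.

Lemma orb_dist_act g x y : orb_dist f (act g x) (act g y) = orb_dist f x y.
Proof.
apply/eqP; rewrite eq_le; apply/andP; split; apply: orb_dist_le => h.
  by rewrite -!(emf_actM F); exact: orb_dist_ge.
have -> : h = (h * g^-1 * g)%g by rewrite mulgVK.
by rewrite !(emf_actM F (h * g^-1)%g g); exact: orb_dist_ge.
Qed.

Lemma orb_dist_tri x y z : orb_dist f x z <= orb_dist f x y + orb_dist f y z.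
Proof.
apply: orb_dist_le => g.
have -> : f (act g x) - f (act g z) =
  (f (act g x) - f (act g y)) + (f (act g y) - f (act g z)) by ring.
by apply: le_trans (ler_normD _ _) _; apply: lerD; exact: orb_dist_ge.
Qed.

Lemma orb_dist_kernel : kernel act (orb_dist f).
Proof.
split; [exact: orb_distC|exact: orb_dist_act|move=> x e e0].
have := emf_equi F cf x e0; apply: filterS => x' xP y.
have d : orb_dist f x' x <= e by exact: orb_dist_le.
have d' : orb_dist f x x' <= e by rewrite orb_distC.
by rewrite ler_distlC; have := orb_dist_tri x' x y; have := orb_dist_tri x x' y; 
   move: d d' => *; apply/andP; split; lra.
Qed.

Lemma orb_dist_xx x : orb_dist f x x = 0.
Proof.
apply/eqP; rewrite eq_le orb_dist_le => [|g]; last by rewrite subrr normr0.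
by apply: le_trans (orb_dist_ge x x 1%g); rewrite normr_ge0.
Qed.

(** This kernel is supported where [f] varies by less than [e]. *)
Lemma bump_kernel (e : R) :
  kernel act (fun x y => Num.max 0 (e - orb_dist f x y)).
Proof.
split=> [x y|g x y|x d d0]; first by rewrite orb_distC.
  by rewrite orb_dist_act.
have := ker_near orb_dist_kernel x d0; apply: filterS => x' xP y.
have := xP y; rewrite !ler_distl => /andP[? ?].
by rewrite /Num.max; case: ltP => ?; case: ltP => ?; apply/andP; split; lra.
Qed.

End OrbitDistance.

(** For [f x > 0] the operator of the kernel supported where [f] varies by less
    than [f x / 2] takes a positive value at [x], whereas it vanishes on the
    orthogonal complement of the eigenfunctions. *)
Lemma orth_eq0 f : orth f -> forall x, f x = 0.
Proof.
move=> of_ x; have [cf _] := of_.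
suff le0 h : orth h -> h x <= 0.
  apply/eqP; rewrite eq_le le0 //= -oppr_le0 -mulN1r.
  by apply: (le0 (fun y => -1 * f y)); exact: (orth_scale F).
move=> [ch oh]; rewrite leNgt; apply/negP => hx0.
have e0 : 0 < h x / 2 by rewrite divr_gt0.
pose k y z := Num.max 0 (h x / 2 - orb_dist h y z).
have K : kernel act k by exact: bump_kernel.
have := kop_orth_eq0 K (conj ch oh) x; apply/eqP; rewrite gt_eqF //.
apply: (mean_gt0 F (x := x)).
- by apply: cont_mul => //; exact: (ker_cont K).
- move=> y; rewrite /k /Num.max; case: ltP => [d|_]; last by rewrite mul0r.
  rewrite mulr_ge0 ?(ltW d) //.
  have := orb_dist_ge ch x y 1%g; rewrite !(emf_act1 F) ler_distlC => /andP[? _].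
  by lra.
- by rewrite /k orb_dist_xx // subr0 max_r ?mulr_gt0 // ltW.
Qed.

(** Let [k] be the orbit pseudometric of [f]. The function [k p _ - k q _] does
    not vanish at [p], so it is not orthogonal to all eigenfunctions; its product
    with an eigenfunction [c] has mean [kop k c p - kop k c q], and [kop k] maps
    eigenfunctions to eigenfunctions. *)
Lemma rot_pair_separates p q f : continuous f -> f p != f q ->
  exists c s : L -> R, rot_pair c s /\ c p != c q.
Proof.
move=> cf fpq; pose k := orb_dist f; have K := orb_dist_kernel cf.
apply: contrapT => nsep.
have same (c s : L -> R) : rot_pair c s -> c p = c q.
  by move=> rcs; apply/eqP; apply: contrapT => /negP ne; apply: nsep; exists c, s.
have ckp := ker_cont K (x:=p); have ckq := ker_cont K (x:=q).
have : orth (fun y => k p y - k q y).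
  split=> [|c s rcs]; first exact: cont_sub.
  have [cc _ _] := rcs; rewrite (dotBl F) //.
  by apply/eqP; rewrite subr_eq0; apply/eqP; exact: same (rot_pair_kop F K rcs).
move=> /orth_eq0/(_ p)/eqP; rewrite /k (orb_dist_xx cf) sub0r oppr_eq0 => /eqP d0.
have := orb_dist_ge cf q p 1%g; rewrite d0 normr_le0 subr_eq0 !(emf_act1 F).
by rewrite eq_sym (negbTE fpq).
Qed.

End Separation.

(** * From the factor to a minimal equicontinuous flow *)

Lemma real_complex_cont (R : realType) (X : topologicalType) (f : X -> R) :
  continuous f -> continuous (fun x => (f x)%:C%C : R[i]^o).
Proof.
move=> cf x; apply/cvgrPdist_le => e e0.
have eE : e = (complex.Re e)%:C%C.
  by case: e e0 => a b; rewrite ltcE /= => /andP[/eqP -> _].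
have e'0 : 0 < complex.Re e by rewrite eE ltcR in e0.
have := cont_near x cf e'0; apply: filterS => y yP.
rewrite eE -rmorphB normc_def /= expr0n addr0 sqrtr_sqr lecR.
by rewrite distrC.
Qed.

Lemma uniform_bump (R : realType) (L : uniformType) (y : L) (U : set L) :
  nbhs y U -> exists f : L -> R, [/\ continuous f, f y = 1, forall z, ~ U z -> f z = 0
    & forall z, 0 <= f z <= 1].
Proof.
move=> yU; have [E entE EU] : exists2 E, entourage E & xsection E y `<=` U.
  by move: yU; rewrite -nbhs_entourageE => -[E entE EU]; exists E.
have sep : uniform_separator (~` U) [set y].
  apply: uniform_separatorW; exists (E^-1)%relation; first exact: entourage_inv.
  rewrite -subset0 => -[z w] [[/= Uz ->] Ezy]; apply: Uz; apply: EU.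
  by apply/xsectionP.
pose f := @Urysohn L R (~` U) [set y].
exists f; split.
- exact: Urysohn_continuous.
- by have := Urysohn_sub1 (R := R) sep; apply; exists y.
- by move=> z Uz; have := Urysohn_sub0 (R := R) sep; apply; exists z.
- move=> z; have := @Urysohn_range L R (~` U) [set y] (f z).
  by rewrite /= in_itv /=; apply; exists z.
Qed.

Lemma hausdorff_bump (R : realType) (L : uniformType) (p q : L) :
  hausdorff_space L -> p != q -> exists2 f : L -> R, continuous f & f p != f q.
Proof.
rewrite open_hausdorff => /(_ p q) /[apply] -[[A B] /= [pA qB] [oA _ /eqP AB0]].
have [|f [cf fp fA _]] := @uniform_bump R L p A; first by apply: open_nbhs_nbhs; split=> //; exact/set_mem.
exists f => //; rewrite fp fA ?oner_eq0 // => Aq.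
have : (A `&` B) q by split=> //; exact/set_mem.
by rewrite AB0.
Qed.

(** Heine-Cantor at the points of a compact set. *)
Lemma compact_unif_cont (R : realType) (L : uniformType) (A : set L) (f : L -> R) :
  compact A -> continuous f -> forall e : R, 0 < e ->
  exists2 D : set (L * L), entourage D &
    forall x y, A x -> D (x, y) -> `|f y - f x| <= e.
Proof.
move=> Ac cf e e0; have e20 : 0 < e / 2 by rewrite divr_gt0.
pose FS : set_system (set (L * L)) :=
  filter_from (@entourage L) (fun E => [set D | entourage D /\ D `<=` E]).
have FF : Filter FS.
  apply: filter_from_filter; first by exists setT; exact: filterT.
  move=> E1 E2 ent1 ent2; exists (E1 `&` E2); first exact: filterI.
  by move=> D [entD DE]; split; split=> // p /DE [].
have /compact_near_coveringP cover := Ac.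
have near_x x : A x -> \forall x' \near x & D \near FS,
    forall y, D (x', y) -> `|f y - f x'| <= e.
  move=> _.
  have /nbhsP[E entE EP] := cont_near x cf e20.
  have sE := entourage_split_ent entE.
  exists (xsection (split_ent E) x, [set D | D `<=` split_ent E]).
    split; first exact: nbhs_entourage.
    by exists (split_ent E) => // D [].
  move=> [x' D] /= [/xsectionP xx' DE] y Dy.
  have Exx' : `|f x' - f x| <= e / 2.
    by apply: EP; apply/xsectionP; exact: split_ent_subset.
  have Exy : `|f y - f x| <= e / 2.
    by apply: EP; apply/xsectionP; apply: (entourage_split x') => //; exact: DE.
  move: Exx' Exy; rewrite !ler_norml => /andP[? ?] /andP[? ?].
  by apply/andP; split; lra.
have cov := cover _ _ _ FF near_x.
case: cov => D entD DP; exists D => // x y Ax.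
exact: (DP D (conj entD (@subset_refl _ D)) x Ax y).
Qed.

Section UniformFlow.
Context (R : realType) (G : topGroupType) (L : uniformType) (act : G -> L -> L).
Hypothesis Lc : compact [set: L].
Hypothesis Leq : equicontinuous_flow act.

Lemma equicont_orbits (f : L -> R) : continuous f -> forall y (e : R), 0 < e ->
  \forall x \near y, forall g, `|f (act g x) - f (act g y)| <= e.
Proof.
move=> cf y e e0; have [D entD DP] := compact_unif_cont Lc cf e0.
have [E entE EP] := Leq entD.
have := nbhs_entourage y entE; apply: filterS => x /xsectionP yx g.
by apply: DP => //; exact: EP.
Qed.

Hypothesis act1 : forall x, act 1%g x = x.
Hypothesis actM : forall g h x, act (g * h)%g x = act g (act h x).
Hypothesis inv_cst : forall f : L -> R, continuous f -> invariant_fun act f ->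
  forall x y, f x = f y.

(** Along an equicontinuous action, the supremum of a continuous function over
    each orbit is a continuous invariant function; being constant, it forbids
    an orbit to avoid an open set that another orbit meets. *)
Lemma equicont_minimal (x y : L) (U : set L) : nbhs y U -> exists g, U (act g x).
Proof.
move=> yU; apply: contrapT => noU.
have [f [cf fy fU f01]] := uniform_bump R yU.
pose S z := range (fun g => f (act g z)).
have supS z : has_sup (S z).
  split; first by exists (f (act 1%g z)), 1%g.
  by exists 1 => _ [g _ <-]; have /andP[] := f01 (act g z).
have leS z g : f (act g z) <= sup (S z) by apply: sup_upper_bound => //; exists g.
have geS z b : (forall g, f (act g z) <= b) -> sup (S z) <= b.
  by move=> fb; apply: ge_sup; [exact: (supS z).1|move=> _ [g _ <-]].
have cS : continuous (fun z => sup (S z)).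
  apply: cont_nearP => z e e0; have := equicont_orbits cf z e0.
  apply: filterS => z' zP; rewrite ler_distl lerBlDr; apply/andP; split; apply: geS => g.
    by have := zP g; rewrite ler_distl lerBlDr => /andP[h _]; rewrite (le_trans h) // lerD2r.
  by have := zP g; rewrite ler_distl => /andP[_ h]; rewrite (le_trans h) // lerD2r.
have iS : invariant_fun act (fun z => sup (S z)).
  move=> h z; apply/eqP; rewrite eq_le; apply/andP; split; apply: geS => g.
    by rewrite -actM.
  by rewrite -[g](mulgVK h) actM.
have := inv_cst cS iS x y.
have -> : sup (S x) = 0.
  apply/eqP; rewrite eq_le; apply/andP; split.
    by apply: geS => g; rewrite fU // => Ug; apply: noU; exists g.
  by apply: le_trans (leS x 1%g); have /andP[] := f01 (act 1%g x).
move=> Sy0; have := leS y 1%g; rewrite act1 fy -Sy0.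
by rewrite lt_geF ?ltr01.
Qed.

End UniformFlow.

(** Invariant functions on the factor pull back to invariant functions, so they
    are constant too. *)
Lemma factor_eq_min_flow (R : realType) (G : topGroupType) (K : topologicalType)
    (act : G -> K -> K) (L : uniformType) (actL : G -> L -> L) (q : K -> L) :
  (forall f : K -> R[i]^o, continuous f -> invariant_fun act f ->
     exists c, forall x, f x = c) ->
  (forall g h : G, commute g h) -> [set: K] !=set0 ->
  flow actL -> equicontinuous_flow actL ->
  continuous q -> range q = [set: L] -> equivariant act actL q ->
  eq_min_flow R actL.
Proof.
move=> Kinv Gab [k0 _] [Lc LT act1 actM cact] Leq cq qsurj qeq.
have inv_cst (f : L -> R) : continuous f -> invariant_fun actL f ->
    forall x y, f x = f y.
  move=> cf finv.
  have [c cP] := Kinv (fun k => (f (q k))%:C%C) (real_complex_cont (cont_comp cq cf))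
    (fun g k => congr1 _ (etrans (congr1 f (qeq g k)) (finv g (q k)))).
  suff fE x : f x = complex.Re c by move=> x y; rewrite !fE.
  have : [set: L] x by []. rewrite -qsurj => -[k _ <-].
  by rewrite -(cP k).
split=> //.
- move=> g x; apply: (@continuous_comp _ _ _ (fun x => (g, x)) (fun p => actL p.1 p.2)).
    by apply: cvg_pair => //=; exact: cvg_cst.
  exact: cact.
- by move=> f cf y e e0; exact: equicont_orbits.
- by move=> x y U; exact: (equicont_minimal Lc Leq act1 actM inv_cst).
- by exists (q k0).
Qed.

(** * Lifting circle-valued functions *)

Section Circle.
Context (R : realType).

(** The circle is parametrized by period 1, so that the lifts of a function
    differ by integers. *)
Definition cosp (t : R) : R := cos (pi *+ 2 * t).
Definition sinp (t : R) : R := sin (pi *+ 2 * t).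

Lemma cosp0 : cosp 0 = 1. Proof. by rewrite /cosp mulr0 cos0. Qed.
Lemma sinp0 : sinp 0 = 0. Proof. by rewrite /sinp mulr0 sin0. Qed.

Lemma cospD s t : cosp (s + t) = cosp s * cosp t - sinp s * sinp t.
Proof. by rewrite /cosp mulrDr cosD. Qed.

Lemma sinpD s t : sinp (s + t) = sinp s * cosp t + cosp s * sinp t.
Proof. by rewrite /sinp mulrDr sinD. Qed.

Lemma cospN t : cosp (- t) = cosp t.
Proof. by rewrite /cosp mulrN cosN. Qed.

Lemma sinpN t : sinp (- t) = - sinp t.
Proof. by rewrite /sinp mulrN sinN. Qed.

Lemma cospB s t : cosp (s - t) = cosp s * cosp t + sinp s * sinp t.
Proof. by rewrite cospD cospN sinpN mulrN opprK. Qed.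

Lemma cosp_sinp t : cosp t ^+ 2 + sinp t ^+ 2 = 1.
Proof. exact: cos2Dsin2. Qed.

Lemma cosp_cont : continuous cosp.
Proof.
apply: cont_comp; last exact: continuous_cos.
by apply: cont_mul; [exact: cont_cst|move=> x; exact: cvg_id].
Qed.

Lemma sinp_cont : continuous sinp.
Proof.
apply: cont_comp; last exact: continuous_sin.
by apply: cont_mul; [exact: cont_cst|move=> x; exact: cvg_id].
Qed.

Lemma cosp_nat n : cosp n%:R = 1 /\ sinp n%:R = 0.
Proof.
elim: n => [|n [c1 s0]]; first by rewrite cosp0 sinp0.
rewrite -natr1 cospD sinpD c1 s0 /cosp /sinp mulr1 cos2pi sin2pi.
by split; ring.
Qed.

Lemma cosp_int t : t \is a Num.int -> cosp t = 1 /\ sinp t = 0.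
Proof.
move=> /intrP[[n|n] ->]; first exact: cosp_nat.
rewrite NegzE mulrNz cospN sinpN; have [-> ->] := cosp_nat n.+1.
by rewrite oppr0.
Qed.

Lemma cosp_eq1 t : cosp t = 1 -> t \is a Num.int.
Proof.
move=> t1; pose r := t - (Num.floor t)%:~R.
have zf : (Num.floor t)%:~R \is a @Num.int R by exact: intr_int.
have [c1 s0] := cosp_int zf.
have r1 : cosp r = 1 by rewrite /r cospB t1 c1 s0; ring.
have r0 : 0 <= r by rewrite subr_ge0 floor_le_tmp.
have rlt : r < 1 by rewrite /r ltrBlDr addrC; have := floorD1_gt t; rewrite intrD.
have [r_eq0|rn0] := eqVneq r 0.
  by move/eqP: r_eq0; rewrite subr_eq0 => /eqP ->.
have rgt0 : 0 < r by rewrite lt_neqAle eq_sym rn0.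
have : sin (pi * r) = 0.
  have := r1; rewrite /cosp mulrnAl cos_mulr2n => h.
  have : sin (pi * r) ^+ 2 = 0 by rewrite sin2cos2; move: h; rewrite mulr2n; lra.
  by move/eqP; rewrite sqrf_eq0 => /eqP.
move/eqP; rewrite gt_eqF // sin_gt0_pi // mulr_gt0 ?pi_gt0 //=.
by rewrite gtr_pMr ?pi_gt0.
Qed.

Lemma circ_eq s t : cosp s = cosp t -> sinp s = sinp t -> s - t \is a Num.int.
Proof.
by move=> cst sst; apply: cosp_eq1; rewrite cospB cst sst -!expr2 cosp_sinp.
Qed.

Lemma circ_eq_int s t : s - t \is a Num.int -> cosp s = cosp t /\ sinp s = sinp t.
Proof.
move=> /cosp_int[c1 s0]; rewrite -(subrK t s) (cospD (s - t)) (sinpD (s - t)) c1 s0.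
by rewrite !mul1r !mul0r subr0 add0r.
Qed.

Lemma pi2_neq0 : pi *+ 2 != 0 :> R.
Proof. by rewrite mulrn_eq0 /= gt_eqF // pi_gt0. Qed.

Lemma circ_surj c s : c ^+ 2 + s ^+ 2 = 1 -> exists t, cosp t = c /\ sinp t = s.
Proof.
move=> cs1.
have c1 : -1 <= c <= 1.
  rewrite -ler_norml -(@ler_sqr _ `|c|) ?nnegrE // real_normK ?num_real // expr1n.
  by rewrite -cs1 lerDl sqr_ge0.
have sE : Num.sqrt (1 - c ^+ 2) = `|s|.
  by rewrite -sqrtr_sqr -cs1; congr Num.sqrt; ring.
have [s0|s0] := leP 0 s.
  exists (acos c / (pi *+ 2)); rewrite /cosp /sinp mulrC divfK ?pi2_neq0 //.
  by rewrite acosK ?sin_acos ?sE ?(ger0_norm s0) // in_itv.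
exists (- acos c / (pi *+ 2)); rewrite /cosp /sinp mulrC divfK ?pi2_neq0 //.
rewrite cosN sinN acosK ?in_itv // sin_acos // sE (ltr0_norm s0).
by rewrite opprK.
Qed.

(** The argument of a point of the right half circle. *)
Definition ang (c s : R) : R := atan (s / c) / (pi *+ 2).

Lemma angP c s : 0 < c -> c ^+ 2 + s ^+ 2 = 1 ->
  cosp (ang c s) = c /\ sinp (ang c s) = s.
Proof.
move=> c0 cs1; rewrite /cosp /sinp /ang mulrC divfK ?pi2_neq0 //.
have cE : cos (atan (s / c)) = c.
  rewrite cos_atan -[RHS]invrK; congr _^-1.
  have -> : 1 + (s / c) ^+ 2 = (c^-1) ^+ 2.
    have c20 : c ^+ 2 != 0 by rewrite expf_neq0 // gt_eqF.
    by rewrite expr_div_n exprVn -[1 in LHS](divff c20) -mulrDl cs1 mul1r.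
  by rewrite sqrtr_sqr gtr0_norm // invr_gt0.
split=> //; have := atanK (s / c); rewrite /tan cE => h.
have cn0 : c != 0 by rewrite gt_eqF.
by have := congr1 ( *%R^~ c) h; rewrite !divfK.
Qed.

Lemma ang10 : ang 1 0 = 0.
Proof. by rewrite /ang mul0r atan0 mul0r. Qed.

Lemma ang_cont (X : topologicalType) (c s : X -> R) x :
  continuous c -> continuous s -> c x != 0 ->
  {for x, continuous (fun y => ang (c y) (s y))}.
Proof.
move=> cc cs cx0.
apply: cvgM; last exact: cvg_cst.
apply: (@continuous_comp _ _ _ (fun y => s y / c y) (@atan R)).
  apply: cvgM; first exact: cs.
  by apply: cvgV => //; exact: cc.
exact: continuous_atan.
Qed.

End Circle.

Lemma connected_int_cst (R : realType) (X : topologicalType) (f : X -> R) :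
  connected [set: X] -> continuous f -> (forall x, f x \is a Num.int) ->
  forall x y, f x = f y.
Proof.
move=> Xc cf fi x y; pose B := [set z | f z = f y].
suff : B = [set: X] by move=> BT; have : B x by rewrite BT.
apply: Xc; first by exists y.
- exists B; last by rewrite setTI.
  rewrite openE => z Bz; rewrite /interior.
  have e0 : 0 < 1 / 2 :> R by rewrite divr_gt0.
  have := cont_near z cf e0; apply: filterS => w wz.
  apply/eqP; rewrite -Bz -subr_eq0.
  have : f w - f z \is a Num.int by rewrite rpredB.
  move=> /intrP[n nE]; rewrite nE intr_eq0.
  move: wz; rewrite nE -intr_norm => h.
  have : (`|n|%:~R : R) < 1%:~R by apply: le_lt_trans h _; rewrite ltr_pdivrMr // mul1r ltr1n.
  by rewrite ltr_int => ?; rewrite -normr_eq0; lia.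
- exists B; last by rewrite setTI.
  rewrite (_ : B = f @^-1` [set f y]) //.
  by move/continuous_closedP: cf; apply; exact: closed_eq.
Qed.

Lemma lift_unique (R : realType) (X : topologicalType) (f g : X -> R) :
  connected [set: X] -> continuous f -> continuous g ->
  (forall x, cosp (f x) = cosp (g x)) -> (forall x, sinp (f x) = sinp (g x)) ->
  forall x y, f x - g x = f y - g y.
Proof.
move=> Xc cf cg hc hs; apply: (connected_int_cst Xc (cont_sub cf cg)) => x.
exact: circ_eq.
Qed.

(** Retraction of the line onto the unit interval: paths parametrized by the
    unit interval are treated as maps on the line that factor through it, so
    that continuity needs no subspace. *)
Definition clamp (R : realType) (t : R) : R := (`|t| - `|t - 1| + 1) / 2.

Section Clamp.
Context (R : realType).
Implicit Types t : R.

Lemma clamp_cont : continuous (@clamp R).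
Proof.
apply: cont_mul; last exact: cont_cst.
apply: cont_add; last exact: cont_cst.
have cid : continuous (fun t : R => t) by move=> t; exact: cvg_id.
apply: cont_sub; apply: cont_norm => //.
by apply: cont_sub => //; exact: cont_cst.
Qed.

Lemma clamp_id t : 0 <= t <= 1 -> clamp t = t.
Proof.
by move=> /andP[t0 t1]; rewrite /clamp ger0_norm // ler0_norm ?subr_le0 //; lra.
Qed.

Lemma clamp_le0 t : t <= 0 -> clamp t = 0.
Proof.
by move=> t0; rewrite /clamp ler0_norm // ler0_norm ?subr_le0 ?(le_trans t0) //; lra.
Qed.

Lemma clamp_ge1 t : 1 <= t -> clamp t = 1.
Proof.
by move=> t1; rewrite /clamp ger0_norm ?(le_trans _ t1) // ger0_norm ?subr_ge0 //; lra.
Qed.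

Lemma clamp_in t : 0 <= clamp t <= 1.
Proof.
have [t0|t0] := lerP t 0; first by rewrite clamp_le0 // lexx ler01.
have [t1|t1] := lerP 1 t; first by rewrite clamp_ge1 // ler01 lexx.
by rewrite clamp_id ?(ltW t0) ?(ltW t1).
Qed.

Lemma clampK t : clamp (clamp t) = clamp t.
Proof. exact/clamp_id/clamp_in. Qed.

Lemma clamp0 : clamp 0 = 0 :> R. Proof. exact: clamp_le0. Qed.
Lemma clamp1 : clamp 1 = 1 :> R. Proof. exact: clamp_ge1. Qed.

Definition clamp2 (p : R * R) : R * R := (clamp p.1, clamp p.2).

End Clamp.

Lemma cont_pair (X Y Z : topologicalType) (f : X -> Y) (g : X -> Z) :
  continuous f -> continuous g -> continuous (fun x => (f x, g x)).
Proof. by move=> cf cg x; apply: cvg_pair; [exact: cf|exact: cg]. Qed.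

Lemma cont_fst (X Y : topologicalType) : continuous (@fst X Y).
Proof. by move=> x; exact: cvg_fst. Qed.

Lemma cont_snd (X Y : topologicalType) : continuous (@snd X Y).
Proof. by move=> x; exact: cvg_snd. Qed.

Lemma clamp2_cont (R : realType) : continuous (@clamp2 R).
Proof.
apply: cont_pair; first exact: (cont_comp (@cont_fst _ _) (@clamp_cont R)).
exact: (cont_comp (@cont_snd _ _) (@clamp_cont R)).
Qed.

(** Lifting over a square: cut the ray from the origin to [p] into [N] equal
    pieces; for large [N] consecutive values are at a small angle, and the lift
    at [p] is the sum of these [N] angles. *)
Lemma square_lift (R : realType) (c s : R * R -> R) :
  continuous c -> continuous s -> (forall p, c p ^+ 2 + s p ^+ 2 = 1) ->
  exists2 h : R * R -> R, continuous h & forall p,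
    cosp (h p) = c (clamp2 p) /\ sinp (h p) = s (clamp2 p).
Proof.
move=> cc cs cs1.
have [N N0 NP] : exists2 N, (0 < N)%N & forall (p : R * R) j, (j < N)%N ->
    0 < c (j.+1%:R / N%:R * clamp p.1, j.+1%:R / N%:R * clamp p.2) *
        c (j%:R / N%:R * clamp p.1, j%:R / N%:R * clamp p.2) +
        s (j.+1%:R / N%:R * clamp p.1, j.+1%:R / N%:R * clamp p.2) *
        s (j%:R / N%:R * clamp p.1, j%:R / N%:R * clamp p.2).
  have sqc : compact ([set` `[(0:R), 1]] `*` [set` `[(0:R), 1]]).
    by apply: compact_setX; exact: segment_compact.
  have e0 : 0 < 1 / 2 :> R by rewrite divr_gt0.
  have [D entD DP] := compact_unif_cont sqc cc e0.
  have [E entE EP] := compact_unif_cont sqc cs e0.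
  have [d /= d0 dDE] : entourage_ (@ball R (R * R)%type) (D `&` E).
    by rewrite entourage_ballE; exact: filterI.
  have [N NP] := invSn_small (divr_gt0 d0 (ltr0Sn R 1)).
  exists N.+1 => // p j jN.
  have inS i : (i <= N.+1)%N -> ([set` `[(0:R), 1]] `*` [set` `[(0:R), 1]])
      (i%:R / N.+1%:R * clamp p.1, i%:R / N.+1%:R * clamp p.2).
    move=> iN; have /andP[p10 p11] := clamp_in p.1; have /andP[p20 p21] := clamp_in p.2.
    have i0 : 0 <= i%:R / N.+1%:R :> R by rewrite divr_ge0 ?ler0n.
    have i1 : i%:R / N.+1%:R <= 1 :> R by rewrite ler_pdivrMr ?ltr0n // mul1r ler_nat.
    by split; rewrite /= in_itv /= mulr_ge0 //= mulr_ile1.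
  have step_small t : `|j%:R / N.+1%:R * clamp t - j.+1%:R / N.+1%:R * clamp t| < d.
    have /andP[t0 t1] := clamp_in t.
    have -> : j%:R / N.+1%:R * clamp t - j.+1%:R / N.+1%:R * clamp t
              = - (N.+1%:R^-1 * clamp t) by rewrite -natr1; ring.
    rewrite normrN ger0_norm; last by apply: mulr_ge0; rewrite ?invr_ge0 ?ler0n.
    apply: (@le_lt_trans _ _ (d / 2)); last by rewrite ltr_pdivrMr // ltr_pMr // ltr1n.
    apply: le_trans (NP N (leqnn N)).
    by rewrite ler_piMr ?invr_ge0 ?ler0n.
  pose x : R * R := (j%:R / N.+1%:R * clamp p.1, j%:R / N.+1%:R * clamp p.2).
  pose y : R * R := (j.+1%:R / N.+1%:R * clamp p.1, j.+1%:R / N.+1%:R * clamp p.2).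
  have s1 := step_small p.1; have s2 := step_small p.2.
  have [Dxy Exy] : (D `&` E) (x, y) by apply: dDE; split; [exact: s1|exact: s2].
  have := DP x y (inS j (ltnW jN)) Dxy; have := EP x y (inS j (ltnW jN)) Exy.
  rewrite -/x -/y !ler_norml => /andP[? ?] /andP[? ?].
  have h1 := cs1 x; have h2 := cs1 y.
  have -> : c y * c x + s y * s x = 1 - ((c y - c x) ^+ 2 + (s y - s x) ^+ 2) / 2.
    have -> : (c y - c x) ^+ 2 + (s y - s x) ^+ 2 = 2 - 2 * (c y * c x + s y * s x).
      transitivity ((c x ^+ 2 + s x ^+ 2) + (c y ^+ 2 + s y ^+ 2) -
        2 * (c y * c x + s y * s x)); first by ring.
      by rewrite h1 h2; ring.
    by field.
  have q1 : (c y - c x) ^+ 2 <= 1 / 4 by nra.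
  have q2 : (s y - s x) ^+ 2 <= 1 / 4 by nra.
  by lra.
pose pt (j : nat) (p : R * R) := (j%:R / N%:R * clamp p.1, j%:R / N%:R * clamp p.2).
have cpt j : continuous (pt j).
  apply: cont_pair; apply: cont_scale.
    exact: (cont_comp (@cont_fst _ _) (@clamp_cont R)).
  exact: (cont_comp (@cont_snd _ _) (@clamp_cont R)).
pose cr j p := c (pt j.+1 p) * c (pt j p) + s (pt j.+1 p) * s (pt j p).
pose sr j p := s (pt j.+1 p) * c (pt j p) - c (pt j.+1 p) * s (pt j p).
have ccr j : continuous (cr j).
  by apply: cont_add; apply: cont_mul; exact: cont_comp.
have csr j : continuous (sr j).
  by apply: cont_sub; apply: cont_mul; exact: cont_comp.
have csr1 j p : cr j p ^+ 2 + sr j p ^+ 2 = 1.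
  have h1 := cs1 (pt j p); have h2 := cs1 (pt j.+1 p); rewrite /cr /sr.
  rewrite -[RHS](mulr1 1) -{1}h1 -h2; ring.
have [t0 [ct0 st0]] := circ_surj (cs1 (0, 0)).
exists (fun p => t0 + \sum_(j < N) ang (cr j p) (sr j p)).
  apply: cont_add; first exact: cont_cst.
  apply: cont_sum => j p; apply: ang_cont => //.
  by rewrite gt_eqF //; exact: NP.
move=> p.
have step n : (n <= N)%N -> cosp (t0 + \sum_(j < n) ang (cr j p) (sr j p)) = c (pt n p) /\
    sinp (t0 + \sum_(j < n) ang (cr j p) (sr j p)) = s (pt n p).
  elim: n => [_|n IHn nN].
    by rewrite big_ord0 addr0 /pt !mul0r.
  rewrite big_ord_recr /= addrA; have [] := IHn (ltnW nN).
  move: (t0 + _) => T cT sT; rewrite (cospD T) (sinpD T) cT sT.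
  have [||-> ->] := @angP R (cr n p) (sr n p); [exact: NP|exact: csr1|].
  have h := cs1 (pt n p).
  rewrite /cr /sr; set a := c (pt n p) in h *; set b := s (pt n p) in h *.
  set a' := c _; set b' := s _.
  have aE : a * a = 1 - b * b by rewrite -h !expr2; ring.
  split.
    transitivity (a' * (a * a + b * b)); first by ring.
    by rewrite aE; ring.
  transitivity (b' * (a * a + b * b)); first by ring.
  by rewrite aE; ring.
have [] := step N (leqnn N).
rewrite /pt divff ?mul1r //; last by rewrite pnatr_eq0 -lt0n.
Qed.

Section PathConnection.
Context (R : realType) (Z : topologicalType) (E : set Z).

Definition path_conn (z z' : Z) : Prop := exists g : R -> Z,
  [/\ continuous g, forall t, E (g t), forall t, g (clamp t) = g t, g 0 = z & g 1 = z'].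

Lemma path_conn_sym z z' : path_conn z z' -> path_conn z' z.
Proof.
move=> [g [cg Eg gc g0 g1]]; exists (fun t => g (1 - t)); split=> //.
- apply: cont_comp cg; apply: cont_sub; first exact: cont_cst.
  by move=> t; exact: cvg_id.
- move=> t; rewrite -[RHS]gc; congr g.
  have [t0|t0] := lerP t 0.
    by rewrite (clamp_le0 t0) subr0 clamp_ge1 //; lra.
  have [t1|t1] := lerP 1 t.
    by rewrite (clamp_ge1 t1) subrr clamp_le0 // subr_le0.
  by rewrite !clamp_id //; lra.
- by rewrite subr0.
- by rewrite subrr.
Qed.

Lemma path_conn_trans z z' z'' :
  path_conn z z' -> path_conn z' z'' -> path_conn z z''.
Proof.
move=> [g [cg Eg gc g0 g1]] [h [ch Eh hc h0 h1]].
pose a (t : R) := g (2 * t); pose b (t : R) := h (2 * t - 1).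
have aE t : 1 / 2 <= t -> a t = z'.
  by move=> t2; rewrite /a -gc clamp_ge1 ?g1 //; lra.
have bE t : t <= 1 / 2 -> b t = z'.
  by move=> t2; rewrite /b -hc clamp_le0 ?h0 //; lra.
have cid : continuous (fun t : R => t) by move=> t; exact: cvg_id.
have ca : continuous a by apply: cont_comp cg; exact: cont_scale.
have cb : continuous b.
  by apply: cont_comp ch; apply: cont_sub; [exact: cont_scale|exact: cont_cst].
pose f t := if t <= 1 / 2 then a t else b t.
exists f; split.
- move=> t U; rewrite {1}/f; case: ifPn => [t2|]; last first.
    rewrite -ltNge => t2 bU; have {}bU : nbhs t (b @^-1` U) by exact: cb.
    apply: filterS2 bU (lt_nbhsr t2) => r /= br r2.
    by rewrite /f ifF //; apply/negbTE; rewrite -ltNge.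
  move=> aU; have nbA : nbhs t (a @^-1` U) by exact: ca.
  move: t2; rewrite le_eqVlt => /orP[/eqP t2|t2]; last first.
    apply: filterS2 nbA (lt_nbhsl t2) => r /= ar r2.
    by rewrite /f ifT // ltW.
  have bU : nbhs t (b @^-1` U).
    have az : a t = z' by apply: aE; rewrite t2.
    have bz : b t = z' by apply: bE; rewrite t2.
    by apply: cb; rewrite bz -az.
  apply: filterS2 nbA bU => r /= ar br.
  by rewrite /f; case: ifP.
- by move=> t; rewrite /f; case: ifP => _; [exact: Eg|exact: Eh].
- move=> t; have [t0|t0] := lerP t 0.
    rewrite (clamp_le0 t0) /f !ifT; [|lra..].
    by rewrite /a -[RHS]gc -[LHS]gc; congr g; rewrite !clamp_le0 //; lra.
  have [t1|t1] := lerP 1 t.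
    rewrite (clamp_ge1 t1) /f !ifF; [|apply/negbTE; rewrite -ltNge; lra..].
    by rewrite /b -[RHS]hc -[LHS]hc; congr h; rewrite !clamp_ge1 //; lra.
  by rewrite clamp_id // (ltW t0) (ltW t1).
- by rewrite /f ifT ?divr_ge0 // /a mulr0.
- rewrite /f ifF; last by apply/negbTE; rewrite -ltNge; lra.
  by rewrite /b (_ : 2 * 1 - 1 = 1) //; ring.
Qed.

End PathConnection.

Lemma path_conn_in (R : realType) (Z : topologicalType) (E : set Z) z z' :
  path_conn R E z z' -> E z'.
Proof. by move=> [g [_ Eg _ _ <-]]. Qed.

(** The joining paths may leave [N'], as in connectedness im kleinen; this is
    the form of local path connectedness that lifting uses. *)
Definition loc_path_conn (R : realType) (X : topologicalType) : Prop :=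
  forall (x : X) (N : set X), nbhs x N ->
  exists2 N', nbhs x N' & forall y, N' y -> path_conn R N x y.

Lemma within_comp (X Y Z : topologicalType) (A : set X) (f : X -> Z) (g : Y -> X) :
  {within A, continuous f} -> continuous g -> (forall y, A (g y)) ->
  continuous (fun y => f (g y)).
Proof.
move=> /subspace_continuousP cf cg gA y U fU.
have := cf (g y) (gA y) U fU; rewrite /within /= => nU.
have : nbhs y (g @^-1` [set x | A x -> U (f x)]) by exact: cg.
by apply: filterS => y' /=; apply.
Qed.

Section Lift.
Context (R : realType) (X : topologicalType).
Hypothesis Xsc : simply_connected R X.
Hypothesis Xlp : loc_path_conn R X.
Variables c s : X -> R.
Hypothesis cc : continuous c.
Hypothesis cs : continuous s.
Hypothesis cs1 : forall x, c x ^+ 2 + s x ^+ 2 = 1.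

(** The pullback by [(c, s)] of the universal covering of the circle. *)
Definition lifts : set (X * R) := [set z | cosp z.2 = c z.1 /\ sinp z.2 = s z.1].

Lemma path_conn_all x y : path_conn R [set: X] x y.
Proof.
have [p [cp p0 p1]] := Xsc.1 x y.
exists (fun t => p (clamp t)); split=> //; rewrite ?clamp0 ?clamp1 //.
  by apply: within_comp cp (@clamp_cont R) _ => t /=; rewrite in_itv /= clamp_in.
by move=> t; rewrite clampK.
Qed.

Lemma path_lift x y t : lifts (x, t) -> exists t', path_conn R lifts (x, t) (y, t').
Proof.
move=> [ct st]; have [g [cg _ gc g0 g1]] := path_conn_all x y.
have cgf : continuous (fun p : R * R => g p.1) by apply: cont_comp cg; exact: cont_fst.
have [h ch hP] := square_lift (cont_comp cgf cc) (cont_comp cgf cs) (fun p => cs1 (g p.1)).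
have hint : t - h (0, 0) \is a Num.int.
  have [h1 h2] := hP (0, 0).
  by apply: circ_eq; rewrite ?ct ?st ?h1 ?h2 /= clamp0 g0.
have ch0 : continuous (fun r : R => h (clamp r, 0)).
  apply: cont_comp ch; apply: cont_pair; first exact: clamp_cont.
  by move=> r; exact: cvg_cst.
exists (h (1, 0) + (t - h (0, 0))).
exists (fun r => (g r, h (clamp r, 0) + (t - h (0, 0)))); split.
- apply: cont_pair => //; apply: cont_add => //; exact: cont_cst.
- move=> r; have [h1 h2] := hP (clamp r, 0); rewrite /lifts /=.
  have [|-> ->] := @circ_eq_int R (h (clamp r, 0) + (t - h (0, 0))) (h (clamp r, 0)).
  + by rewrite addrC addKr.
  + by rewrite h1 h2 /= clampK gc.
- by move=> r; rewrite gc clampK.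
- by rewrite g0 clamp0; congr pair; ring.
- by rewrite g1 clamp1.
Qed.

(** Lifts of loops are loops: lift a null-homotopy of the loop and compare
    along the boundary of the square. *)
Lemma loop_lift x t t' : path_conn R lifts (x, t) (x, t') -> t = t'.
Proof.
move=> [g [cg Eg gc g0 g1]].
pose p r := (g r).1; pose th r := (g r).2.
have cp : continuous p by apply: cont_comp cg _; exact: cont_fst.
have cth : continuous th by apply: cont_comp cg _; exact: cont_snd.
have p0 : p 0 = x by rewrite /p g0.
have p1 : p 1 = x by rewrite /p g1.
have [F [cF FP]] := Xsc.2 p (continuous_subspaceT cp) (etrans p0 (esym p1)).
have cF2 : continuous (fun z => F (@clamp2 R z)).
  apply: within_comp cF (@clamp2_cont R) _ => z.
  by split=> /=; rewrite in_itv /= clamp_in.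
have [h ch hP] := square_lift (cont_comp cF2 cc) (cont_comp cF2 cs)
  (fun z => cs1 (F (clamp2 z))).
have {}hP z : cosp (h z) = c (F (clamp2 z)) /\ sinp (h z) = s (F (clamp2 z)).
  by have [-> ->] := hP z; rewrite /clamp2 /= !clampK.
have Rc : connected [set: R] by apply/connected_intervalP => a b _ _ z _.
have inI (r : R) : clamp r \in `[0, 1] by rewrite in_itv /= clamp_in.
have cidR : continuous (fun r : R => r) by move=> r; exact: cvg_id.
have edge (k : R -> R * R) : continuous k -> (forall r, F (clamp2 (k r)) = p 0) ->
    h (k 0) = h (k 1).
  move=> ck kP; have chk := cont_comp ck ch.
  have := lift_unique Rc chk (@cont_cst _ _ (h (k 0))) _ _ 0 1.
  rewrite subrr => e; apply/esym/eqP; rewrite -subr_eq0; apply/eqP/esym/e => r.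
    by rewrite (hP _).1 (hP _).1 !kP.
  by rewrite (hP _).2 (hP _).2 !kP.
have left_ : h (0, 0) = h (0, 1).
  apply: (edge (fun r => (0, r))).
    by apply: cont_pair => // r; exact: cvg_cst.
  by move=> r; rewrite /clamp2 /= clamp0; have [_ _ -> _] := FP _ (inI r).
have right_ : h (1, 0) = h (1, 1).
  apply: (edge (fun r => (1, r))).
    by apply: cont_pair => // r; exact: cvg_cst.
  by move=> r; rewrite /clamp2 /= clamp1; have [_ _ _ ->] := FP _ (inI r).
have top_ : h (0, 1) = h (1, 1).
  apply: (edge (fun r => (r, 1))).
    by apply: cont_pair => // r; exact: cvg_cst.
  by move=> r; rewrite /clamp2 /= clamp1; have [_ -> _ _] := FP _ (inI r).
have cbot : continuous (fun r : R => h (r, 0)).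
  by apply: cont_comp ch; apply: cont_pair => // r; exact: cvg_cst.
have bottom r : F (clamp2 (r, 0)) = p r.
  rewrite /clamp2 /= clamp0; have [-> _ _ _] := FP _ (inI r).
  by rewrite /p gc.
have := lift_unique Rc cth cbot _ _ 0 1.
have e1 r : cosp (th r) = cosp (h (r, 0)) by rewrite (hP _).1 bottom; have [-> _] := Eg r.
have e2 r : sinp (th r) = sinp (h (r, 0)) by rewrite (hP _).2 bottom; have [_ ->] := Eg r.
move=> /(_ e1 e2); rewrite left_ top_ -right_ => /(addIr _).
by rewrite /th g0 g1.
Qed.

(** The lift at [x] is the endpoint of any lifted path from a base point; it is
    well defined by [loop_lift], and continuous because nearby points are joined
    by paths along which the angle from [x] stays acute. *)
Lemma circle_lift : exists2 h : X -> R, continuous h &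
  forall x, cosp (h x) = c x /\ sinp (h x) = s x.
Proof.
have [[x0]|noX] := pselect ([set: X] !=set0); last first.
  exists (fun=> 0); first exact: cont_cst.
  by move=> x; exfalso; apply: noX; exists x.
move=> _; have [t0 [ct0 st0]] := circ_surj (cs1 x0).
have E0 : lifts (x0, t0) by [].
have /choice[h hP] : forall x, exists t, path_conn R lifts (x0, t0) (x, t).
  by move=> x; exact: path_lift.
have hE x : lifts (x, h x) by exact: path_conn_in (hP x).
have uniq_h x t : path_conn R lifts (x0, t0) (x, t) -> t = h x.
  by move=> /path_conn_sym/path_conn_trans/(_ (hP x)); exact: loop_lift.
exists h; last exact: hE.
apply: cont_nearP => x e e0.
pose cr y := c y * c x + s y * s x; pose sr y := s y * c x - c y * s x.
have ccr : continuous cr by apply: cont_add; apply: cont_mul => //; exact: cont_cst.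
have csr : continuous sr by apply: cont_sub; apply: cont_mul => //; exact: cont_cst.
have crx : cr x = 1 by rewrite /cr -!expr2 cs1.
have srx : sr x = 0 by rewrite /sr mulrC subrr.
have nN : \forall y \near x, 0 < cr y.
  have e20 : 0 < 1 / 2 :> R by rewrite divr_gt0.
  have := cont_near x ccr e20; apply: filterS => y.
  by rewrite crx ler_norml => /andP[? _]; lra.
have [N' xN' N'P] := Xlp nN.
have near_ang : \forall y \near x, `|ang (cr y) (sr y)| <= e.
  have crx0 : cr x != 0 by rewrite crx oner_neq0.
  have /cvgrPdist_le/(_ e e0) := @ang_cont R X cr sr x ccr csr crx0.
  by apply: filterS => y; rewrite crx srx ang10 sub0r normrN.
apply: filterS2 near_ang xN' => y ye /N'P[g [cg Ng gc g0 g1]].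
have csr1 z : cr z ^+ 2 + sr z ^+ 2 = 1.
  rewrite -[RHS](mulr1 1) -{1}(cs1 z) -(cs1 x) /cr /sr; ring.
suff hy : h x + ang (cr y) (sr y) = h y by rewrite -hy addrC addKr.
apply: uniq_h; apply: path_conn_trans (hP x) _.
exists (fun r => (g r, h x + ang (cr (g r)) (sr (g r)))); split.
- apply: cont_pair => //; apply: cont_add; first exact: cont_cst.
  move=> r; apply: (@ang_cont R R (fun r => cr (g r)) (fun r => sr (g r))).
  + exact: cont_comp.
  + exact: cont_comp.
  + by rewrite gt_eqF //; exact: Ng.
- move=> r; have [ca sa] := angP (Ng r) (csr1 (g r)).
  have [hcx hsx] := hE x; rewrite /lifts /= cospD sinpD ca sa hcx hsx /cr /sr /=.
  have csx := cs1 x; have aE : c x * c x = 1 - s x * s x by rewrite -csx !expr2; ring.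
  split.
    transitivity (c (g r) * (c x * c x + s x * s x)); first by ring.
    by rewrite aE; ring.
  transitivity (s (g r) * (c x * c x + s x * s x)); first by ring.
  by rewrite aE; ring.
- by move=> r; rewrite gc.
- by rewrite g0 crx srx ang10 addr0.
- by rewrite g1.
Qed.

End Lift.

(** * Local structure of Lie groups *)

Section LieLocal.
Context (R : realType) (H : topGroupType).
Hypothesis HL : lie_group R H.

(** What is used of charts: near [x] the group is parametrized continuously by
    a ball, inside any given neighbourhood. *)
Lemma chart_ball (x : H) (N : set H) : nbhs x N ->
  exists (n : nat) (A : set H) (f : H -> 'rV[R]_n) (g : 'rV[R]_n -> H) (r : R),
  [/\ 0 < r, A x,
      forall e, 0 < e -> nbhs x [set y | A y /\ `|f x - f y| < e],
      forall y, A y -> g (f y) = y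
    & {within [set w | `|f x - w| < r], continuous g} /\
      forall w, `|f x - w| < r -> N (g w)].
Proof.
move=> xN; have [_ _ [n [At LA]]] := HL.
have SA := lie_smooth_atlas LA.
have [c Ac cx] := atlas_cover SA x; have Cc := atlas_chart SA Ac.
pose z := chart_map c x.
have cz : chart_cod c z by exists x.
have gz : chart_inv c z = x by apply: (chart_mapK Cc); exact/mem_set.
have /subspace_continuousP cg := chart_inv_continuous Cc.
have /subspace_continuousP cf := chart_map_continuous Cc.
have nz : nbhs z [set w | chart_cod c w /\ N (chart_inv c w)].
  have n1 : nbhs z (chart_cod c) by apply: open_nbhs_nbhs; split=> //; exact: chart_cod_open Cc.
  have n2 : nbhs z [set w | chart_cod c w -> N (chart_inv c w)].
    have xN' : nbhs (chart_inv c z) N by rewrite gz.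
    exact: (cg z cz N xN').
  by apply: filterS2 n1 n2 => w cw /(_ cw).
have [r /= r0 rP] : exists2 r : R, 0 < r & forall w, `|z - w| < r ->
    chart_cod c w /\ N (chart_inv c w).
  have /nbhs_ballP[r /= r0 rP] := nz; exists r => // w zw; apply: rP.
  by rewrite -ball_normE.
exists n, (chart_dom c), (chart_map c), (chart_inv c), r; split=> //.
- move=> e e0.
  have n1 : nbhs x (chart_dom c) by apply: open_nbhs_nbhs; split=> //; exact: chart_dom_open Cc.
  have ze : nbhs z [set w | `|z - w| < e].
    by apply/nbhs_ballP; exists e => // w; rewrite -ball_normE.
  have n2 : nbhs x [set y | chart_dom c y -> `|z - chart_map c y| < e].
    exact: (cf x cx _ ze).
  by apply: filterS2 n1 n2 => y cy /(_ cy).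
- by move=> y Ay; apply: (chart_mapK Cc); exact/mem_set.
- split; last by move=> w /rP[].
  apply: continuous_subspaceW (chart_inv_continuous Cc) => w /= /rP[] //.
Qed.

Lemma lie_loc_path_conn : loc_path_conn R H.
Proof.
move=> x N /chart_ball[n [A [f [g [r [r0 Ax fn gK [cg gN]]]]]]].
exists [set y | A y /\ `|f x - f y| < r]; first exact: fn.
move=> y [Ay yr].
pose k (t : R) := f x + clamp t *: (f y - f x).
have kr t : `|f x - k t| < r.
  rewrite /k opprD addNKr normrN normrZ.
  have /andP[t0 t1] := clamp_in t; rewrite ger0_norm //.
  by apply: le_lt_trans yr; rewrite distrC ler_piMl.
have ck : continuous k.
  move=> t; apply: cvgD; first exact: cvg_cst.
  by apply: cvgZr_tmp; exact: clamp_cont.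
exists (fun t => g (k t)); split.
- by apply: within_comp cg ck _ => t /=.
- by move=> t; exact: gN.
- by move=> t; rewrite /k clampK.
- by rewrite /k clamp0 scale0r addr0 gK.
- by rewrite /k clamp1 scale1r addrC subrK gK.
Qed.

Lemma lie_loc_compact (x : H) : exists2 C, compact C & nbhs x C.
Proof.
have [n [A [f [g [r [r0 Ax fn gK [cg gN]]]]]]] := chart_ball (@filterT _ (nbhs x) _).
have r20 : 0 < r / 2 by rewrite divr_gt0.
exists (g @` [set w | `|f x - w| <= r / 2]).
  apply: continuous_compact.
    apply: continuous_subspaceW cg => w /=.
    by move=> /le_lt_trans; apply; rewrite ltr_pdivrMr // ltr_pMr // ltr1n.
  apply: bounded_closed_compact.
    exists (`|f x| + r / 2); split; first exact: num_real.
    move=> M lM w /= wr; apply: le_trans (ltW lM).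
    have -> : w = f x - (f x - w) by rewrite opprB addrC subrK.
    by apply: le_trans (ler_normB _ _) _; rewrite lerD2l.
  exact: (@closed_closed_ball_ _ _ (f x) (r / 2)).
have := fn _ r20; apply: filterS => y [Ay yr].
by exists (f y); [exact: ltW|exact: gK].
Qed.

End LieLocal.

(** * Cocompact discrete subgroups *)

Section CosetSpace.
Context (H : topGroupType) (Gamma : groupClosed H).
Local Open Scope quotient_scope.

Definition coset_pr : H -> coset_space Gamma :=
  \pi_(quotient_topology (cosets Gamma)).

Lemma coset_pr_cont : continuous coset_pr.
Proof. exact: pi_continuous. Qed.

Lemma coset_pr_surj k : exists x, coset_pr x = k.
Proof. by exists (repr (k : quotient_topology (cosets Gamma))); exact: reprK. Qed.

Lemma coset_prP x y : coset_pr x = coset_pr y <-> (x^-1 * y)%g \in Gamma.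
Proof.
split=> [/eqmodP|xy]; first by [].
by apply/eqmodP.
Qed.

Lemma coset_prM x g : g \in Gamma -> coset_pr (x * g)%g = coset_pr x.
Proof. by move=> Gg; apply/esym/coset_prP; rewrite mulKg. Qed.

Lemma mulgl_cont (a : H) : continuous (fun x : H => (a * x)%g).
Proof.
move=> x; apply: (@continuous_comp _ _ _ (fun x => (a, x)) (fun p : H * H => (p.1 * p.2)%g)).
  by apply: cvg_pair => //=; exact: cvg_cst.
exact: mulg_continuous.
Qed.

Lemma mulgr_cont (a : H) : continuous (fun x : H => (x * a)%g).
Proof.
move=> x; apply: (@continuous_comp _ _ _ (fun x => (x, a)) (fun p : H * H => (p.1 * p.2)%g)).
  by apply: cvg_pair => //=; exact: cvg_cst.
exact: mulg_continuous.
Qed.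

Lemma mulVg_cont : continuous (fun p : H * H => (p.1^-1 * p.2)%g).
Proof.
apply: (@cont_comp _ _ _ (fun p : H * H => ((p.1^-1)%g, p.2)) (fun p => (p.1 * p.2)%g)).
  apply: cont_pair; last exact: cont_snd.
  by apply: cont_comp (@invg_continuous H); exact: cont_fst.
exact: mulg_continuous.
Qed.

Lemma translate_open (x : H) (D : set H) : open D -> open [set (x * d)%g | d in D].
Proof.
have -> : [set (x * d)%g | d in D] = (fun y => (x^-1 * y)%g) @^-1` D.
  apply/seteqP; split=> [_ [d Dd <-]|y Dy] /=; first by rewrite mulKg.
  by exists (x^-1 * y)%g => //; rewrite mulVKg.
by move/continuousP : (@mulgl_cont (x^-1)%g); apply.
Qed.

Lemma coset_pr_open (U : set H) : open U -> open (coset_pr @` U).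
Proof.
move=> oU; suff : open (coset_pr @^-1` (coset_pr @` U)) by [].
rewrite openE => x [u Uu /esym/coset_prP]; rewrite /interior => xu.
have : nbhs x ((fun y => y * (x^-1 * u)) @^-1` U)%g.
  by apply: mulgr_cont; rewrite mulVKg; apply: open_nbhs_nbhs.
apply: filterS => y /= Uy; exists (y * (x^-1 * u))%g => //.
exact: coset_prM.
Qed.

End CosetSpace.

Section FiniteGeneration.
Context (R : realType) (H : topGroupType) (Gamma : groupClosed H).
Hypothesis HL : lie_group R H.
Hypothesis Hc : connected [set: H].
Hypothesis Gd : [set` Gamma] `<=` isolated [set` Gamma].
Hypothesis Kc : compact [set: coset_space Gamma].

(** Around any point there is a neighbourhood that contains at most one element
    of a discrete subgroup. *)
Lemma discrete_compact_finite (C : set H) : compact C ->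
  exists S : seq H, forall g, g \in Gamma -> C g -> g \in S.
Proof.
move=> Cc; have G1 : [set` Gamma] 1%g by exact: gpred1.
have [_ [V nV VG]] := Gd G1.
have nW : nbhs (1%g, 1%g) [set p : H * H | V (p.1^-1 * p.2)%g].
  by apply: mulVg_cont; rewrite /= invg1 mulg1.
have /choice[W WP] : forall x : H, exists W, nbhs x W /\
    forall g h, g \in Gamma -> h \in Gamma -> W g -> W h -> g = h.
  move=> x; have [[W1 W2] /= [nW1 nW2] W12] := nW.
  exists ((fun y => x^-1 * y)%g @^-1` (W1 `&` W2)); split.
    by apply: mulgl_cont; rewrite mulVg; exact: filterI.
  move=> g h Gg Gh /= [W1g _] [_ W2h].
  have Vgh : V (g^-1 * h)%g.
    have := W12 (x^-1 * g, x^-1 * h)%g (conj W1g W2h).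
    by rewrite /= invgM invgK mulgA mulgK.
  have : (V `&` [set` Gamma]) (g^-1 * h)%g.
    by split=> //=; rewrite gpredM ?gpredV.
  by rewrite VG => /= gh; rewrite -[LHS]mulg1 -gh mulVKg.
have [x _|xs xsP] := compact_finite_cover (U := W) Cc.
  by exists x; have [] := WP x.
exists [seq xget 1%g [set g | g \in Gamma /\ W x g] | x <- xs] => g Gg Cg.
have [x xxs Wxg] := xsP g Cg; apply/mapP; exists x => //.
have [Gx Wx] := xgetI 1%g (conj Gg Wxg : [set g | g \in Gamma /\ W x g] g).
by have [_] := WP x; apply.
Qed.

(** Let the open relatively compact set [O] meet every coset of [Gamma]. For a
    subgroup [P] of [Gamma] that contains the finite set of elements of [Gamma]
    of the form [o^-1 * o'], the set [O P] is open, and so is its complement, a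
    union of other translates of [O]; by connectedness it is the whole group. *)
Lemma fin_gen_lattice : exists S : seq H, {subset S <= Gamma} /\
  forall P : set H, P 1%g ->
    (forall g h, g \in Gamma -> h \in Gamma -> P g -> P h -> P (g * h)%g) ->
    (forall g, g \in Gamma -> P g -> P (g^-1)%g) ->
    (forall g, g \in S -> P g) -> forall g, g \in Gamma -> P g.
Proof.
have [C Cc nC] := lie_loc_compact HL (1%g : H).
pose D := interior C.
have oD : open D by exact: open_interior.
have D1 : D 1%g by exact: nbhs_singleton (nbhs_interior nC).
have [|xs xsP] := compact_finite_cover
    (U := fun x : H => coset_pr Gamma @` [set (x * d)%g | d in D]) Kc.
  move=> k _; have [x xk] := coset_pr_surj k; exists x.
  apply: open_nbhs_nbhs; split.
    by apply: coset_pr_open; exact: translate_open.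
  by exists x => //; exists 1%g => //; rewrite mulg1.
pose O := \bigcup_(x in [set` xs]) [set (x * d)%g | d in D].
pose Q := \bigcup_(x in [set` xs]) [set (x * d)%g | d in C].
have OQ : O `<=` Q.
  by move=> y [x xxs [d Dd <-]]; exists x => //; exists d => //; exact: interior_subset.
have Qc : compact Q.
  rewrite /Q bigcup_seq; apply: bigsetU_compact => x _.
  by apply: continuous_compact => //; exact/continuous_subspaceT/mulgl_cont.
have oO : open O by apply: bigcup_open => x _; exact: translate_open.
have cover y : exists2 o, O o & exists2 g, g \in Gamma & y = (o * g)%g.
  have [x xxs [_ [d Dd <-] /coset_prP xdy]] := xsP (coset_pr Gamma y) Logic.I.
  exists (x * d)%g; first by exists x => //; exists d.
  by exists ((x * d)^-1 * y)%g => //; rewrite mulVKg.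
have QQc : compact [set (p.1^-1 * p.2)%g | p in Q `*` Q].
  apply: continuous_compact; last exact: compact_setX.
  exact/continuous_subspaceT/mulVg_cont.
have [S0 S0P] := discrete_compact_finite QQc.
exists [seq g <- S0 | g \in Gamma]; split; first by move=> g; rewrite mem_filter => /andP[].
move=> P P1 PM PV PS.
have OOP o o' : O o -> O o' -> (o^-1 * o')%g \in Gamma -> P (o^-1 * o')%g.
  move=> Oo Oo' Goo; apply: PS; rewrite mem_filter Goo /=; apply: S0P => //.
  by exists (o, o') => //; split; exact: OQ.
pose U := [set y | exists2 o, O o & exists2 g, g \in Gamma /\ P g & y = (o * g)%g].
have nbhs_translate o g : O o -> nbhs (o * g)%g [set z | O (z * g^-1)%g].
  by move=> Oo; apply: mulgr_cont; rewrite mulgK; apply: open_nbhs_nbhs.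
have UT : U = [set: H].
  apply: Hc.
  - have [o Oo _] := cover 1%g; exists o, o => //.
    by exists 1%g; rewrite ?mulg1 //; split=> //; exact: gpred1.
  - exists U; last by rewrite setTI.
    rewrite openE => _ [o Oo [g [Gg Pg] ->]]; rewrite /interior.
    apply: filterS (nbhs_translate o g Oo) => z /= Oz.
    by exists (z * g^-1)%g => //; exists g => //; rewrite mulgVK.
  - exists U; last by rewrite setTI.
    rewrite -openC openE => y Uy; rewrite /interior.
    have [o Oo [g Gg yE]] := cover y.
    rewrite yE; apply: filterS (nbhs_translate o g Oo) => z /= Oz.
    move=> [o' Oo' [h [Gh Ph] zE]]; apply: Uy; exists o => //; exists g => //.
    split=> //.
    have ghE : (o'^-1 * (z * g^-1))%g = (h * g^-1)%g by rewrite zE -mulgA mulKg.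
    have Ghg : (h * g^-1)%g \in Gamma by rewrite gpredM ?gpredV.
    have Phg : P (h * g^-1)%g by rewrite -ghE; apply: OOP => //; rewrite ghE.
    have -> : g = ((h * g^-1)^-1 * h)%g by rewrite invgM invgK mulgVK.
    by apply: PM => //; rewrite ?gpredV //; exact: PV.
move=> g Gg; have [o Oo _] := cover 1%g.
have [o' Oo' [h [Gh Ph] e']] : U (o * g)%g by rewrite UT.
have gE : g = (o^-1 * o' * h)%g by rewrite -mulgA -e' mulKg.
have Goo : (o^-1 * o')%g \in Gamma.
  have -> : (o^-1 * o' = g * h^-1)%g by rewrite gE mulgK.
  by rewrite gpredM ?gpredV.
by rewrite gE; apply: PM => //; exact: OOP.
Qed.

End FiniteGeneration.

(** * Bases of groups of integer-valued functions *)

(** Gaussian elimination over the integers: a group of functions that are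
    integer-valued on the finite list [S] and determined by their values there
    has a basis that is triangular with respect to suitable points of [S]. *)
Lemma triangular_basis (R : realType) (X : eqType) (S : seq X) (P : set (X -> R)) :
  P (fun=> 0) ->
  (forall a b (c : int), P a -> P b -> P (fun x => a x + c%:~R * b x)) ->
  (forall a x, P a -> x \in S -> a x \is a Num.int) ->
  (forall a, P a -> (forall x, x \in S -> a x = 0) -> a = (fun=> 0)) ->
  exists (m : nat) (v : 'I_m -> X -> R) (y : 'I_m -> X),
  [/\ forall i, P (v i), forall i, y i \in S,
      forall i, v i (y i) != 0, forall i j : 'I_m, (j < i)%N -> v i (y j) = 0
    & forall a, P a -> exists c : 'I_m -> int, forall x,
        a x = \sum_i (c i)%:~R * v i x].
Proof.
elim: S P => [|x S IHS] P P0 Plin Pint Pinj.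
  have y0 : 'I_0 -> X by case.
  exists 0%N, (fun _ _ => 0), y0.
  split; try by case.
  move=> a /Pinj a0; exists (fun=> 0) => x; rewrite big_ord0 a0 //.
pose P' : set (X -> R) := [set a | P a /\ a x = 0].
have [||||m [v [y [Pv yS vy0 vyt vspan]]]] := IHS P'.
- by [].
- move=> a b c [Pa ax] [Pb bx]; split; first exact: Plin.
  by rewrite /= ax bx mulr0 addr0.
- by move=> a z [Pa _] zS; apply: Pint => //; rewrite inE zS orbT.
- move=> a [Pa ax] aS; apply: Pinj => // z; rewrite inE => /orP[/eqP->//|].
  exact: aS.
have [all0|] := pselect (forall a, P a -> a x = 0).
  exists m, v, y; split=> //.
  - by move=> i; have [] := Pv i.
  - by move=> i; rewrite inE yS orbT.
  - by move=> a Pa; apply: vspan; split=> //; exact: all0.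
move=> /existsNP[a /not_implyP[Pa /eqP ax0]].
have int_of b : P b -> exists z : int, b x = z%:~R.
  by move=> Pb; apply/intrP; apply: Pint => //; rewrite mem_head.
pose Q (d : nat) := `[< exists b, P b /\ b x = d.+1%:R >].
have exQ : exists d, Q d.
  have [z az] := int_of a Pa.
  case: z az => [[|k]|k] az.
  - by move: ax0; rewrite az eqxx.
  - by exists k; apply/asboolP; exists a.
  - exists k; apply/asboolP; exists (fun t => 0 + (-1)%:~R * a t); split; first exact: Plin.
    by rewrite add0r az NegzE !rmorphN /= mulNr mul1r opprK.
case: (ex_minnP exQ) => d /asboolP[b [Pb bx]] dmin.
have dvd e : P e -> exists z : int, e x = z%:~R * d.+1%:R.
  move=> Pe; have [z ez] := int_of e Pe.
  exists (z %/ d.+1)%Z.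
  pose r := (z %% d.+1)%Z.
  have r0 : 0 <= r by rewrite modz_ge0.
  have rd : r < d.+1 by rewrite ltz_pmod.
  have zE : z = (z %/ d.+1)%Z * d.+1%:Z + r by exact: divz_eq.
  have Pr : P (fun t => e t + (- (z %/ d.+1)%Z)%:~R * b t) by exact: Plin.
  have rx : e x + (- (z %/ d.+1)%Z)%:~R * b x = r%:~R.
    by rewrite ez bx {1}zE rmorphD rmorphM rmorphN /=; ring.
  have [r_eq0|rn0] := eqVneq r 0.
    by rewrite ez {1}zE r_eq0 addr0 rmorphM.
  have rpos : 0 < r by rewrite lt_neqAle eq_sym rn0.
  exfalso; move: rpos rd rx; case: (r) => // [[|k]] // _ kd kx.
  have : Q k by apply/asboolP; exists (fun t => e t + (- (z %/ d.+1)%Z)%:~R * b t).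
  by move=> /dmin; move: kd; rewrite ltz_nat ltnS ltnNge => /negP.
exists m.+1, (fun i => if unlift ord0 i is Some j then v j else b),
  (fun i => if unlift ord0 i is Some j then y j else x).
split.
- by move=> i; case: unliftP => [j _|_] //; have [] := Pv j.
- by move=> i; case: unliftP => [j _|_]; rewrite inE ?yS ?orbT ?eqxx.
- by move=> i; case: unliftP => [j _|_] //; rewrite bx pnatr_eq0.
- move=> i j; case: (unliftP ord0 i) => [i' ->|->] //.
  case: (unliftP ord0 j) => [j' ->|->] //; last by have [] := Pv i'.
  by move=> ji; apply: vyt.
- move=> e Pe; have [z ez] := dvd e Pe.
  have [|c cP] := vspan (fun t => e t + (- z)%:~R * b t).
    split; first exact: Plin.
    by rewrite /= ez bx rmorphN /= mulNr subrr.
  exists (fun i => if unlift ord0 i is Some j then c j else z) => t.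
  rewrite big_ord_recl unlift_none; under eq_bigr do rewrite liftK.
  by rewrite -cP rmorphN /=; ring.
Qed.

(** * A lower bound for the mean of powers of the cosine kernel *)

Section CosineKernel.
Context (R : realType).
Local Open Scope complex_scope.

Definition cexp (t : R) : R[i] := cosp t +i* sinp t.
Definition sqmod (z : R[i]) : R := complex.Re z ^+ 2 + complex.Im z ^+ 2.

Lemma sqmodM z w : sqmod (z * w) = sqmod z * sqmod w.
Proof. by case: z w => [a b] [c d]; rewrite /sqmod /=; ring. Qed.

Lemma sqmod1 : sqmod 1 = 1.
Proof. by rewrite /sqmod /= expr1n expr0n addr0. Qed.

Lemma cexpD s t : cexp (s + t) = cexp s * cexp t.
Proof. by rewrite /cexp cospD sinpD; apply/eqP; rewrite eq_complex /= eqxx /= addrC. Qed.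

Lemma cexp0 : cexp 0 = 1. Proof. by rewrite /cexp cosp0 sinp0. Qed.

Lemma cexpMn t n : cexp t ^+ n = cexp (n%:R * t).
Proof.
elim: n => [|n IHn]; first by rewrite mul0r cexp0.
by rewrite exprS IHn -cexpD -natr1 mulrDl mul1r addrC.
Qed.

Lemma cexp_sum (I : Type) (r : seq I) (t : I -> R) :
  cexp (\sum_(i <- r) t i) = \prod_(i <- r) cexp (t i).
Proof. exact: (big_morph cexp cexpD cexp0). Qed.

Lemma sqmod1D t : sqmod (1 + cexp t) = 2 + 2 * cosp t.
Proof.
have := cosp_sinp t; rewrite /sqmod /= add0r => h.
transitivity (1 + 2 * cosp t + (cosp t ^+ 2 + sinp t ^+ 2)); first by ring.
by rewrite h; ring.
Qed.

Definition bincoef m n (f : {ffun 'I_m -> 'I_n.+1}) : R := \prod_i 'C(n, f i)%:R.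

Lemma sum_bincoef m n :
  \sum_(f : {ffun 'I_m -> 'I_n.+1}) bincoef f = 2 ^+ (n * m).
Proof.
rewrite -(bigA_distr_bigA (fun (i : 'I_m) (j : 'I_n.+1) => 'C(n, j)%:R)).
have -> : \sum_(j < n.+1) 'C(n, j)%:R = 2 ^+ n :> R.
  have := exprDn (1 : R) 1 n; rewrite -[1 + 1]/2 => ->.
  by apply: eq_bigr => j _; rewrite !expr1n mulr1.
by rewrite prodr_const card_ord -exprM.
Qed.

(** The kernel is the squared modulus of the trigonometric polynomial
    [\prod_i (1 + e (t i)) ^+ n]. *)
Lemma cosine_kernel_expand m n (t : 'I_m -> R) :
  \prod_i (2 + 2 * cosp (t i)) ^+ n =
  \sum_(f : {ffun 'I_m -> 'I_n.+1}) \sum_(f' : {ffun 'I_m -> 'I_n.+1})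
    bincoef f * bincoef f' *
    cosp (\sum_i (f i)%:R * t i - \sum_i (f' i)%:R * t i).
Proof.
pose tau (f : {ffun 'I_m -> 'I_n.+1}) : R := \sum_i (f i)%:R * t i.
have -> : \prod_i (2 + 2 * cosp (t i)) ^+ n = sqmod (\prod_i (1 + cexp (t i)) ^+ n).
  rewrite (big_morph _ sqmodM sqmod1); apply: eq_bigr => i _.
  by rewrite -sqmod1D; elim: (n) => [|k IHk]; rewrite ?sqmod1 // !exprS sqmodM IHk.
have -> : \prod_i (1 + cexp (t i)) ^+ n =
    \sum_(f : {ffun 'I_m -> 'I_n.+1}) (bincoef f)%:C * cexp (tau f).
  under eq_bigr => i _ do rewrite exprDn.
  rewrite bigA_distr_bigA; apply: eq_bigr => f _.
  rewrite /bincoef cexp_sum (rmorph_prod (real_complex R)) -big_split /=.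
  apply: eq_bigr => i _; rewrite expr1n mul1r cexpMn -mulr_natl.
  by rewrite rmorph_nat.
have ReD : {morph (@complex.Re R) : x y / x + y} by move=> [? ?] [? ?].
have ImD : {morph (@complex.Im R) : x y / x + y} by move=> [? ?] [? ?].
rewrite /sqmod (big_morph _ ReD erefl) (big_morph _ ImD erefl).
rewrite !expr2 !mulr_suml -big_split /=; apply: eq_bigr => f _.
rewrite !mulr_sumr -big_split /=; apply: eq_bigr => f' _.
by rewrite -/(tau f) -/(tau f') cospB; ring.
Qed.

Lemma sum_sqr_ge (I : finType) (B : I -> R) :
  (\sum_i B i) ^+ 2 <= #|I|%:R * \sum_i B i ^+ 2.
Proof.
have [I0|Ipos] := posnP #|I|.
  rewrite big1 ?expr0n ?I0 ?mul0r // => i _.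
  by have := fintype0 i I0.
set S := \sum_i B i; set N := #|I|%:R : R.
have N0 : 0 < N by rewrite ltr0n.
have : 0 <= \sum_i (B i - S / N) ^+ 2 by apply: sumr_ge0 => i _; exact: sqr_ge0.
have -> : \sum_i (B i - S / N) ^+ 2 = \sum_i B i ^+ 2 - S ^+ 2 / N.
  transitivity (\sum_i (B i ^+ 2 + (- (2 * (S / N)) * B i + (S / N) ^+ 2))).
    by apply: eq_bigr => i _; ring.
  rewrite !big_split /= -mulr_sumr -/S sumr_const -[_ *+ #|I|]mulr_natl -/N.
  by field; rewrite gt_eqF.
by rewrite subr_ge0 ler_pdivrMr // mulrC.
Qed.

(** Exponents [n = k * m.+1] suffice: by Bernoulli's inequality [rho^-1 ^+ n] is
    at least a polynomial in [k] of degree [m.+1]. *)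
Lemma exp_beats_poly (rho : R) m : 0 <= rho -> rho < 1 ->
  exists n, rho ^+ n * n.+1%:R ^+ m < 1.
Proof.
move=> r0 r1; have [r_eq0|rn0] := eqVneq rho 0.
  by exists 1%N; rewrite r_eq0 expr1 mul0r.
have rpos : 0 < rho by rewrite lt_neqAle eq_sym rn0.
pose t := rho^-1 - 1; have t0 : 0 < t by rewrite subr_gt0 invf_gt1.
pose u := Num.min 1 t; have u0 : 0 < u by rewrite lt_min ltr01 t0.
have u1 : u <= 1 by rewrite ge_min lexx.
have ut : u <= t by rewrite ge_min lexx orbT.
pose C := (m.+1%:R / u) ^+ m / t.
have C0 : 0 <= C by rewrite divr_ge0 ?(ltW t0) // exprn_ge0 // divr_ge0 ?ler0n // ltW.
pose k := Num.bound C; have kC : C < k%:R by exact: archi_boundP.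
exists (k * m.+1)%N.
have rhoE : rho = (1 + t)^-1 by rewrite /t addrC subrK invrK.
have t1 : 0 < 1 + t by rewrite addr_gt0.
rewrite rhoE exprVn ltr_pdivrMl ?exprn_gt0 // mulr1 exprM.
have bern : 1 + k%:R * t <= (1 + t) ^+ k.
  elim: (k) => [|j IHj]; first by rewrite mul0r addr0 expr0.
  rewrite exprS -natr1; apply: (@le_trans _ _ ((1 + t) * (1 + j%:R * t))); last by rewrite ler_pM2l.
  have : 0 <= t * (j%:R * t) by rewrite !mulr_ge0 ?ler0n ?ltW.
  by lra.
have kt0 : 0 < 1 + k%:R * t by rewrite ltr_wpDr ?mulr_ge0 ?ler0n ?ltW.
apply: (@lt_le_trans _ _ ((1 + k%:R * t) ^+ m.+1)); last first.
  by apply: lerXn2r => //; rewrite nnegrE ?(ltW kt0) // exprn_ge0 // ltW.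
rewrite exprS.
have le1 : (k * m.+1).+1%:R <= (m.+1%:R / u) * (1 + k%:R * t).
  rewrite -mulrA [u^-1 * _]mulrC mulrA ler_pdivlMr //.
  apply: (@le_trans _ _ (m.+1%:R * ((1 + k%:R) * u))).
    rewrite mulrA ler_pM2r // -natr1 natrM mulrDr mulr1 addrC mulrC lerD2r.
    by rewrite ler1n.
  rewrite ler_pM2l ?ltr0n // mulrDl mul1r lerD //.
  by rewrite ler_wpM2l ?ler0n.
apply: (@le_lt_trans _ _ ((m.+1%:R / u) ^+ m * (1 + k%:R * t) ^+ m)).
  rewrite -exprMn; apply: lerXn2r => //; rewrite nnegrE ?ler0n //.
  by apply: mulr_ge0; [rewrite divr_ge0 ?ler0n ?(ltW u0)|rewrite ltW].
rewrite ltr_pM2r ?exprn_gt0 //.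
have : (m.+1%:R / u) ^+ m < k%:R * t by rewrite -ltr_pdivrMr.
by lra.
Qed.

End CosineKernel.

(** * Quotient maps between compact Hausdorff spaces, and tori *)

(** A continuous surjection from a compact space to a Hausdorff one is closed,
    hence a quotient map. *)
Lemma compact_quotient_cont (X Y Z : topologicalType) (f : X -> Y) (h : Y -> Z) :
  compact [set: X] -> hausdorff_space Y -> continuous f -> range f = [set: Y] ->
  continuous (fun x => h (f x)) -> continuous h.
Proof.
move=> Xc YT cf fsurj chf; apply/continuous_closedP => A cA.
have -> : h @^-1` A = f @` ((fun x => h (f x)) @^-1` A).
  apply/seteqP; split=> [y Ay|_ [x Ax <-] //].
  have : [set: Y] y by []. 
  by rewrite -fsurj => -[x _ xy]; exists x => //; rewrite /= xy.
apply: compact_closed => //; apply: continuous_compact.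
  exact: continuous_subspaceT.
apply: subclosed_compact Xc _ => //.
by move/continuous_closedP : chf; apply.
Qed.

Lemma hausdorff_functions (R : realType) (X : topologicalType) :
  (forall x y : X, x != y -> exists2 f : X -> R, continuous f & f x != f y) ->
  hausdorff_space X.
Proof.
move=> sep x y xy; apply/eqP; apply: contrapT => /negP /sep[f cf].
move=> /eqP; apply; apply: (@Rhausdorff R) => A B fA fB.
have [z [Az Bz]] := xy (f @^-1` A) (f @^-1` B) (cf _ _ fA) (cf _ _ fB).
by exists (f z).
Qed.

Section Torus.
Context (R : realType) (m : nat).
Local Open Scope quotient_scope.

Local Notation Q := (quotient_topology (Quotient.quot (@int_lattice R m))).

Definition torus_pr : 'rV[R]_m -> torus R m := \pi_Q.

Lemma torus_pr_cont : continuous torus_pr.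
Proof. exact: pi_continuous. Qed.

Lemma torus_pr_surj t : exists u, torus_pr u = t.
Proof.
by exists (repr (t : Q)); exact: reprK.
Qed.

Lemma torus_prP u v : torus_pr u = torus_pr v <-> forall i, u 0 i - v 0 i \is a Num.int.
Proof.
have -> : torus_pr u = torus_pr v <-> u - v \in @int_lattice R m.
  split=> [/eqmodP|uv]; first by [].
  by apply/eqmodP.
split=> [/forallP uv i|uv]; first by have := uv i; rewrite !mxE.
by apply/forallP => i; rewrite !mxE.
Qed.

Lemma torus_prD u v : torus_pr (u + v) = torus_pr u + torus_pr v.
Proof. exact: (@pi_addr _ _ _ _ _ (Quotient.quot (@int_lattice R m))). Qed.

(** The functions [cos (2 pi u i)] and [sin (2 pi u i)] descend to the torus and
    separate its points. *)
Lemma torus_hausdorff : hausdorff_space (torus R m).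
Proof.
apply: (@hausdorff_functions R) => t t' /eqP tt'.
have [u ut] := torus_pr_surj t; have [u' ut'] := torus_pr_surj t'.
have desc (f : R -> R) (i : 'I_m) : continuous f ->
    (forall x y, x - y \is a Num.int -> f x = f y) ->
    exists2 F : torus R m -> R, continuous F & forall u, F (torus_pr u) = f (u 0 i).
  move=> cf fper.
  pose F (t : torus R m) : R :=
    f ((repr (t : Q) : 'rV[R]_m) 0 i).
  have FE u0 : F (torus_pr u0) = f (u0 0 i).
    apply: fper.
    have /torus_prP/(_ i) : torus_pr (repr (torus_pr u0 : Q)) = torus_pr u0.
      exact: reprK.
    by [].
  exists F => //; apply/quotient_continuous.
  rewrite (_ : _ \o _ = (fun u0 : 'rV[R]_m => f (u0 0 i))); last first.
    by apply/funext => u0; exact: FE.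
  apply: (@cont_comp _ _ _ (fun u0 : 'rV[R]_m => u0 0 i)) cf.
  exact: coord_continuous.
have [i ni] : exists i, ~~ (u 0 i - u' 0 i \is a Num.int).
  apply: contrapT => none; apply: tt'; rewrite -ut -ut'; apply/torus_prP => i.
  by apply: contrapT => /negP ni; apply: none; exists i.
have [C cC CE] := desc (@cosp R) i (@cosp_cont R) (fun x y xy => (circ_eq_int xy).1).
have [S cS SE] := desc (@sinp R) i (@sinp_cont R) (fun x y xy => (circ_eq_int xy).2).
have [Ctt|Ctt] := eqVneq (C t) (C t'); last by exists C.
exists S => //; apply: contraNneq ni => Stt; apply: circ_eq.
  by rewrite -!CE ut ut'.
by rewrite -!SE ut ut'.
Qed.

End Torus.

Lemma row_cont (R : realType) (X : topologicalType) m (v : 'I_m -> X -> R) :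
  (forall i, continuous (v i)) -> continuous (fun x => \row_i v i x : 'rV[R]_m).
Proof.
move=> cv x U [P nP PU].
have : \forall y \near x, forall i, P 0 i (v i y).
  apply: filter_forall => i; have := nP 0 i; rewrite mxE; exact: cv.
apply: filterS => y yP; apply: PU => i j; rewrite mxE (ord1 i); exact: yP.
Qed.

(** * Arguments of eigenfunctions *)

Section Arguments.
Context (R : realType) (H : topGroupType) (Gamma : groupClosed H).
Context (G : topGroupType) (act : G -> coset_space Gamma -> coset_space Gamma).
Context (L : uniformType) (actL : G -> L -> L) (q0 : coset_space Gamma -> L).
Hypothesis HL : lie_group R H.
Hypothesis Hc : connected [set: H].
Hypothesis Hsc : simply_connected R H.
Hypothesis Gd : [set` Gamma] `<=` isolated [set` Gamma].
Hypothesis Gab : forall g h : G, commute g h.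
Hypothesis Kflow : flow act.
Hypothesis Kinv : forall f : coset_space Gamma -> R[i]^o,
  continuous f -> invariant_fun act f -> exists c, forall x, f x = c.
Hypothesis Lflow : flow actL.
Hypothesis Leq : equicontinuous_flow actL.
Hypothesis cq0 : continuous q0.
Hypothesis q0surj : range q0 = [set: L].
Hypothesis q0eq : equivariant act actL q0.

Local Notation pr := (coset_pr Gamma).

Definition proj_factor (x : H) : L := q0 (pr x).
Local Notation q := proj_factor.

Lemma proj_factor_cont : continuous q.
Proof. exact: cont_comp (@coset_pr_cont H Gamma) cq0. Qed.

Lemma proj_factor_surj z : exists x, q x = z.
Proof.
have : [set: L] z by [].
rewrite -q0surj => -[k _ <-]; have [x <-] := coset_pr_surj k.
by exists x.
Qed.

Lemma factor_flow : eq_min_flow R actL.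
Proof.
apply: (factor_eq_min_flow Kinv) cq0 q0surj q0eq => //.
by exists (pr 1%g).
Qed.
Local Notation F := factor_flow.

(** The factor is a topological quotient of the group: of its coset space by
    compactness. *)
Lemma proj_factor_quotient (Z : topologicalType) (f : L -> Z) :
  continuous (fun x => f (q x)) -> continuous f.
Proof.
move=> cf; apply: (compact_quotient_cont (flow_compact Kflow) (flow_hausdorff Lflow) cq0 q0surj).
exact/quotient_continuous.
Qed.

Lemma real_invariant_cst (f : coset_space Gamma -> R) :
  continuous f -> invariant_fun act f -> forall x y, f x = f y.
Proof.
move=> cf finv x y.
have [c cP] := Kinv (real_complex_cont cf) (fun g k => congr1 _ (finv g k)).
by apply: complexI; rewrite !cP.
Qed.

(** The arguments of eigenfunctions of the factor, pulled back to the simply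
    connected group and normalized at 1; [a] is the argument of the
    eigenvalue. They form an additive group, the dual of the factor. *)
Definition eigen_arg : set (H -> R) := [set h | [/\ continuous h, h 1%g = 0 &
  forall g : G, exists a : R, forall y y', q y' = actL g (q y) ->
    h y' - h y - a \is a Num.int]].

Lemma eigen_arg0 : eigen_arg (fun=> 0).
Proof.
split=> [||g]; [exact: cont_cst|by []|exists 0 => y y' _].
by rewrite !subr0 rpred0.
Qed.

Lemma eigen_arg_lin h k (c : int) :
  eigen_arg h -> eigen_arg k -> eigen_arg (fun x => h x + c%:~R * k x).
Proof.
move=> [ch h1 hP] [ck k1 kP]; split=> [||g].
- by apply: cont_add => //; exact: cont_scale.
- by rewrite h1 k1 mulr0 addr0.
- have [a aP] := hP g; have [b bP] := kP g; exists (a + c%:~R * b) => y y' yy'.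
  have -> : h y' + c%:~R * k y' - (h y + c%:~R * k y) - (a + c%:~R * b) =
            (h y' - h y - a) + c%:~R * (k y' - k y - b) by ring.
  by rewrite rpredD ?rpredM ?intr_int ?aP ?bP.
Qed.

Lemma eigen_arg_comb m (v : 'I_m -> H -> R) (c : 'I_m -> int) :
  (forall i, eigen_arg (v i)) -> eigen_arg (fun x => \sum_i (c i)%:~R * v i x).
Proof.
move=> Pv; elim: (index_enum _) => [|i s IHs].
  by under eq_fun do rewrite big_nil; exact: eigen_arg0.
under eq_fun do rewrite big_cons addrC.
exact: eigen_arg_lin.
Qed.

Lemma eigen_arg_fiber h y y' : eigen_arg h -> q y = q y' -> h y - h y' \is a Num.int.
Proof.
move=> [_ _ hP] yy'; have [a aP] := hP 1%g.
have h1 := aP y y; have h2 := aP y' y; rewrite !(flow_act1 Lflow) in h1 h2.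
have -> : h y - h y' = (h y - h y' - a) - (h y - h y - a) by ring.
by rewrite rpredB ?h1 ?h2.
Qed.

Lemma proj_factorM y g : g \in Gamma -> q (y * g)%g = q y.
Proof. by move=> Gg; rewrite /q coset_prM. Qed.

(** The difference of the two sides is continuous and integer-valued in [y]. *)
Lemma eigen_argM h y g : eigen_arg h -> g \in Gamma -> h (y * g)%g = h y + h g.
Proof.
move=> Ph Gg; have [ch h1 _] := Ph.
have c1 : continuous (fun y => h (y * g)%g - h y).
  by apply: cont_sub => //; apply: cont_comp ch; exact: mulgr_cont.
have := @connected_int_cst R H (fun y => h (y * g)%g - h y) Hc c1 _ y 1%g.
rewrite mul1g h1 subr0 => <- => [|x]; first by ring.
by apply: eigen_arg_fiber => //; exact: proj_factorM.
Qed.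

Lemma eigen_arg_int h g : eigen_arg h -> g \in Gamma -> h g \is a Num.int.
Proof.
move=> Ph Gg; have [_ h1 _] := Ph.
rewrite -[h g]subr0 -h1; apply: eigen_arg_fiber => //.
by rewrite -[g]mul1g proj_factorM.
Qed.

(** If the winding numbers along [Gamma] vanish, the argument is a bounded
    real function on the coset space that the action of any [g] translates by a
    constant; boundedness forces the constant to be 0, and invariant functions
    are constant. *)
Lemma eigen_arg_eq0 h : eigen_arg h -> (forall g, g \in Gamma -> h g = 0) ->
  h = (fun=> 0).
Proof.
move=> Ph h0; have [ch h1 hP] := Ph.
pose hb (k : coset_space Gamma) : R := h (repr (k : quotient_topology (cosets Gamma))).
have hbE x : hb (pr x) = h x.
  set y := repr (pr x : quotient_topology (cosets Gamma)).
  have /coset_prP yx : pr x = pr y by apply/esym; exact: reprK.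
  by rewrite /hb -/y -[y](mulVKg x) eigen_argM // (h0 _ yx) addr0.
have chb : continuous hb.
  apply/quotient_continuous.
  by rewrite (_ : _ \o _ = h) //; apply/funext => x; exact: hbE.
have Kc : connected [set: coset_space Gamma].
  have -> : [set: coset_space Gamma] = range pr.
    by apply/seteqP; split=> // k _; have [x <-] := coset_pr_surj k; exists x.
  apply: connected_continuous_connected => //.
  by apply: continuous_subspaceT; exact: coset_pr_cont.
have act_cont g : continuous (act g).
  apply: (@cont_comp _ _ _ (fun x => (g, x)) (fun p => act p.1 p.2)).
    by apply: cont_pair => x; [exact: cst_continuous|exact: cvg_id].
  exact: (flow_continuous Kflow).
have [B B0 hB] := compact_bounded_fun (flow_compact Kflow) chb.
have hinv : invariant_fun act hb.
  move=> g k; have [a aP] := hP g.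
  have cst : forall k k', hb (act g k) - hb k - a = hb (act g k') - hb k' - a.
    apply: (@connected_int_cst R _ _ Kc).
      apply: cont_sub; last exact: cont_cst.
      by apply: cont_sub => //; exact: cont_comp.
    move=> k'; have [y yk] := coset_pr_surj k'; have [y' yk'] := coset_pr_surj (act g k').
    by rewrite -yk' -yk !hbE; apply: aP; rewrite /q yk yk' q0eq.
  pose b := hb (act g k) - hb k.
  have step k' : hb (act g k') = hb k' + b by have := cst k' k; rewrite /b; lra.
  have orbit_hb n : hb (iter n (act g) k) = hb k + n%:R * b.
    elim: n => [|n IHn]; first by rewrite mul0r addr0.
    by rewrite iterS step IHn -natr1; ring.
  suff b0 : b = 0 by rewrite step b0 addr0.
  apply/eqP; rewrite -normr_eq0 -[_ == 0]negbK; apply/negP => bn0.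
  have bpos : 0 < `|b| by rewrite lt_neqAle eq_sym bn0 normr_ge0.
  pose n := Num.bound ((B + B) / `|b|).
  have : (B + B) / `|b| < n%:R by apply: archi_boundP; rewrite divr_ge0 // addr_ge0 // ltW.
  rewrite ltr_pdivrMr // ltNge => /negP; apply.
  have -> : n%:R * `|b| = `|hb (iter n (act g) k) - hb k|.
    by rewrite orbit_hb [hb k + _]addrC addrK normrM ger0_norm ?ler0n.
  by apply: le_trans (ler_normB _ _) _; exact: lerD.
apply/funext => x; rewrite -h1 -!hbE.
exact: real_invariant_cst.
Qed.

(** Eigenfunctions have constant modulus, so after normalization they take
    values in the circle and have an argument on the simply connected [H]. *)
Lemma eigen_arg_separates y y' : q y != q y' ->
  exists2 h, eigen_arg h & ~ (h y - h y' \is a Num.int).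
Proof.
move=> yy'.
have [f cf fyy'] := hausdorff_bump R (flow_hausdorff Lflow) yy'.
have [c [s [[cc cs rot] cyy']]] := rot_pair_separates F cf fyy'.
pose N z := c z ^+ 2 + s z ^+ 2.
have cN : continuous N by apply: cont_add; exact: cont_exp.
have N0 z : 0 <= N z by rewrite addr_ge0 ?sqr_ge0.
have [z0 Nz0] : exists z, 0 < N z.
  have pos z : c z != 0 -> 0 < N z.
    by move=> cz; rewrite ltr_pwDl ?sqr_ge0 // lt_neqAle sqr_ge0 andbT eq_sym sqrf_eq0.
  have [cy0|/pos] := eqVneq (c (q y)) 0; last by exists (q y).
  by exists (q y'); apply: pos; rewrite -cy0 eq_sym.
have mN : 0 < mean actL N by exact: (mean_gt0 F cN N0 Nz0).
have rot1 g a b : (forall x, c (actL g x) = a * c x - b * s x /\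
    s (actL g x) = b * c x + a * s x) ->
    a ^+ 2 + b ^+ 2 = 1 /\ forall x, N (actL g x) = N x.
  move=> ab; have NE x : N (actL g x) = (a ^+ 2 + b ^+ 2) * N x.
    by rewrite /N (ab x).1 (ab x).2; ring.
  have ab1 : a ^+ 2 + b ^+ 2 = 1.
    have := mean_act F g cN; under eq_fun do rewrite NE.
    by rewrite (meanZ F) // => /(canRL (mulfK (lt0r_neq0 mN))) ->; rewrite divff // lt0r_neq0.
  by split=> // x; rewrite NE ab1 mul1r.
have Ninv z z' : N z = N z'.
  have cNq : continuous (fun k => N (q0 k)) by exact: cont_comp.
  have iNq : invariant_fun act (fun k => N (q0 k)).
    by move=> g k; rewrite q0eq; have [a [b ab]] := rot g; exact: (rot1 _ _ _ ab).2.
  have [x <-] := proj_factor_surj z; have [x' <-] := proj_factor_surj z'.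
  exact: (real_invariant_cst cNq iNq).
pose nu := Num.sqrt (N z0); have nu0 : 0 < nu by rewrite sqrtr_gt0.
have nuE z : nu ^+ 2 = N z by rewrite sqr_sqrtr // (Ninv z z0).
pose c' x := nu^-1 * c (q x); pose s' x := nu^-1 * s (q x).
have cc' : continuous c' by apply: cont_scale; exact: cont_comp proj_factor_cont cc.
have cs' : continuous s' by apply: cont_scale; exact: cont_comp proj_factor_cont cs.
have cs1 x : c' x ^+ 2 + s' x ^+ 2 = 1.
  rewrite /c' /s' !exprMn -mulrDr -/(N (q x)) -nuE exprVn mulVf //.
  by rewrite expf_neq0 // gt_eqF.
have [h ch hP] := circle_lift Hsc (lie_loc_path_conn HL) cc' cs' cs1.
exists (fun x => h x - h 1%g).
  split; [by apply: cont_sub => //; exact: cont_cst|by rewrite subrr|move=> g].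
  have [a [b ab]] := rot g; have [ab1 _] := rot1 _ _ _ ab.
  have [t [ta tb]] := circ_surj ab1; exists t => x x' xx'.
  have -> : h x' - h 1%g - (h x - h 1%g) - t = h x' - (t + h x) by ring.
  apply: circ_eq.
    by rewrite cospD ta tb !(hP _).1 (hP _).2 /c' /s' xx' (ab _).1; ring.
  by rewrite sinpD ta tb !(hP _).2 (hP _).1 /c' /s' xx' (ab _).2; ring.
have -> : h y - h 1%g - (h y' - h 1%g) = h y - h y' by ring.
move=> /circ_eq_int[ceq _]; move/negP : cyy'; apply; apply/eqP.
move: ceq; rewrite !(hP _).1 /c' => /(mulfI _) -> //.
by rewrite invr_eq0 gt_eqF.
Qed.

(** The winding numbers of an eigenfunction along [Gamma] are a homomorphism,
    which factors through the abelianization. *)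
Section Restriction.
Variable h : H -> R.
Hypothesis Ph : eigen_arg h.
Implicit Types x y : subgroup Gamma.

Lemma eigen_arg_valM x y : h (val (x * y)%g) = h (val x) + h (val y).
Proof. by rewrite valM eigen_argM //; exact: (valP y). Qed.

Lemma eigen_arg_val1 : h (val (1%g : subgroup Gamma)) = 0.
Proof. by have [_ h1 _] := Ph; rewrite val1. Qed.

Lemma eigen_arg_valV x : h (val (x^-1)%g) = - h (val x).
Proof. by apply/eqP; rewrite -addr_eq0 -eigen_arg_valM mulVg eigen_arg_val1. Qed.

Lemma eigen_arg_derived x : x \in @derived (subgroup Gamma) -> h (val x) = 0.
Proof.
move=> /asboolP Dx.
pose K : {pred subgroup Gamma} := fun x => h (val x) == 0.
have K1 : 1%g \in K by rewrite unfold_in eigen_arg_val1.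
have KM : {in K &, forall u v, (u * v)%g \in K}.
  by move=> u v; rewrite !unfold_in eigen_arg_valM => /eqP-> /eqP->; rewrite addr0.
have KV : {in K, forall u, (u^-1)%g \in K}.
  by move=> u; rewrite !unfold_in eigen_arg_valV oppr_eq0.
pose S : groupClosed (subgroup Gamma) := HB.pack K
  (isInvClosed.Build _ K KV) (isMulClosed.Build _ K KM) (isMul1Closed.Build _ K K1).
apply/eqP; apply: (Dx S) => a b.
have -> : ([~ a, b]%g \in S) = (h (val [~ a, b]%g) == 0) by [].
by rewrite commgEl conjgE !eigen_arg_valM !eigen_arg_valV; apply/eqP; ring.
Qed.

End Restriction.

(** An argument is determined by its integer values on the finite generating
    set of [Gamma]. *)
Lemma eigen_basis : compact [set: coset_space Gamma] ->
  exists (m : nat) (v : 'I_m -> H -> R) (y : 'I_m -> H),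
  [/\ forall i, eigen_arg (v i), forall i, y i \in Gamma,
      forall i, v i (y i) != 0, forall i j : 'I_m, (j < i)%N -> v i (y j) = 0
    & forall h, eigen_arg h -> exists c : 'I_m -> int, forall x,
        h x = \sum_i (c i)%:~R * v i x].
Proof.
move=> Kc; have [S [SG Sgen]] := fin_gen_lattice HL Hc Gd Kc.
have [||||m [v [y [Pv yS vy0 vyt span]]]] := @triangular_basis R H S eigen_arg.
- exact: eigen_arg0.
- by move=> a b c; exact: eigen_arg_lin.
- by move=> a x Pa /SG; exact: eigen_arg_int.
- move=> h Ph hS; apply: eigen_arg_eq0 => //; have [_ h1 _] := Ph.
  apply: (Sgen (fun g => h g = 0)) => //.
    by move=> g k Gg Gk hg hk; rewrite eigen_argM // hg hk addr0.
  move=> g Gg hg; apply/eqP; rewrite -[_ == 0](inj_eq (addIr (h g))).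
  by rewrite -eigen_argM // mulVg h1 hg addr0.
- by exists m, v, y; split=> // i; exact/SG/yS.
Qed.

Section Basis.
Variables (m : nat) (v : 'I_m -> H -> R) (y : 'I_m -> H).
Hypothesis Pv : forall i, eigen_arg (v i).
Hypothesis yG : forall i, y i \in Gamma.
Hypothesis vy0 : forall i, v i (y i) != 0.
Hypothesis vyt : forall i j : 'I_m, (j < i)%N -> v i (y j) = 0.

Lemma basis_unit : \matrix_(i, j) v j (y i) \in unitmx.
Proof.
rewrite unitmxE det_trig; last first.
  by apply/is_trig_mxP => i j ij; rewrite mxE vyt.
by rewrite unitfE; apply/prodf_neq0 => i _; rewrite mxE.
Qed.

Lemma basis_free (c : 'I_m -> R) :
  (forall x, \sum_i c i * v i x = 0) -> forall i, c i = 0.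
Proof.
move=> c0 i; pose M := \matrix_(i, j) v j (y i); pose u := \col_i c i.
have Mu : M *m u = 0.
  apply/colP => j; rewrite !mxE -[RHS](c0 (y j)).
  by apply: eq_bigr => k _; rewrite !mxE mulrC.
have : u = 0 by rewrite -[u](mulKmx basis_unit) -/M Mu mulmx0.
by move=> /colP/(_ i); rewrite !mxE.
Qed.

(** The winding numbers of a basis give [m] linear forms on the rationalized
    abelianization, which form a triangular matrix on the classes of the
    [y j]. *)
Lemma basis_rank : (m%:R%:E <= rank R (abelianization (subgroup Gamma)))%E.
Proof.
apply: ereal_sup_ubound; exists m => //.
pose g j : subgroup Gamma := Subgroup (yG j).
exists (fun j => tensor 1 (ab_pi (g j))) => c c0 i.
have scale_t (r : rat) a :
    r *: tensor 1 a = tensor r a :> rat_tensor (abelianization (subgroup Gamma)).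
  by rewrite -[LHS]/(tensor_scale _ _) tensor_scaleE /scale_sum /= mulr1.
have Mc k : \sum_j ratr (c j) * v k (y j) = 0.
  pose hab (a : abelianization (subgroup Gamma)) : R := v k (val (repr a)).
  have habE x : hab (ab_pi x) = v k (val x).
    have /ab_piP/(eigen_arg_derived (Pv k)) : ab_pi (repr (ab_pi x)) = ab_pi x.
      exact: ab_reprK.
    rewrite (eigen_arg_valM (Pv k)) (eigen_arg_valV (Pv k)) => /eqP.
    by rewrite addrC subr_eq0 => /eqP ->.
  have habD a b : hab (a + b) = hab a + hab b.
    by rewrite -(ab_reprK a) -(ab_reprK b) -ab_piD !habE (eigen_arg_valM (Pv k)).
  have [||f fD fE] := @tensor_universal (abelianization (subgroup Gamma)) R
      (fun r a => ratr r * hab a).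
  - by move=> r s a; rewrite rmorphD mulrDl.
  - by move=> r a b; rewrite habD mulrDr.
  have f0 : f 0 = 0 by apply: (addrI (f 0)); rewrite -fD !addr0.
  have := congr1 f c0; rewrite (big_morph f fD f0) f0 => fs; apply: etrans fs.
  apply: eq_bigr => j _.
  by rewrite scale_t fE habE.
pose M := \matrix_(i, j) v j (y i); pose u := \row_j ratr (c j) : 'rV[R]_m.
have uM : u *m M = 0.
  apply/rowP => k; rewrite !mxE -[RHS](Mc k).
  by apply: eq_bigr => j _; rewrite !mxE.
have : u = 0 by rewrite -[u](mulmxK basis_unit) -/M uM mul0mx.
by move=> /rowP/(_ i); rewrite !mxE => /eqP; rewrite fmorph_eq0 => /eqP.
Qed.

(** Functions on the factor are written with a section of the projection. *)
Variable sec : L -> H.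
Hypothesis secK : forall z, q (sec z) = z.

Section Descent.
Variable h : H -> R.
Hypothesis Ph : eigen_arg h.

Lemma cosp_arg_fiber x x' : q x = q x' ->
  cosp (h x) = cosp (h x') /\ sinp (h x) = sinp (h x').
Proof. by move=> xx'; apply: circ_eq_int; exact: eigen_arg_fiber. Qed.

Lemma cosp_arg_cont : continuous (fun z => cosp (h (sec z))).
Proof.
apply: proj_factor_quotient.
have -> : (fun x => cosp (h (sec (q x)))) = (fun x => cosp (h x)).
  by apply/funext => x; apply: (cosp_arg_fiber _).1; rewrite secK.
by have [ch _ _] := Ph; exact: cont_comp ch (@cosp_cont R).
Qed.

Lemma sinp_arg_cont : continuous (fun z => sinp (h (sec z))).
Proof.
apply: proj_factor_quotient.
have -> : (fun x => sinp (h (sec (q x)))) = (fun x => sinp (h x)).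
  by apply/funext => x; apply: (cosp_arg_fiber _).2; rewrite secK.
by have [ch _ _] := Ph; exact: cont_comp ch (@sinp_cont R).
Qed.

Lemma cospB_arg_cont b : continuous (fun z => cosp (h (sec z) - b)).
Proof.
under eq_fun do rewrite cospB.
by apply: cont_add; apply: cont_mul; try exact: cont_cst;
  [exact: cosp_arg_cont|exact: sinp_arg_cont].
Qed.

(** The mean [(u, w)] of a non-trivial eigenfunction is fixed by the rotations
    by its eigenvalues; were it non-zero, the eigenfunction would be invariant,
    hence constant. *)
Lemma mean_eigenfunction b : (exists x, h x != 0) ->
  mean actL (fun z => cosp (h (sec z) - b)) = 0.
Proof.
move=> [x0 hx0]; have [ch h1 hP] := Ph.
have cc := cosp_arg_cont; have cs := sinp_arg_cont.
pose u := mean actL (fun z => cosp (h (sec z))).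
pose w := mean actL (fun z => sinp (h (sec z))).
have rot g a : (forall x x', q x' = actL g (q x) -> h x' - h x - a \is a Num.int) ->
    forall z, cosp (h (sec (actL g z))) = cosp (h (sec z)) * cosp a - sinp (h (sec z)) * sinp a /\
              sinp (h (sec (actL g z))) = sinp (h (sec z)) * cosp a + cosp (h (sec z)) * sinp a.
  move=> aP z; rewrite -cospD -sinpD; apply: circ_eq_int.
  by rewrite opprD addrA; apply: aP; rewrite !secK.
have [uw0|uwn0] := eqVneq (u ^+ 2 + w ^+ 2) 0.
  have /andP[/eqP u0 /eqP w0] : (u == 0) && (w == 0).
    by rewrite -[u == 0]sqrf_eq0 -[w == 0]sqrf_eq0 -paddr_eq0 ?sqr_ge0 // uw0.
  under eq_fun do rewrite cospB [_ * cosp b]mulrC [_ * sinp b]mulrC.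
  by rewrite (meanD F) ?(meanZ F) -/u -/w ?u0 ?w0 ?mulr0 ?addr0 //; exact: cont_scale.
exfalso; move/eqP : hx0; apply.
have inv : invariant_fun act (fun k => cosp (h (sec (q0 k)))).
  move=> g k; rewrite q0eq; have [a aP] := hP g; have {}rot := rot g a aP.
  have uE : u = u * cosp a - w * sinp a.
    rewrite {1}/u -(mean_act F g cc); under eq_fun do rewrite (rot _).1 mulrC [_ * sinp a]mulrC.
    by rewrite (meanB F) ?(meanZ F) -/u -/w ?[_ * u]mulrC ?[_ * w]mulrC //; exact: cont_scale.
  have wE : w = w * cosp a + u * sinp a.
    rewrite {1}/w -(mean_act F g cs); under eq_fun do rewrite (rot _).2 mulrC [_ * sinp a]mulrC.
    by rewrite (meanD F) ?(meanZ F) -/u -/w ?[_ * u]mulrC ?[_ * w]mulrC //; exact: cont_scale.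
  have ca : cosp a = 1.
    apply/eqP; rewrite -subr_eq0; have /eqP : (cosp a - 1) * (u ^+ 2 + w ^+ 2) = 0.
      transitivity (u * (u * cosp a - w * sinp a) + w * (w * cosp a + u * sinp a) -
        (u ^+ 2 + w ^+ 2)); first by ring.
      by rewrite -uE -wE; ring.
    by rewrite mulf_eq0 (negbTE uwn0) orbF.
  have [_ sa] := cosp_int (cosp_eq1 ca).
  by rewrite (rot _).1 ca sa; ring.
have cinv : continuous (fun k => cosp (h (sec (q0 k)))).
  exact: cont_comp cq0 cosp_arg_cont.
have cst x : cosp (h x) = 1.
  have := real_invariant_cst cinv inv (pr x) (pr 1%g).
  have e y' : cosp (h (sec (q0 (pr y')))) = cosp (h y').
    by apply: (cosp_arg_fiber _).1; rewrite secK.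
  by rewrite !e h1 cosp0.
rewrite -h1; apply: (connected_int_cst Hc ch) => x.
exact: cosp_eq1.
Qed.

End Descent.

(** If the image of the factor in the torus missed a point [theta], then the
    kernel [prod_i (2 + 2 cos (v i - theta i))], whose maximum [4 ^ m] is
    attained only over [theta], would be at most [4 ^ m * rho] with [rho < 1].
    But the mean of its [n]-th power is, by orthogonality of eigenfunctions,
    a sum of squares of products of binomial coefficients, which is at least
    [4 ^ (m * n) / n.+1 ^ m]. *)
Lemma torus_map_surj (theta : 'I_m -> R) :
  exists x, forall i, v i x - theta i \is a Num.int.
Proof.
apply: contrapT => miss.
pose T z := \prod_i (2 + 2 * cosp (v i (sec z) - theta i)).
have fac_le (t : R) : 0 <= 2 + 2 * cosp t <= 4.
  have := cos_geN1 (pi *+ 2 * t); have := cos_le1 (pi *+ 2 * t); rewrite -/(cosp t).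
  by move=> ? ?; apply/andP; split; lra.
have T0 z : 0 <= T z by apply: prodr_ge0 => i _; have /andP[] := fac_le (v i (sec z) - theta i).
have Tlt z : T z < 4 ^+ m.
  have [i ni] : exists i, ~ (v i (sec z) - theta i \is a Num.int).
    apply: contrapT => none; apply: miss; exists (sec z) => i.
    by apply: contrapT => ni; apply: none; exists i.
  have lt4 : 2 + 2 * cosp (v i (sec z) - theta i) < 4.
    have /andP[_ le4] := fac_le (v i (sec z) - theta i).
    rewrite lt_neqAle le4 andbT; apply/eqP => e4; apply/ni/cosp_eq1.
    by move: e4; lra.
  rewrite /T (bigD1 i) //= -[m in 4 ^+ m]card_ord -prodr_const (bigD1 (P := predT) i) //=.
  have le : \prod_(j | j != i) (2 + 2 * cosp (v j (sec z) - theta j)) <=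
      \prod_(j : 'I_m | j != i) 4.
    by apply: ler_prod => j _; exact: fac_le.
  apply: (le_lt_trans (ler_wpM2l _ le)).
    by have /andP[] := fac_le (v i (sec z) - theta i).
  by rewrite ltr_pM2r // prodr_gt0.
have cfac i : continuous (fun z => 2 + 2 * cosp (v i (sec z) - theta i)).
  by apply: cont_add; [exact: cont_cst|apply: cont_scale; exact: cospB_arg_cont].
have cprod n : continuous (fun z => \prod_i (2 + 2 * cosp (v i (sec z) - theta i)) ^+ n).
  elim: (index_enum _) => [|i s IHs].
    by under eq_fun do rewrite big_nil; exact: cont_cst.
  by under eq_fun do rewrite big_cons; apply: cont_mul => //; exact: cont_exp.
have Tn n z : T z ^+ n = \prod_i (2 + 2 * cosp (v i (sec z) - theta i)) ^+ n.
  by rewrite prodrXl.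
have cT : continuous T.
  have -> : T = (fun z => \prod_i (2 + 2 * cosp (v i (sec z) - theta i)) ^+ 1).
    by apply/funext => z; rewrite -Tn expr1.
  exact: cprod.
have [rho [r0 r1 Trho]] : exists rho, [/\ 0 <= rho, rho < 1 & forall z, T z <= 4 ^+ m * rho].
  have cW : continuous (fun z => (4 ^+ m - T z)^-1).
    move=> z; apply: cvgV; first by rewrite subr_eq0 gt_eqF.
    by apply: cvgB; [exact: cvg_cst|exact: cT].
  have [B B0 BP] := compact_bounded_fun (emf_compact F) cW.
  exists (1 - B^-1 / 4 ^+ m).
  have TB z : T z <= 4 ^+ m - B^-1.
    rewrite lerBrDr addrC -lerBrDr -[leRHS]invrK lef_pV2 ?posrE ?invr_gt0 ?subr_gt0 //.
    by apply: le_trans (BP z); exact: ler_norm.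
  have m4 : 0 < 4 ^+ m :> R by rewrite exprn_gt0.
  split.
  - have := le_trans (T0 (q 1%g)) (TB (q 1%g)).
    by rewrite subr_ge0 => ?; rewrite subr_ge0 ler_pdivrMr // mul1r.
  - by rewrite gtrBl divr_gt0 // invr_gt0.
  - by move=> z; rewrite mulrBr mulr1 mulrCA divff ?gt_eqF // mulr1.
have [n nP] := exp_beats_poly m r0 r1.
pose idx := {ffun 'I_m -> 'I_n.+1}.
pose c (f f' : idx) i : int := (f i : nat)%:Z - (f' i : nat)%:Z.
pose h f f' x := \sum_i (c f f' i)%:~R * v i x.
have Ph f f' : eigen_arg (h f f') by exact: eigen_arg_comb.
pose b f f' := \sum_i (c f f' i)%:~R * theta i.
have tauE (f f' : idx) z :
    \sum_i (f i)%:R * (v i (sec z) - theta i) - \sum_i (f' i)%:R * (v i (sec z) - theta i)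
    = h f f' (sec z) - b f f'.
  rewrite /h /b -!sumrB; apply: eq_bigr => i _.
  by rewrite /c rmorphB /= -!pmulrn; ring.
have meanh f f' : mean actL (fun z => cosp (h f f' (sec z) - b f f')) = (f == f')%:R.
  have [<-|ff'] := eqVneq f f'.
    rewrite -[RHS](mean_cst F); congr (mean _ _); apply/funext => z.
    rewrite /h /b !big1 ?subrr ?cosp0 // => i _; by rewrite /c subrr mul0r.
  apply: mean_eigenfunction => //; apply: contrapT => hz.
  move/eqP : ff'; apply; apply/ffunP => i; apply: val_inj.
  have : ((c f f' i)%:~R : R) = 0.
    apply: (basis_free (c := fun i => (c f f' i)%:~R)) => x.
    by apply/eqP; apply: contrapT => /negP hx; apply: hz; exists x.
  move/eqP; rewrite intr_eq0 subr_eq0 => /eqP [].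
  by [].
have meanT : mean actL (fun z => T z ^+ n) = \sum_(f : idx) bincoef R f ^+ 2.
  under eq_fun do rewrite Tn cosine_kernel_expand.
  rewrite (mean_sum F) => [|f]; last first.
    apply: cont_sum => f'; apply: cont_scale.
    by under eq_fun do rewrite tauE; exact: cospB_arg_cont.
  apply: eq_bigr => f _; rewrite (mean_sum F) => [|f']; last first.
    by apply: cont_scale; under eq_fun do rewrite tauE; exact: cospB_arg_cont.
  transitivity (\sum_(f' : idx) bincoef R f * bincoef R f' * (f == f')%:R).
    apply: eq_bigr => f' _; under eq_fun do rewrite tauE.
    by rewrite (meanZ F) ?meanh //; exact: cospB_arg_cont.
  rewrite (bigD1 f) //= eqxx mulr1 expr2 big1 ?addr0 // => f' ff'.
  by rewrite eq_sym (negbTE ff') mulr0.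
have upper : mean actL (fun z => T z ^+ n) <= (4 ^+ m * rho) ^+ n.
  rewrite -[leRHS](mean_cst F); apply: (mean_le F); [exact: cont_exp|exact: cont_cst|].
  move=> z; apply: lerXn2r => //; rewrite nnegrE //.
  by rewrite mulr_ge0 // exprn_ge0.
have lower := @sum_sqr_ge R idx (@bincoef R m n).
rewrite sum_bincoef -meanT card_ffun !card_ord in lower.
have : 4 ^+ m ^+ n <= n.+1%:R ^+ m * (4 ^+ m * rho) ^+ n :> R.
  apply: (@le_trans _ _ ((n.+1 ^ m)%N%:R * mean actL (fun z => T z ^+ n))).
    have -> : 4 ^+ m ^+ n = (2 ^+ (n * m)) ^+ 2 :> R; last by [].
    have -> : (4 : R) = 2 ^+ 2 by rewrite -natrX.
    by rewrite -!exprM; congr (_ ^+ _); lia.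
  by rewrite natrX ler_pM2l // exprn_gt0.
rewrite exprMn mulrCA [_ ^+ m * rho ^+ n]mulrC -{1}[4 ^+ m ^+ n]mulr1 ler_pM2l ?exprn_gt0 //.
by rewrite leNgt nP.
Qed.

End Basis.

(** The arguments of a basis of eigenfunctions are coordinates on the factor:
    they separate points since all arguments do, and they fill the torus by
    [torus_map_surj]. In these coordinates [g] adds the arguments of its
    eigenvalues. *)
Lemma factor_torus_rotation : compact [set: coset_space Gamma] ->
  exists (m : nat) (rot : G -> torus R m -> torus R m),
    [/\ (m%:R%:E <= rank R (abelianization (subgroup Gamma)))%E,
        flow rot, minimal_flow rot, via_rotations rot
      & flow_isomorphic actL rot].
Proof.
move=> Kc; have [m [v [y [Pv yG vy0 vyt span]]]] := eigen_basis Kc.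
have /choice[sec secK] := proj_factor_surj.
pose row x : 'rV[R]_m := \row_i v i x.
pose Phi z : torus R m := torus_pr (row (sec z)).
have PhiE x : Phi (q x) = torus_pr (row x).
  by apply/torus_prP => i; rewrite !mxE; apply: eigen_arg_fiber => //; rewrite secK.
have cPhi : continuous Phi.
  apply: proj_factor_quotient.
  have -> : (fun x => Phi (q x)) = (fun x => torus_pr (row x)) by apply/funext.
  apply: cont_comp (@torus_pr_cont R m); apply: row_cont => i.
  by have [] := Pv i.
have Phi_inj : injective Phi.
  move=> z z' /torus_prP zz'; apply/eqP; apply: contrapT => /negP.
  rewrite -(secK z) -(secK z') => /eigen_arg_separates[h Ph]; apply.
  have [c hE] := span h Ph; rewrite !hE -sumrB rpred_sum // => i _.
  by rewrite -mulrBr rpredM ?intr_int //; have := zz' i; rewrite !mxE.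
have Phi_surj t : exists z, Phi z = t.
  have [u <-] := torus_pr_surj t.
  have [x xu] := torus_map_surj Pv vy0 vyt secK (fun i => u 0 i).
  by exists (q x); rewrite PhiE; apply/torus_prP => i; rewrite mxE.
have /choice[Psi PsiK] := Phi_surj.
have PhiK : cancel Phi Psi by move=> z; apply: Phi_inj; rewrite PsiK.
have PhiT : range Phi = [set: torus R m].
  by apply/seteqP; split=> // t _; exists (Psi t).
have cPsi : continuous Psi.
  apply: (compact_quotient_cont (emf_compact F) (@torus_hausdorff R m) cPhi PhiT).
  by under eq_fun do rewrite PhiK; move=> z; exact: cvg_id.
exists m, (fun g t => Phi (actL g (Psi t))); split.
- exact: basis_rank Pv yG vy0 vyt.
- split.
  + rewrite -PhiT; apply: continuous_compact; last exact: (emf_compact F).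
    exact: continuous_subspaceT.
  + exact: torus_hausdorff.
  + by move=> t; rewrite (flow_act1 Lflow) PsiK.
  + by move=> g h t; rewrite (flow_actM Lflow) PhiK.
  + apply: cont_comp cPhi.
    apply: (@cont_comp _ _ _ (fun p : G * torus R m => (p.1, Psi p.2))
      (fun p => actL p.1 p.2)); last exact: (flow_continuous Lflow).
    by apply: cont_pair; [exact: cont_fst|apply: cont_comp cPsi; exact: cont_snd].
- move=> t O [t1 Ot1] oO.
  have nO : nbhs (Psi t1) (Phi @^-1` O).
    by apply: cPhi; rewrite PsiK; apply: open_nbhs_nbhs.
  have [g gO] := emf_mini F (Psi t) nO.
  by exists (Phi (actL g (Psi t))); split=> //; exists g.
- move=> g; have /choice[a aP] : forall i, exists a : R, forall x x',
      q x' = actL g (q x) -> v i x' - v i x - a \is a Num.int.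
    by move=> i; have [_ _ /(_ g)] := Pv i.
  exists (torus_pr (\row_i a i)) => t.
  have [x xt] := proj_factor_surj (Psi t).
  have [x' xx'] := proj_factor_surj (actL g (Psi t)).
  rewrite -xx' PhiE -[t in RHS]PsiK -xt PhiE -torus_prD; apply/torus_prP => i.
  rewrite !mxE opprD addrA addrAC; apply: aP.
  by rewrite xx' xt.
- exists Phi, Psi; split=> // g z.
  by rewrite PhiK.
Qed.

End Arguments.

Theorem corollary3p4 (R : realType) (H : topGroupType) (Gamma : groupClosed H)
    (G : topGroupType) (act : G -> coset_space Gamma -> coset_space Gamma) :
  lie_group R H -> connected [set: H] -> simply_connected R H ->
  [set` Gamma] `<=` isolated [set` Gamma] ->
  compact [set: coset_space Gamma] ->
  (forall g h : G, commute g h) ->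
  flow act ->
  (forall f : coset_space Gamma -> R[i]^o,
     continuous f -> invariant_fun act f -> exists c, forall x, f x = c) ->
  forall (L : uniformType) (actL : G -> L -> L),
    flow actL -> is_factor act actL -> equicontinuous_flow actL ->
    exists (m : nat) (rot : G -> torus R m -> torus R m),
      [/\ (m%:R%:E <= rank R (abelianization (subgroup Gamma)))%E,
          flow rot, minimal_flow rot, via_rotations rot
        & flow_isomorphic actL rot].
Proof.
move=> HL Hc Hsc Gd Kc Gab Kflow Kinv L actL Lflow [q [cq qsurj qeq]] Leq.
exact: (factor_torus_rotation HL Hc Hsc Gd Gab Kflow Kinv Lflow Leq cq qsurj qeq Kc).
Qed.
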